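(* Let $n\ge 1$. Then $$C_{b,u}(\mathcal{F}^2)=\overline{\mathcal{W}^{2,\infty}(\mathcal{F}^2)},$$ where the closure is taken in the operator norm of $\mathcal{L}(\mathcal{F}^2)$.
   Context: $\mathcal{F}^2(\mathbb{C}^n)$ denotes the Fock space of entire functions on $\mathbb{C}^n$ that are square integrable with respect to $d\lambda(z)=e^{-\pi|z|^2}dz$, where $dz$ is Lebesgue measure. Its normalized reproducing kernels are $k_z(w)=e^{\pi\bar z w-\frac{\pi}{2}|z|^2}$, with $\bar z w=\sum_i \bar z_i w_i$. $\mathcal{L}(\mathcal{F}^2)$ denotes the bounded operators on $\mathcal{F}^2(\mathbb{C}^n)$. The Berezin transform of $S\in\mathcal{L}(\mathcal{F}^2)$ is $B(S)(z)=\langle Sk_z,k_z\rangle$. $\Delta=\sum_{i=1}^n\partial_{z_i}\partial_{\bar z_i}$. $\mathcal{W}^{2,\infty}(\mathcal{F}^2)$ is the set of all $S\in\mathcal{L}(\mathcal{F}^2)$ such that $\Delta B(S)=B(T)$ for some $T\in\mathcal{L}(\mathcal{F}^2)$. The Weyl operators are $W_zf(w)=k_z(w)f(w-z)$. $C_{b,u}(\mathcal{F}^2)$ is the set of all $S\in\mathcal{L}(\mathcal{F}^2)$ for which the map $z\mapsto W_zSW_z^*$ is continuous from $\mathbb{C}^n$ to $\mathcal{L}(\mathcal{F}^2)$ with the operator norm. *)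

(* Defs.v *)
From mathcomp Require Import all_boot all_order all_algebra.
Import Order.TTheory GRing.Theory Num.Theory.
From mathcomp Require Import all_classical all_reals all_analysis.
From mathcomp.real_closed Require Import complex.

Set Implicit Arguments.
Unset Strict Implicit.
Unset Printing Implicit Defensive.

Local Open Scope ring_scope.
Local Open Scope complex_scope.

Section Fock.
Variable R : realType.
Local Notation C := R[i].
Variable n : nat.

Definition Cn := 'rV[C]_n.

Definition cabs (z : C) : R := Normc.normc z.

Definition cexp (z : C) : C :=
  Complex (expR (Re z) * cos (Im z)) (expR (Re z) * sin (Im z)).

Definition dotc (z w : Cn) : C := \sum_(i < n) (z 0 i)^* * w 0 i.
Definition sqn (z : Cn) : R := \sum_(i < n) cabs (z 0 i) ^+ 2.

Definition ec (i : 'I_n) : Cn := delta_mx 0 i.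

(** Lebesgue measure on C^n = R^{2n}: integral of a function C^n -> \bar R,
    written as the iterated Lebesgue integral over the 2n real coordinates
    (Re w_k, Im w_k), k = n-1, ..., 0. *)
Definition upd (w : Cn) (k : nat) (c : C) : Cn :=
  \row_(j < n) (if (j : nat) == k then c else w 0 j).

Fixpoint iter_int (k : nat) (g : Cn -> \bar R) (w : Cn) : \bar R :=
  match k with
  | 0 => g w
  | k'.+1 => (\int[@lebesgue_measure R]_x
               \int[@lebesgue_measure R]_y iter_int k' g (upd w k' (Complex x y)))%E
  end.

Definition int_Cn (g : Cn -> \bar R) : \bar R := iter_int n g 0.

Definition gauss (w : Cn) : R := expR (- (pi * sqn w)).

(** entire functions on C^n: continuous and complex differentiable in each
    variable (holomorphic; by Osgood's lemma / Hartogs). *)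
Definition entire (f : Cn -> C) : Prop :=
  (forall z (eps : R), 0 < eps -> exists2 delta : R, 0 < delta &
     forall w, sqn (w - z) < delta -> cabs (f w - f z) < eps) /\
  (forall z (i : 'I_n), exists l : C, forall eps : R, 0 < eps ->
     exists2 delta : R, 0 < delta & forall h : C, 0 < cabs h < delta ->
       cabs ((f (z + h *: ec i) - f z) / h - l) < eps).

Definition fock_norm2 (f : Cn -> C) : \bar R :=
  int_Cn (fun w => (cabs (f w) ^+ 2 * gauss w)%:E).

Definition in_fock (f : Cn -> C) : Prop := entire f /\ (fock_norm2 f < +oo)%E.

Definition fock_norm (f : Cn -> C) : R := Num.sqrt (fine (fock_norm2 f)).

Definition fock_inner (f g : Cn -> C) : C :=
  let F := fun w => f w * (g w)^* * (gauss w)%:C in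
  Complex (fine (int_Cn (fun w => (Re (F w))%:E)))
          (fine (int_Cn (fun w => (Im (F w))%:E))).

Definition kz (z : Cn) : Cn -> C :=
  fun w => cexp ((pi : R)%:C * dotc z w - (pi / 2 * sqn z)%:C).

(** operators: maps on functions; only their action on F^2 matters *)
Definition op := (Cn -> C) -> (Cn -> C).

Definition bounded_op (S : op) : Prop :=
  (forall f, in_fock f -> in_fock (S f)) /\
  (forall (a : C) f g, in_fock f -> in_fock g ->
     S (fun w => a * f w + g w) = (fun w => a * S f w + S g w)) /\
  (exists M : R, forall f, in_fock f -> fock_norm (S f) <= M * fock_norm f).

Definition op_dist_le (S T : op) (eps : R) : Prop :=
  forall f, in_fock f -> fock_norm (fun w => S f w - T f w) <= eps * fock_norm f.

Definition berezin (S : op) (z : Cn) : C := fock_inner (S (kz z)) (kz z).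

Definition has_rderiv (F : Cn -> C) (z v : Cn) (l : C) : Prop :=
  forall eps : R, 0 < eps -> exists2 delta : R, 0 < delta &
    forall t : R, 0 < `|t| < delta ->
      cabs ((F (z + t%:C *: v) - F z) / t%:C - l) < eps.

(** Delta F = H everywhere, where
    Delta = sum_i d_{z_i} d_{\bar z_i} = 1/4 sum_i (d_{x_i}^2 + d_{y_i}^2),
    z_i = x_i + i y_i (classical second derivatives). *)
Definition laplacian_is (F H : Cn -> C) : Prop :=
  exists Dx Dy Dxx Dyy : 'I_n -> Cn -> C,
    (forall i z, has_rderiv F z (ec i) (Dx i z)) /\
    (forall i z, has_rderiv F z ('i *: ec i) (Dy i z)) /\
    (forall i z, has_rderiv (Dx i) z (ec i) (Dxx i z)) /\
    (forall i z, has_rderiv (Dy i) z ('i *: ec i) (Dyy i z)) /\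
    (forall z, H z = (4%:R^-1 : R)%:C * \sum_(i < n) (Dxx i z + Dyy i z)).

Definition W2inf (S : op) : Prop :=
  bounded_op S /\
  exists T : op, bounded_op T /\ laplacian_is (berezin S) (berezin T).

(** Weyl operators W_z f(w) = k_z(w) f(w - z);  W_z^* = W_{-z} *)
Definition weyl (z : Cn) : op := fun f w => kz z w * f (w - z).
Definition weyl_adj (z : Cn) : op := weyl (- z).

Definition Cbu (S : op) : Prop :=
  bounded_op S /\
  forall z (eps : R), 0 < eps -> exists2 delta : R, 0 < delta &
    forall z', sqn (z' - z) < delta ->
      op_dist_le (fun f => weyl z' (S (weyl_adj z' f)))
                 (fun f => weyl z (S (weyl_adj z f))) eps.

Definition W2inf_closure (S : op) : Prop :=
  bounded_op S /\
  forall eps : R, 0 < eps -> exists2 T : op, W2inf T & op_dist_le S T eps.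

End Fock.

(* Main.v *)
(* Write alpha_z(S) = W_z S W_z^*, so that B(alpha_z S)(w) = B(S)(w - z).

   Closure of W^{2,oo} is contained in C_{b,u}.  Since C_{b,u} is norm closed, take S with
   Delta B(S) = B(T).  Every matrix coefficient <A f, g> is, uniformly in A over norm balls, a limit of
   finite combinations of Berezin values B(A)(z_m): differentiating <A P K_z, Q K_z> in z along q and
   i q produces <A x_a P K_z, Q K_z> and <A P K_z, x_b Q K_z>, and the powers (1 + x_a/N)^N of the linear
   forms x_a converge to the kernels K_a, which span a dense subspace.  Hence <alpha_z(S) f, g> is uniformly
   close to a function of z which is bounded and has bounded Laplacian, with constants depending only on
   the norms of S and T.  The elementary barrier estimate for Poisson's equation makes such functions
   Lipschitz along the coordinate axes, and so is z |-> alpha_z(S) in operator norm.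

   C_{b,u} is contained in the closure.  For S in C_{b,u} the average \int_0^1 alpha_{s e}(S) ds is close
   to S when e is small, and its translates are differentiable along e with derivative
   alpha_e - 1 applied to S.  Averaging twice along each of the 2n coordinate axes
   gives an operator close to S all of whose second derivatives along the axes are bounded operators.

   The Hilbert space facts (reproducing kernel, completeness, density of the kernels) rest on the mean value
   property against the Gaussian, which follows from Goursat's theorem and rotation invariance
   in each coordinate. *)
Require Import Defs.
From HB Require Import structures.
From mathcomp Require Import all_boot all_order all_algebra.
Import Order.TTheory GRing.Theory Num.Theory.
From mathcomp Require Import all_classical all_reals all_analysis.
From mathcomp Require Import measurable_realfun.
From mathcomp.real_closed Require Import complex.
From mathcomp Require Import ring lra.
Import numFieldNormedType.Exports.

Set Implicit Arguments.
Unset Strict Implicit.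
Unset Printing Implicit Defensive.

Local Open Scope classical_set_scope.
Local Open Scope complex_scope.
Local Open Scope ring_scope.

(** * Complex numbers and entire functions *)

(** The condition defining [W2inf] concerns scalar functions, whereas the conclusion concerns
    operator norms, so the bridge between them must be uniform. A combination of Berezin values
    approximating one matrix coefficient has to do so for all translates of [S] at once, since
    nothing controls the coefficients of the combination and they may not enter the Lipschitz
    constant. They do not: translation preserves norms, and the Poisson estimate uses only sup
    bounds of the function and of its Laplacian. As [laplacian_is] gives second derivatives along
    the axes without any continuity, that estimate is a maximum principle for symmetric second
    differences. In the other direction the phases of the Weyl relations cancel, so translations of
    operators commute, and averaging along one axis keeps the derivatives already gained along the
    others. An [op] acts on arbitrary functions but is controlled only on the Fock space; identities
    between operators hold on Fock functions and are carried into norm estimates by [dle_eq]. *)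

Section ComplexBasics.
Variable R : realType.
Local Notation C := R[i].
Implicit Types (x y z : C) (r s t : R).

Lemma eqReIm x y : Re x = Re y -> Im x = Im y -> x = y.
Proof. by case: x y => [a b] [c d] /= -> ->. Qed.

Lemma ReD x y : Re (x + y) = Re x + Re y. Proof. by case: x y => [a b] [c d]. Qed.
Lemma ImD x y : Im (x + y) = Im x + Im y. Proof. by case: x y => [a b] [c d]. Qed.
Lemma ReN x : Re (- x) = - Re x. Proof. by case: x. Qed.
Lemma ImN x : Im (- x) = - Im x. Proof. by case: x. Qed.
Lemma ReM x y : Re (x * y) = Re x * Re y - Im x * Im y.
Proof. by case: x y => [a b] [c d]. Qed.
Lemma ImM x y : Im (x * y) = Re x * Im y + Im x * Re y.
Proof. by case: x y => [a b] [c d]. Qed.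
Lemma Re_conj x : Re (x^*) = Re x. Proof. by case: x. Qed.
Lemma Im_conj x : Im (x^*) = - Im x. Proof. by case: x. Qed.
Lemma Re_real r : Re (r%:C : C) = r. Proof. by []. Qed.
Lemma Im_real r : Im (r%:C : C) = 0. Proof. by []. Qed.

Lemma Re_i : Re ('i : C) = 0. Proof. by []. Qed.
Lemma Im_i : Im ('i : C) = 1. Proof. by []. Qed.
Lemma Re_1 : Re (1 : C) = 1. Proof. by []. Qed.
Lemma Im_1 : Im (1 : C) = 0. Proof. by []. Qed.
Lemma Re_0 : Re (0 : C) = 0. Proof. by []. Qed.
Lemma Im_0 : Im (0 : C) = 0. Proof. by []. Qed.

Definition ReImE := (ReD, ImD, ReN, ImN, ReM, ImM, Re_conj, Im_conj, Re_real, Im_real,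
  Re_i, Im_i, Re_1, Im_1, Re_0, Im_0).

Lemma conjD x y : (x + y)^* = x^* + y^*.
Proof. by apply: eqReIm; rewrite !ReImE //= opprD. Qed.
Lemma conjN x : (- x)^* = - x^*. Proof. by apply: eqReIm; rewrite !ReImE. Qed.
Lemma conjM x y : (x * y)^* = x^* * y^*.
Proof. by apply: eqReIm; rewrite !ReImE //; ring. Qed.
Lemma conj_real r : (r%:C : C)^* = r%:C. Proof. by apply: eqReIm; rewrite !ReImE ?oppr0. Qed.
Lemma conj0 : (0 : C)^* = 0. Proof. exact: conj_real. Qed.
Lemma conjI : ('i : C)^* = - 'i. Proof. by apply: eqReIm; rewrite !ReImE //= oppr0. Qed.
Lemma realCD r s : ((r + s)%:C : C) = r%:C + s%:C. Proof. by apply: eqReIm; rewrite !ReImE ?addr0. Qed.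
Lemma realCN r : ((- r)%:C : C) = - r%:C. Proof. by apply: eqReIm; rewrite !ReImE ?oppr0. Qed.
Lemma realCB r s : ((r - s)%:C : C) = r%:C - s%:C. Proof. by rewrite realCD realCN. Qed.
Lemma realCM r s : ((r * s)%:C : C) = r%:C * s%:C. Proof. by apply: eqReIm; rewrite !ReImE; ring. Qed.
Lemma realC1 : ((1 : R)%:C : C) = 1. Proof. by []. Qed.
Lemma realC0 : ((0 : R)%:C : C) = 0. Proof. by []. Qed.
Lemma realCV r : ((r^-1)%:C : C) = (r%:C)^-1.
Proof.
have [->|r0] := eqVneq r 0; first by rewrite invr0 realC0 invr0.
have rC0 : (r%:C : C) != 0 by rewrite eq_complex /= (negbTE r0).
apply: (mulIf rC0); rewrite mulVf // -realCM mulVf //.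
Qed.

Lemma Re_sum (I : Type) (s : seq I) (P : pred I) (F : I -> C) :
  Re (\sum_(i <- s | P i) F i) = \sum_(i <- s | P i) Re (F i).
Proof. by elim/big_rec2: _ => //= i a b _ <-; rewrite ReD. Qed.

Lemma cabs_ge0 z : 0 <= cabs z. Proof. by case: z => a b; exact: sqrtr_ge0. Qed.
Lemma cabs_sq z : cabs z ^+ 2 = Re z ^+ 2 + Im z ^+ 2.
Proof. by case: z => a b; rewrite /cabs /= sqr_sqrtr // addr_ge0 // sqr_ge0. Qed.
Lemma cabs0 : cabs (0 : C) = 0. Proof. exact: Normc.normc0. Qed.
Lemma cabs1 : cabs (1 : C) = 1. Proof. exact: Normc.normc1. Qed.
Lemma cabsM x y : cabs (x * y) = cabs x * cabs y. Proof. exact: Normc.normcM. Qed.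
Lemma cabsV x : cabs x^-1 = (cabs x)^-1. Proof. exact: Normc.normcV. Qed.
Lemma cabsX x n : cabs (x ^+ n) = cabs x ^+ n.
Proof. by elim: n => [|n IH]; rewrite ?expr0 ?cabs1 // !exprS cabsM IH. Qed.
Lemma cabs_eq0 z : cabs z = 0 -> z = 0. Proof. exact: Normc.eq0_normc. Qed.
Lemma cabs_gt0 z : z != 0 -> 0 < cabs z.
Proof.
by move=> z0; rewrite lt_def cabs_ge0 andbT; apply: contra z0 => /eqP/cabs_eq0 ->.
Qed.
Lemma cabsN z : cabs (- z) = cabs z.
Proof. by case: z => a b; rewrite /cabs /= !sqrrN. Qed.
Lemma cabsB x y : cabs (x - y) = cabs (y - x). Proof. by rewrite -cabsN opprB. Qed.
Lemma cabs_conj z : cabs z^* = cabs z.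
Proof. by case: z => a b; rewrite /cabs /= sqrrN. Qed.
Lemma cabs_real r : cabs (r%:C : C) = `|r|.
Proof. by rewrite /cabs /= expr0n /= addr0 sqrtr_sqr. Qed.
Lemma cabsI : cabs ('i : C) = 1.
Proof. by rewrite /cabs /= expr0n /= add0r expr1n sqrtr1. Qed.

Lemma Re_le_cabs z : `|Re z| <= cabs z.
Proof.
rewrite -(@ler_pXn2r _ 2) ?nnegrE ?cabs_ge0 // cabs_sq real_normK ?num_real //.
by rewrite lerDl sqr_ge0.
Qed.
Lemma Im_le_cabs z : `|Im z| <= cabs z.
Proof.
rewrite -(@ler_pXn2r _ 2) ?nnegrE ?cabs_ge0 // cabs_sq real_normK ?num_real //.
by rewrite lerDr sqr_ge0.
Qed.
Lemma Re_lec z : Re z <= cabs z. Proof. exact: le_trans (ler_norm _) (Re_le_cabs _). Qed.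

Lemma cabsD x y : cabs (x + y) <= cabs x + cabs y.
Proof.
rewrite -(@ler_pXn2r _ 2) ?nnegrE ?addr_ge0 ?cabs_ge0 //.
have h : Re (x * y^*) <= cabs x * cabs y by rewrite -(cabs_conj y) -cabsM Re_lec.
move: h; rewrite sqrrD !cabs_sq !ReImE; lra.
Qed.
Lemma cabsBD x y : cabs (x - y) <= cabs x + cabs y.
Proof. by rewrite -(cabsN y); exact: cabsD. Qed.
Lemma cabs_tri z x y : cabs (x - y) <= cabs (x - z) + cabs (z - y).
Proof. by have := cabsD (x - z) (z - y); rewrite addrA subrK. Qed.
Lemma cabsBB x y : cabs x - cabs y <= cabs (x - y).
Proof. by rewrite lerBlDr; have := cabsD (x - y) y; rewrite subrK. Qed.
Lemma cabs_le_ReIm z : cabs z <= `|Re z| + `|Im z|.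
Proof.
rewrite -(@ler_pXn2r _ 2) ?nnegrE ?addr_ge0 ?cabs_ge0 //.
rewrite sqrrD cabs_sq !real_normK ?num_real //.
by rewrite lerD2r lerDl mulrn_wge0 // mulr_ge0.
Qed.
Lemma cabs_sum (I : Type) (s : seq I) (P : pred I) (F : I -> C) :
  cabs (\sum_(i <- s | P i) F i) <= \sum_(i <- s | P i) cabs (F i).
Proof.
elim/big_rec2: _ => [|i a b _ h]; first by rewrite cabs0.
exact: le_trans (cabsD _ _) (lerD _ h).
Qed.
Lemma mul_conj z : z * z^* = (cabs z ^+ 2)%:C.
Proof. by apply: eqReIm; rewrite !ReImE ?cabs_sq; ring. Qed.

Lemma cexpD x y : cexp (x + y) = cexp x * cexp y.
Proof. by apply: eqReIm; rewrite ?ReM ?ImM /cexp /= !ReImE expRD ?cosD ?sinD; ring. Qed.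
Lemma cexp0 : cexp (0 : C) = 1.
Proof. by apply: eqReIm; rewrite /cexp /= expR0 ?cos0 ?sin0 ?mulr1 ?mulr0. Qed.
Lemma cabs_cexp z : cabs (cexp z) = expR (Re z).
Proof.
apply/eqP; rewrite -(@eqrXn2 _ 2) ?cabs_ge0 ?expR_ge0 // cabs_sq /cexp /=.
by rewrite !exprMn -mulrDr cos2Dsin2 mulr1.
Qed.
Lemma cexpX z n : cexp z ^+ n = cexp (n%:R * z).
Proof.
elim: n => [|n IH]; first by rewrite mul0r cexp0.
by rewrite exprS IH -cexpD -{1}(mul1r z) -mulrDl nat1r.
Qed.

Lemma is_derive_mulr_id (a t : R) : is_derive t 1 (fun u : R => u * a) a.
Proof.
have -> : (fun u : R => u * a) = a \*: (id : R -> R) by apply/funext => u /=; rewrite /GRing.scale /= mulrC.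
by apply: is_derive_eq; rewrite /GRing.scale /= mulr1.
Qed.
Lemma is_derive_expM (a t : R) : is_derive t 1 (fun u : R => expR (u * a)) (a * expR (t * a)).
Proof.
rewrite mulrC; exact: (@is_derive1_comp _ expR _ t _ _ (is_derive_expR _) (is_derive_mulr_id a t)).
Qed.
Lemma is_derive_cosM (a t : R) : is_derive t 1 (fun u : R => cos (u * a)) (- a * sin (t * a)).
Proof.
rewrite mulNr mulrC -mulNr.
exact: (@is_derive1_comp _ cos _ t _ _ (is_derive_cos _) (is_derive_mulr_id a t)).
Qed.
Lemma is_derive_sinM (a t : R) : is_derive t 1 (fun u : R => sin (u * a)) (a * cos (t * a)).
Proof.
rewrite mulrC; exact: (@is_derive1_comp _ sin _ t _ _ (is_derive_sin _) (is_derive_mulr_id a t)).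
Qed.

(** The mean value theorem applied twice; the factor 1/2 of Taylor's formula is given up, since only
    the order of the bound matters. *)
Lemma taylor2_bound (f f1 f2 : R -> R) (M : R) :
  (forall t, is_derive t 1 f (f1 t)) -> (forall t, is_derive t 1 f1 (f2 t)) ->
  (forall t, 0 <= t <= 1 -> `|f2 t| <= M) ->
  `|f 1 - f 0 - f1 0| <= M.
Proof.
move=> d1 d2 b.
have c (g g' : R -> R) (d : forall t, is_derive t 1 g (g' t)) a e :
    {within `[a, e]%classic, continuous g}.
  apply: derivable_within_continuous => x _; by have [] := d x.
have [x /[!in_itv] /andP [x0 x1]] := @MVT _ f f1 0 1 ltr01 (fun t _ => d1 t) (c _ _ d1 _ _).
rewrite subr0 mulr1 => ->.
have [y /[!in_itv] /andP [y0 y1]] := @MVT _ f1 f2 0 x x0 (fun t _ => d2 t) (c _ _ d2 _ _).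
rewrite subr0 => ->.
rewrite normrM (gtr0_norm x0).
have := b y; rewrite (ltW y0) (ltW (lt_trans y1 x1)) => /(_ isT) h.
by rewrite -[leRHS]mulr1; apply: ler_pM => //; exact: ltW.
Qed.

(** Functions e^(ta) (p cos tb + q sin tb) are closed under differentiation in t: (p, q) becomes (ap
    + bq, aq - bp), a vector longer by the factor |h|. Hence the second derivative is at most |h|^2
    e^|h| on [0, 1]. The choice (1, 0) gives the real part of [cexp], (0, 1) the imaginary part. *)
Let cexp_ReIm_bound (h : C) : 
  `|Re (cexp h) - 1 - Re h| <= cabs h ^+ 2 * expR (cabs h) /\
  `|Im (cexp h) - Im h| <= cabs h ^+ 2 * expR (cabs h).
Proof.
case: h => a b.
set M := _ * _.
have key (t : R) : 0 <= t <= 1 -> expR (t * a) <= expR (cabs (Complex a b)).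
  move=> /andP[t0 t1]; rewrite ler_expR.
  apply: le_trans (Re_le_cabs _) => /=.
  apply: le_trans (ler_norm _) _; rewrite normrM (ger0_norm t0).
  by rewrite ler_piMl.
pose e t : R := expR (t * a). pose co t : R := cos (t * b). pose si t : R := sin (t * b).
have B (p q : R) (t : R) : 0 <= t <= 1 -> p ^+ 2 + q ^+ 2 <= (cabs (Complex a b) ^+ 2) ^+ 2 ->
   `|e t * (p * co t + q * si t)| <= M.
  move=> t01 pq; rewrite normrM (ger0_norm (expR_ge0 _)) /M mulrC.
  apply: ler_pM; [exact: normr_ge0 | exact: expR_ge0 | | exact: key].
  rewrite -(@ler_pXn2r _ 2) ?nnegrE ?exprn_ge0 ?cabs_ge0 //.
  apply: le_trans pq; rewrite real_normK ?num_real //.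
  have := cos2Dsin2 (t * b); rewrite -/(co t) -/(si t).
  have : 0 <= (p * si t - q * co t) ^+ 2 by exact: sqr_ge0.
  nra.
have C4 : (cabs (Complex a b) ^+ 2) ^+ 2 = (a ^+ 2 - b ^+ 2) ^+ 2 + (2 * a * b) ^+ 2.
  by rewrite cabs_sq /=; ring.
have D (p q t : R) : is_derive t 1 (fun t => e t * (p * co t + q * si t))
    (e t * ((a * p + b * q) * co t + (a * q - b * p) * si t)).
  have -> : (fun t => e t * (p * co t + q * si t)) = e * (p \*: co + q \*: si).
    by apply/funext => u.
  have De : is_derive t 1 e _ := is_derive_expM a t.
  have Dc : is_derive t 1 co _ := is_derive_cosM b t.
  have Ds : is_derive t 1 si _ := is_derive_sinM b t.
  apply: (is_derive_eq (is_deriveM De (is_deriveD (is_deriveZ p Dc) (is_deriveZ q Ds)))).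
  change (e t * (p * (- b * si t) + q * (b * co t)) + (p * co t + q * si t) * (a * e t)
    = e t * ((a * p + b * q) * co t + (a * q - b * p) * si t)); ring.
have e0 : e 0 = 1 by rewrite /e mul0r expR0.
have co0 : co 0 = 1 by rewrite /co mul0r cos0.
have si0 : si 0 = 0 by rewrite /si mul0r sin0.
have D2 p q t : is_derive t 1 (fun t => e t * ((a * p + b * q) * co t + (a * q - b * p) * si t))
    (e t * (((a ^+ 2 - b ^+ 2) * p + 2 * a * b * q) * co t + ((a ^+ 2 - b ^+ 2) * q - 2 * a * b * p) * si t)).
  by apply: (eq_ind _ (is_derive t 1 _) (D _ _ t)); congr (_ * (_ * _ + _ * _)); ring.
have T p q : p ^+ 2 + q ^+ 2 = 1 -> `|e 1 * (p * co 1 + q * si 1) - p - (a * p + b * q)| <= M.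
  move=> pq; have := taylor2_bound (D p q) (D2 p q).
  rewrite e0 co0 si0 !mulr0 !addr0 !mulr1 !mul1r; apply => t t01.
  apply: B => //; rewrite C4 -[leRHS]mulr1 -pq; rewrite le_eqVlt; apply/orP; left; apply/eqP; ring.
split.
- have := T 1 0; rewrite /e /co /si !mul1r !mul0r !mulr0 !addr0 !mulr1; apply; ring.
- have := T 0 1; rewrite /e /co /si !mul1r !mul0r !mulr0 !add0r !mulr1 subr0; apply; ring.
Qed.

Lemma cexp_taylor1 (h : C) : cabs (cexp h - 1 - h) <= 2 * (cabs h ^+ 2 * expR (cabs h)).
Proof.
have [h1 h2] := cexp_ReIm_bound h.
apply: le_trans (cabs_le_ReIm _) _.
rewrite mulr_natl mulr2n; apply: lerD.
  by rewrite !ReImE.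
by rewrite !ReImE /= subr0.
Qed.
Lemma cexp_sub1 (h : C) : cabs (cexp h - 1) <= cabs h * (1 + 2 * cabs h * expR (cabs h)).
Proof.
have := cexp_taylor1 h; have := cabsD (cexp h - 1 - h) h; rewrite subrK; lra.
Qed.
End ComplexBasics.

(** * Continuous and entire functions on C^n *)

Section Cn.
Variables (R : realType) (n : nat).
Local Notation C := R[i].
Local Notation V := (Cn R n).
Implicit Types (z w a : V) (f g : V -> C).

Lemma dotcDr a z w : dotc a (z + w) = dotc a z + dotc a w.
Proof. by rewrite /dotc -big_split; apply: eq_bigr => i _; rewrite mxE mulrDr. Qed.
Lemma dotcDl a z w : dotc (z + w) a = dotc z a + dotc w a.
Proof. by rewrite /dotc -big_split; apply: eq_bigr => i _; rewrite mxE conjD mulrDl. Qed.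
Lemma dotcZr a (c : C) w : dotc a (c *: w) = c * dotc a w.
Proof. by rewrite /dotc mulr_sumr; apply: eq_bigr => i _; rewrite mxE mulrCA. Qed.
Lemma dotcZl a (c : C) w : dotc (c *: a) w = c^* * dotc a w.
Proof. by rewrite /dotc mulr_sumr; apply: eq_bigr => i _; rewrite mxE conjM mulrA. Qed.
Lemma dotcNr a w : dotc a (- w) = - dotc a w.
Proof. by rewrite -scaleN1r dotcZr mulN1r. Qed.
Lemma dotcNl a w : dotc (- a) w = - dotc a w.
Proof. by rewrite -scaleN1r dotcZl conjN -[1](realC1 R) conj_real realC1 mulN1r. Qed.
Lemma dotc0r a : dotc a 0 = 0.
Proof. by rewrite -(scale0r 0) dotcZr mul0r. Qed.
Lemma dotc0l a : dotc 0 a = 0.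
Proof. by rewrite -(scale0r 0) dotcZl conj0 mul0r. Qed.
Lemma dotcC a w : dotc w a = (dotc a w)^*.
Proof.
rewrite /dotc (big_morph _ (@conjD R) (conj0 R)).
by apply: eq_bigr => i _; rewrite conjM conjCK mulrC.
Qed.
Lemma dotcc w : dotc w w = (sqn w)%:C.
Proof.
rewrite /dotc /sqn; elim/big_rec2: _ => // i x y _ ->.
by rewrite realCD mulrC mul_conj.
Qed.
Lemma sqn_ge0 w : 0 <= sqn w.
Proof. by apply: sumr_ge0 => i _; rewrite exprn_ge0 // cabs_ge0. Qed.
Lemma sqn0 : sqn (0 : V) = 0.
Proof. by rewrite /sqn big1 // => i _; rewrite mxE cabs0 expr0n. Qed.
Lemma sqnN w : sqn (- w) = sqn w.
Proof. by apply: eq_bigr => i _; rewrite mxE cabsN. Qed.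
Lemma sqnZ (c : C) w : sqn (c *: w) = cabs c ^+ 2 * sqn w.
Proof. by rewrite /sqn mulr_sumr; apply: eq_bigr => i _; rewrite mxE cabsM exprMn. Qed.
Lemma sqnD z w : sqn (z + w) = sqn z + sqn w + 2 * Re (dotc z w).
Proof.
apply: (@complexI R); rewrite -dotcc dotcDl !dotcDr !dotcc (dotcC z w).
by apply: eqReIm; rewrite !ReImE ?Re_real ?Im_real; ring.
Qed.
Lemma coord_le_sqn w i : cabs (w 0 i) ^+ 2 <= sqn w.
Proof.
rewrite /sqn (bigD1 i) //= lerDl; apply: sumr_ge0 => j _.
by rewrite exprn_ge0 // cabs_ge0.
Qed.
Lemma sqnD_le z w : sqn (z + w) <= 2 * sqn z + 2 * sqn w.
Proof.
have := sqn_ge0 (z - w); have := sqnD z w; have := sqnD z (- w).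
rewrite dotcNr sqnN ReN; lra.
Qed.
Lemma ecE (i j : 'I_n) : ec R i 0 j = (i == j)%:R.
Proof. by rewrite /ec mxE /= eq_sym. Qed.

Definition ccont f := forall z (eps : R), 0 < eps -> exists2 delta : R, 0 < delta &
     forall w, sqn (w - z) < delta -> cabs (f w - f z) < eps.
(** The derivative at 0 in a form without division, which includes h = 0 and makes the product rule
    an algebraic identity plus estimates. *)
Definition cder (g : C -> C) (l : C) := forall eps : R, 0 < eps ->
  exists2 delta : R, 0 < delta & forall h, cabs h < delta ->
    cabs (g h - g 0 - h * l) <= eps * cabs h.

Lemma entireP f : entire f <->
  ccont f /\ forall z i, exists l, cder (fun h => f (z + h *: ec R i)) l.
Proof.
split=> -[c d]; split=> // z i; have [l dl] := d z i; exists l => e e0.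
- have [del del0 H] := dl _ e0; exists del => // h hd; rewrite scale0r addr0.
  have [->|h0] := eqVneq h 0.
    by rewrite scale0r addr0 subrr mul0r subr0 cabs0 mulr0.
  have := H h; rewrite hd cabs_gt0 // => /(_ isT) H1.
  have -> : f (z + h *: ec R i) - f z - h * l = ((f (z + h *: ec R i) - f z) / h - l) * h.
    by rewrite [RHS]mulrBl divfK // [l * h]mulrC.
  by rewrite cabsM ler_wpM2r ?cabs_ge0 // ltW.
- have [del del0 H] := dl _ (divr_gt0 e0 (ltr0n _ 2)); exists del => // h /andP[h0 hd].
  have hn : h != 0 by apply: contraTN h0 => /eqP ->; rewrite cabs0 ltxx.
  have := H h hd; rewrite scale0r addr0 => H1.
  have -> : (f (z + h *: ec R i) - f z) / h - l = (f (z + h *: ec R i) - f z - h * l) / h.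
    by rewrite [RHS]mulrBl [h * l]mulrC mulfK.
  rewrite cabsM cabsV ltr_pdivrMr //; apply: le_lt_trans H1 _.
  by rewrite ltr_pM2r // ltr_pdivrMr // ltr_pMr // ltr1n.
Qed.

Lemma ccont_cst (c : C) : ccont (fun=> c).
Proof. by move=> z e e0; exists 1 => // w _; rewrite subrr cabs0. Qed.
Lemma ccontD f g : ccont f -> ccont g -> ccont (fun w => f w + g w).
Proof.
move=> cf cg z e e0; have e2 : 0 < e / 2 by rewrite divr_gt0.
have [d1 d10 H1] := cf z _ e2; have [d2 d20 H2] := cg z _ e2.
exists (Num.min d1 d2); first by rewrite lt_min d10.
move=> w; rewrite lt_min => /andP[/H1 h1 /H2 h2].
rewrite opprD addrACA; apply: le_lt_trans (cabsD _ _) _; lra.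
Qed.
Lemma ccontM f g : ccont f -> ccont g -> ccont (fun w => f w * g w).
Proof.
move=> cf cg z e e0.
have af := cabs_ge0 (f z); have ag := cabs_ge0 (g z).
pose K := 1 + cabs (f z) + cabs (g z).
have K0 : 0 < K by rewrite /K; lra.
pose e1 := Num.min 1 (e / (2 * K)).
have e10 : 0 < e1 by rewrite lt_min ltr01 divr_gt0 // mulr_gt0.
have [d1 d10 H1] := cf z _ e10; have [d2 d20 H2] := cg z _ e10.
exists (Num.min d1 d2); first by rewrite lt_min d10.
move=> w; rewrite lt_min => /andP[/H1 h1 /H2 h2].
have -> : f w * g w - f z * g z = (f w - f z) * (g w - g z) + (f w - f z) * g z + f z * (g w - g z).
  ring.
apply: le_lt_trans (cabsD _ _) _.
apply: le_lt_trans (lerD (cabsD _ _) (lexx _)) _; rewrite !cabsM.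
have b1 : e1 <= 1 by rewrite ge_min lexx.
have b2 : e1 * K <= e / 2.
  by rewrite -ler_pdivlMr // -mulrA -invfM ge_min lexx orbT.
have x0 := cabs_ge0 (f w - f z); have y0 := cabs_ge0 (g w - g z).
set x := cabs (f w - f z) in h1 x0 *; set y := cabs (g w - g z) in h2 y0 *.
apply: (@le_lt_trans _ _ (e1 * K)); last by apply: le_lt_trans b2 _; lra.
rewrite /K; nra.
Qed.
Lemma ccont_coord i : ccont (fun w => w 0 i).
Proof.
move=> z e e0; exists (e ^+ 2); first by rewrite exprn_gt0.
move=> w h; have := le_lt_trans (coord_le_sqn (w - z) i) h.
by rewrite !mxE ltr_pXn2r // nnegrE ?cabs_ge0 // ltW.
Qed.
Lemma ccont_sum (I : Type) (s : seq I) (P : pred I) (F : I -> V -> C) :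
  (forall i, ccont (F i)) -> ccont (fun w => \sum_(i <- s | P i) F i w).
Proof.
move=> cF; elim: s => [|x s IH].
  have -> : (fun w => \sum_(i <- [::] | P i) F i w) = fun=> 0.
    by apply/funext => w; rewrite big_nil.
  exact: ccont_cst.
have -> : (fun w => \sum_(i <- x :: s | P i) F i w) =
  fun w => (if P x then F x w else 0) + \sum_(i <- s | P i) F i w.
  by apply/funext => w; rewrite big_cons; case: ifP => // _; rewrite add0r.
apply: ccontD => //; case: (P x) => //; exact: ccont_cst.
Qed.
Lemma ccont_dotc a : ccont (dotc a).
Proof.
apply: (@ccont_sum _ _ _ (fun i w => (a 0 i)^* * w 0 i)) => i.
by apply: ccontM; [exact: ccont_cst | exact: ccont_coord].
Qed.
Lemma ccont_cexp f : ccont f -> ccont (fun w => cexp (f w)).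
Proof.
move=> cf z e e0; pose K := 1 + 2 * expR 1 : R.
have K0 : 0 < K by rewrite /K; have := expR_gt0 (1 : R); lra.
have L0 : 0 < cabs (cexp (f z)) by rewrite cabs_cexp expR_gt0.
pose e1 := Num.min 1 (e / (2 * K * cabs (cexp (f z)))).
have e10 : 0 < e1 by rewrite lt_min ltr01 divr_gt0 // !mulr_gt0.
have [d d0 H] := cf z _ e10; exists d => // w /H h.
have -> : cexp (f w) - cexp (f z) = (cexp (f w - f z) - 1) * cexp (f z).
  by rewrite mulrBl mul1r -cexpD subrK.
have b1 : e1 <= 1 by rewrite ge_min lexx.
have b2 : e1 * K * cabs (cexp (f z)) <= e / 2.
  rewrite -mulrA -ler_pdivlMr ?mulr_gt0 // -mulrA -invfM ge_min.
  by apply/orP; right; rewrite mulrA.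
rewrite cabsM; apply: le_lt_trans (ler_wpM2r (ltW L0) (cexp_sub1 _)) _.
set x := cabs (f w - f z) in h *; have x0 : 0 <= x by exact: cabs_ge0.
apply: (@le_lt_trans _ _ (e1 * K * cabs (cexp (f z)))); last by apply: le_lt_trans b2 _; lra.
rewrite ler_wpM2r ?(ltW L0) //.
have x1 : x <= 1 by apply: ltW; apply: lt_le_trans h b1.
have E : expR x <= expR 1 by rewrite ler_expR.
have E0 := expR_gt0 x.
apply: ler_pM => //; [|exact: ltW|].
  by rewrite addr_ge0 // !mulr_ge0 // ltW.
rewrite /K lerD2l -mulrA ler_wpM2l //.
by rewrite -[leRHS]mul1r; apply: ler_pM => //; exact: ltW.
Qed.
Lemma ccont_comp f (T : V -> V) (K : R) : 0 < K -> (forall z w, sqn (T w - T z) <= K * sqn (w - z)) ->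
  ccont f -> ccont (f \o T).
Proof.
move=> K0 HT cf z e e0; have [d d0 H] := cf (T z) _ e0; exists (d / K); first by rewrite divr_gt0.
move=> w h; apply: H; apply: le_lt_trans (HT _ _) _.
by rewrite mulrC -ltr_pdivlMr.
Qed.

Lemma cder_cst (c : C) : cder (fun=> c) 0.
Proof.
by move=> e e0; exists 1 => // h _; rewrite subrr mulr0 subr0 cabs0 mulr_ge0 ?cabs_ge0 // ltW.
Qed.
Lemma cder_affine (g : C -> C) (l : C) : (forall h, g h = g 0 + h * l) -> cder g l.
Proof.
move=> gl e e0; exists 1 => // h _.
have -> : g h - g 0 - h * l = 0 by rewrite gl; ring.
by rewrite cabs0 mulr_ge0 ?cabs_ge0 // ltW.
Qed.
Lemma cderD (g k : C -> C) l m : cder g l -> cder k m -> cder (fun h => g h + k h) (l + m).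
Proof.
move=> dg dk e e0; have e2 : 0 < e / 2 by rewrite divr_gt0.
have [d1 d10 H1] := dg _ e2; have [d2 d20 H2] := dk _ e2.
exists (Num.min d1 d2); first by rewrite lt_min d10.
move=> h; rewrite lt_min => /andP[/H1 h1 /H2 h2].
have -> : g h + k h - (g 0 + k 0) - h * (l + m) = (g h - g 0 - h * l) + (k h - k 0 - h * m) by ring.
apply: le_trans (cabsD _ _) _; lra.
Qed.
Lemma cder_lip (g : C -> C) l : cder g l ->
  exists2 d : R, 0 < d & forall h, cabs h < d -> cabs (g h - g 0) <= (cabs l + 1) * cabs h.
Proof.
move=> dg; have [d d0 H] := dg 1 ltr01; exists d => // h /H.
have := cabsD (g h - g 0 - h * l) (h * l); rewrite subrK cabsM; lra.
Qed.
Lemma cderM (g k : C -> C) l m : cder g l -> cder k m ->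
  cder (fun h => g h * k h) (l * k 0 + g 0 * m).
Proof.
move=> dg dk e e0.
have [d3 d30 H3] := cder_lip dg; have [d4 d40 H4] := cder_lip dk.
have g0 := cabs_ge0 (g 0); have k0 := cabs_ge0 (k 0).
have l0 := cabs_ge0 l; have m0 := cabs_ge0 m.
have P1 : 0 < e / 3 / (cabs (k 0) + 1) by rewrite divr_gt0 ?divr_gt0 //; lra.
have P2 : 0 < e / 3 / (cabs (g 0) + 1) by rewrite divr_gt0 ?divr_gt0 //; lra.
have Q0 : 0 < (cabs l + 1) * (cabs m + 1) by rewrite mulr_gt0 //; lra.
have P3 : 0 < e / 3 / ((cabs l + 1) * (cabs m + 1)) by rewrite !divr_gt0.
have [d1 d10 H1] := dg _ P1; have [d2 d20 H2] := dk _ P2.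
exists (Num.min (Num.min d1 d2) (Num.min (Num.min d3 d4) (e / 3 / ((cabs l + 1) * (cabs m + 1))))).
  by rewrite !lt_min d10 d20 d30 d40 P3.
move=> h; rewrite !lt_min => /andP[/andP[/H1 h1 /H2 h2] /andP[/andP[/H3 h3 /H4 h4] h5]].
have -> : g h * k h - g 0 * k 0 - h * (l * k 0 + g 0 * m) =
  (g h - g 0 - h * l) * k 0 + g 0 * (k h - k 0 - h * m) + (g h - g 0) * (k h - k 0) by ring.
apply: le_trans (cabsD _ _) _.
apply: le_trans (lerD (cabsD _ _) (lexx _)) _; rewrite !cabsM.
have hh := cabs_ge0 h.
have B1 : cabs (g h - g 0 - h * l) * cabs (k 0) <= e / 3 * cabs h.
  apply: le_trans (ler_wpM2r k0 h1) _; rewrite mulrAC ler_wpM2r //.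
  by rewrite mulrAC ler_pdivrMr; [nra | lra].
have B2 : cabs (g 0) * cabs (k h - k 0 - h * m) <= e / 3 * cabs h.
  apply: le_trans (ler_wpM2l g0 h2) _; rewrite mulrA ler_wpM2r //.
  by rewrite mulrA ler_pdivrMr; [nra | lra].
have B3 : cabs (g h - g 0) * cabs (k h - k 0) <= e / 3 * cabs h.
  apply: le_trans (ler_pM (cabs_ge0 _) (cabs_ge0 _) h3 h4) _.
  rewrite mulrACA [leLHS]mulrA ler_wpM2r //.
  by rewrite mulrC -ler_pdivlMr // ltW.
lra.
Qed.
Lemma cder_cexp (g : C -> C) l : (forall h, g h = g 0 + h * l) ->
  cder (fun h => cexp (g h)) (l * cexp (g 0)).
Proof.
move=> gl e e0.
have L0 : 0 < cabs (cexp (g 0)) by rewrite cabs_cexp expR_gt0.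
have l0 := cabs_ge0 l.
pose K := 2 * ((cabs l + 1) ^+ 2 * expR (cabs l + 1)) * cabs (cexp (g 0)).
have K0 : 0 < K by rewrite /K !mulr_gt0 ?expR_gt0 ?exprn_gt0 //; lra.
exists (Num.min 1 (e / K)); first by rewrite lt_min ltr01 divr_gt0.
move=> h; rewrite lt_min => /andP[h1 h2].
have -> : cexp (g h) - cexp (g 0) - h * (l * cexp (g 0)) =
   (cexp (h * l) - 1 - h * l) * cexp (g 0) by rewrite gl cexpD; ring.
rewrite cabsM; apply: le_trans (ler_wpM2r (ltW L0) (cexp_taylor1 _)) _.
rewrite cabsM; have hh := cabs_ge0 h.
apply: (@le_trans _ _ (cabs h ^+ 2 * K)); last first.
  rewrite expr2 -mulrA mulrC ler_wpM2r //.
  by rewrite -ler_pdivlMr // ltW.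
rewrite /K.
have -> : cabs h ^+ 2 * (2 * ((cabs l + 1) ^+ 2 * expR (cabs l + 1)) * cabs (cexp (g 0))) =
  2 * (cabs h ^+ 2 * ((cabs l + 1) ^+ 2 * expR (cabs l + 1))) * cabs (cexp (g 0)) by ring.
rewrite ler_wpM2r ?(ltW L0) // ler_wpM2l // exprMn -mulrA ler_wpM2l ?exprn_ge0 //.
apply: ler_pM; rewrite ?exprn_ge0 ?expR_ge0 //.
  by rewrite ler_pXn2r // ?nnegrE; lra.
by rewrite ler_expR; nra.
Qed.

Lemma entire_cst (c : C) : entire (fun _ : V => c).
Proof. by apply/entireP; split; [exact: ccont_cst | move=> z i; exists 0; exact: cder_cst]. Qed.
Lemma entireD f g : entire f -> entire g -> entire (fun w => f w + g w).
Proof.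
move=> /entireP[cf df] /entireP[cg dg]; apply/entireP; split; first exact: ccontD.
by move=> z i; have [l h] := df z i; have [m k] := dg z i; exists (l + m); exact: cderD.
Qed.
Lemma entireM f g : entire f -> entire g -> entire (fun w => f w * g w).
Proof.
move=> /entireP[cf df] /entireP[cg dg]; apply/entireP; split; first exact: ccontM.
by move=> z i; have [l h] := df z i; have [m k] := dg z i; eexists; exact: (cderM h k).
Qed.
Lemma entire_dotc a : entire (dotc a).
Proof.
apply/entireP; split; first exact: ccont_dotc.
move=> z i; exists (dotc a (ec R i)); apply: cder_affine => h.
by rewrite scale0r addr0 dotcDr dotcZr.
Qed.
Lemma entire_cexp_dotc a (c d : C) : entire (fun w => cexp (c * dotc a w - d)).
Proof.
apply/entireP; split.
  apply: ccont_cexp; apply: ccontD; last exact: ccont_cst.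
  by apply: ccontM; [exact: ccont_cst | exact: ccont_dotc].
move=> z i; exists ((c * dotc a (ec R i)) * cexp (c * dotc a (z + 0 *: ec R i) - d)).
apply: (@cder_cexp (fun h => c * dotc a (z + h *: ec R i) - d)) => h.
by rewrite scale0r addr0 dotcDr dotcZr; ring.
Qed.
Lemma entire_kz a : entire (kz a).
Proof. exact: entire_cexp_dotc. Qed.
Lemma entire_shift f a : entire f -> entire (fun w => f (w - a)).
Proof.
move=> /entireP[cf df]; apply/entireP; split.
  apply: (@ccont_comp f (fun w => w - a) 1 ltr01) => // z w.
  by rewrite opprB addrA subrK mul1r.
move=> z i; have [l h] := df (z - a) i; exists l.
have -> // : (fun h => f (z + h *: ec R i - a)) = fun h => f (z - a + h *: ec R i).
by apply/funext => k; rewrite addrAC.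
Qed.
End Cn.

(** * Lebesgue integration on C^n *)

Section MCdef.
Variables (R : realType) (n : nat).
Local Notation C := R[i].
Local Notation RR := (measurableTypeR R).

(* C^n as a measurable space, with the sigma-algebra generated by the real coordinates *)
Definition MC := Cn R n.
Definition mcoord (i : 'I_n) (w : MC) : (RR * RR)%type := (Re (w 0 i), Im (w 0 i)).

HB.instance Definition _ := Choice.on MC.
HB.instance Definition _ := isPointed.Build MC (0%R : Cn R n).

Definition MC_display : measure_display.
Proof. exact: measure_tuple_display default_measure_display. Qed.

Let MC_set0 : g_sigma_preimage mcoord set0. Proof. exact: sigma_algebra0. Qed.
Let MC_setC A : g_sigma_preimage mcoord A -> g_sigma_preimage mcoord (~` A).
Proof. exact: sigma_algebraC. Qed.
Let MC_bigcup (F : _^nat) : (forall i, g_sigma_preimage mcoord (F i)) ->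
  g_sigma_preimage mcoord (\bigcup_i (F i)).
Proof. exact: sigma_algebra_bigcup. Qed.

HB.instance Definition _ := @isMeasurable.Build MC_display MC
  (g_sigma_preimage mcoord) MC_set0 MC_setC MC_bigcup.
End MCdef.

Section Meas.
Variables (R : realType) (n : nat).
Local Notation C := R[i].
Local Notation RR := (measurableTypeR R).
Local Notation M := (MC R n).
Local Notation V := (Cn R n).
Local Notation leb := (@lebesgue_measure R).

Lemma measurable_mcoord (i : 'I_n) : measurable_fun [set: M] (mcoord i).
Proof.
move=> _ Y mY; rewrite setTI; apply: sub_sigma_algebra => /=.
rewrite -bigcup_seq/=; exists i => /=; first by rewrite mem_index_enum.
by exists Y => //; rewrite setTI.
Qed.

Lemma measurable_fun_MC d (T : measurableType d) (f : T -> M) :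
  (forall i, measurable_fun setT (fun x => (Re (f x 0 i) : RR))) ->
  (forall i, measurable_fun setT (fun x => (Im (f x 0 i) : RR))) ->
  measurable_fun setT f.
Proof.
move=> mR mI.
have mf i : measurable_fun setT (mcoord i \o f) by apply: measurable_fun_pair; [exact: mR | exact: mI].
have sub : g_sigma_preimage (fun i => mcoord i \o f) `<=` measurable.
  apply: smallest_sub; first exact: sigma_algebra_measurable.
  rewrite -bigcup_seq /=; apply: bigcup_sub => i _ A [B mB <-]; exact: mf.
move=> _ A mA; apply: sub.
by rewrite g_sigma_preimage_comp; exists A.
Qed.

Lemma measurable_Re_coord (i : 'I_n) : measurable_fun setT (fun w : M => (Re (w 0 i) : RR)).
Proof. by apply: (measurableT_comp measurable_fst (measurable_mcoord i)). Qed.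
Lemma measurable_Im_coord (i : 'I_n) : measurable_fun setT (fun w : M => (Im (w 0 i) : RR)).
Proof. by apply: (measurableT_comp measurable_snd (measurable_mcoord i)). Qed.

Let rnd (m : nat) (x : R) : R := (Num.floor (x * m.+1%:R))%:~R / m.+1%:R.
Let grid (m : nat) (w : V) : {ffun 'I_n -> int * int} :=
  [ffun i => (Num.floor (Re (w 0 i) * m.+1%:R), Num.floor (Im (w 0 i) * m.+1%:R))].
Let ungrid (m : nat) (v : {ffun 'I_n -> int * int}) : V :=
  \row_i Complex ((v i).1%:~R / m.+1%:R) ((v i).2%:~R / m.+1%:R).

Let rndP m x : `|rnd m x - x| <= m.+1%:R^-1.
Proof.
have m0 : 0 < m.+1%:R :> R by rewrite ltr0n.
have /andP[a b] := floor_itv (x * m.+1%:R).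
rewrite -[leRHS]mul1r ler_pdivlMr // -[m.+1%:R in leLHS]gtr0_norm // -normrM mulrBl divfK ?gt_eqF //.
by rewrite ler_norml; apply/andP; move: b; rewrite intrD; split; lra.
Qed.

Let cvg_grid m (w : V) : sqn (ungrid m (grid m w) - w) <= n%:R * (4 * m.+1%:R^-1 ^+ 2).
Proof.
rewrite /sqn -[n in n%:R](card_ord n) mulr_natl -sumr_const; apply: ler_sum => i _.
rewrite !mxE /grid ffunE /= cabs_sq !ReImE /=.
change ((rnd m (Re (w 0 i)) - Re (w 0 i)) ^+ 2 + (rnd m (Im (w 0 i)) - Im (w 0 i)) ^+ 2
  <= 4 * m.+1%:R^-1 ^+ 2).
have h1 := rndP m (Re (w 0 i)); have h2 := rndP m (Im (w 0 i)).
have m0 : 0 <= m.+1%:R^-1 :> R by [].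
rewrite -(ler_pXn2r (n:=2)) ?nnegrE // real_normK ?num_real // in h1.
rewrite -(ler_pXn2r (n:=2)) ?nnegrE // real_normK ?num_real // in h2.
have q : 0 <= m.+1%:R^-1 ^+ 2 :> R by rewrite exprn_ge0.
apply: le_trans (lerD h1 h2) _; move: q; set x := _ ^+ 2 => q; lra.
Qed.

Let measurable_fiber m (v : {ffun 'I_n -> int * int}) : measurable [set w : M | grid m w = v].
Proof.
have -> : [set w : M | grid m w = v] = \big[setI/setT]_(i < n)
   mcoord i @^-1` ([set` `[(v i).1%:~R / m.+1%:R : R, ((v i).1 + 1)%:~R / m.+1%:R[] `*`
     [set` `[(v i).2%:~R / m.+1%:R : R, ((v i).2 + 1)%:~R / m.+1%:R[]).
  apply/seteqP; split=> w /=.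
    move=> <-; rewrite -bigcap_seq /= => i _; rewrite /mcoord /grid ffunE /=.
    by rewrite !in_itv /= !ler_pdivrMr // !ltr_pdivlMr // !floor_itv.
  rewrite -bigcap_seq /= => H; apply/ffunP => i; rewrite /grid ffunE.
  have [/=] := H i (mem_index_enum i).
  rewrite !in_itv /= !ler_pdivrMr // !ltr_pdivlMr // => h1 h2.
  by case: (v i) h1 h2 => a b /= h1 h2; congr pair; apply: floor_def.
apply: bigsetI_measurable => i _; rewrite -[_ @^-1` _]setTI.
apply: measurable_mcoord => //; apply: measurableX; exact: measurable_itv.
Qed.

Let measurable_grid m (h : {ffun 'I_n -> int * int} -> R) :
  measurable_fun [set: M] (fun w => h (grid m w)).
Proof.
move=> _ Y mY; rewrite setTI.
(* There are countably many cells: the union runs over the codes of grid points, with the empty set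
   at every other number. *)
have -> : (fun w : M => h (grid m w)) @^-1` Y =
  \bigcup_k (if unpickle k is Some v then (if h v \in Y then [set w : M | grid m w = v] else set0) else set0).
  apply/seteqP; split=> w /=.
    by move=> Yw; exists (pickle (grid m w)) => //; rewrite pickleK mem_set.
  case=> k _; case: (unpickle k) => // v; case: ifPn => // /set_mem hv /= wv.
  by rewrite wv.
apply: bigcup_measurable => k _; case: (unpickle k) => [v|]; last exact: measurable0.
by case: ifPn => _; [exact: measurable_fiber | exact: measurable0].
Qed.

(** The sigma-algebra is generated by the coordinates, not by the open sets, so continuity has to be
    linked to it by hand. [ungrid m (grid m w)] rounds every real coordinate down to a multiple of
    1/(m+1); it takes countably many values on measurable cells and tends to [w], so a continuous
    function is a pointwise limit of measurable ones. *)
Lemma measurable_ccont_real (g : V -> R) :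
  (forall z (e : R), 0 < e -> exists2 d : R, 0 < d & forall w, sqn (w - z) < d -> `|g w - g z| < e) ->
  measurable_fun [set: M] (g : M -> RR).
Proof.
move=> cg; apply: (@measurable_fun_cvg _ M R setT (fun (m : nat) (w : M) => g (ungrid m (grid m w))) g).
  by move=> m; exact: (measurable_grid m (fun v => g (ungrid m v))).
move=> z _; apply/cvgrPdist_lt => e e0.
have [d d0 H] := cg z e e0.
pose K : R := n%:R * 4 + 1.
have K0 : 0 < K by rewrite /K ltr_wpDl // mulr_ge0.
have := (near_infty_natSinv_lt (PosNum (divr_gt0 d0 K0))); apply: filterS => m /= hm.
rewrite distrC; apply: H; apply: le_lt_trans (cvg_grid m z) _.
have m0 : 0 < m.+1%:R^-1 :> R by rewrite invr_gt0.
have m1 : m.+1%:R^-1 <= 1 :> R by rewrite invf_le1 // ler1n.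
move: hm; rewrite ltr_pdivlMr // => hm.
apply: le_lt_trans hm; rewrite /K mulrA mulrDr mulr1 expr2.
set x := m.+1%:R^-1 in m0 m1 *; have : 0 <= n%:R :> R by [].
move: (n%:R) => N N0; have : x * x <= x by rewrite ler_piMl // ltW.
by move=> hx; have := ler_wpM2l (mulr_ge0 N0 (ler0n _ 4)) hx; nra.
Qed.

Lemma measurable_ccont_Re (f : V -> C) : ccont f -> measurable_fun [set: M] (fun w => (Re (f w) : RR)).
Proof.
move=> cf; apply: measurable_ccont_real => z e e0; have [d d0 H] := cf z e e0.
by exists d => // w /H; apply: le_lt_trans; rewrite -ReN -ReD Re_le_cabs.
Qed.
Lemma measurable_ccont_Im (f : V -> C) : ccont f -> measurable_fun [set: M] (fun w => (Im (f w) : RR)).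
Proof.
move=> cf; apply: measurable_ccont_real => z e e0; have [d d0 H] := cf z e e0.
by exists d => // w /H; apply: le_lt_trans; rewrite -ImN -ImD Im_le_cabs.
Qed.

Lemma measurable_upd (k : nat) d (T : measurableType d) (w : T -> M) (x y : T -> RR) :
  measurable_fun setT w -> measurable_fun setT x -> measurable_fun setT y ->
  measurable_fun setT (fun t => upd (w t) k (Complex (x t) (y t)) : M).
Proof.
move=> mw mx my; apply: measurable_fun_MC => i.
- have -> : (fun t => (Re (upd (w t) k (Complex (x t) (y t)) 0 i) : RR)) =
     if (i : nat) == k then x else (fun t => Re (w t 0 i)).
    by apply/funext => t; rewrite mxE; case: ifP.
  by case: ifP => _ //; exact: (measurableT_comp (measurable_Re_coord i) mw).
- have -> : (fun t => (Im (upd (w t) k (Complex (x t) (y t)) 0 i) : RR)) =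
     if (i : nat) == k then y else (fun t => Im (w t 0 i)).
    by apply/funext => t; rewrite mxE; case: ifP.
  by case: ifP => _ //; exact: (measurableT_comp (measurable_Im_coord i) mw).
Qed.

Local Open Scope ereal_scope.

(** Tonelli's theorem is about nonnegative integrands; a signed integral is by definition the
    difference of the integrals of the positive and negative parts. *)
Lemma measurable_par_int d (T : measurableType d) (F : T * RR -> \bar R) :
  measurable_fun setT F -> measurable_fun setT (fun t => \int[leb]_y F (t, y)).
Proof.
move=> mF.
have -> : (fun t => \int[leb]_y F (t, y)) = (fun t => (\int[leb]_y (F^\+ (t, y))) - \int[leb]_y (F^\- (t, y))).
  by apply/funext => t; rewrite [LHS]integralE; congr (_ - _); apply: eq_integral => y _; rewrite ?funeposE ?funenegE.
apply: emeasurable_funB.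
- apply: (measurable_fun_fubini_tonelli_F (m2 := leb) F^\+); first exact: measurable_funepos.
  by move=> x; exact: funepos_ge0.
- apply: (measurable_fun_fubini_tonelli_F (m2 := leb) F^\-); first exact: measurable_funeneg.
  by move=> x; exact: funeneg_ge0.
Qed.

Lemma measurable_comp_upd k (g : M -> \bar R) : measurable_fun setT g ->
  measurable_fun setT (fun p : (M * RR) * RR => g (upd p.1.1 k (Complex p.1.2 p.2))).
Proof.
move=> mg; apply: (measurableT_comp mg).
apply: (@measurable_upd k _ _ (fun p : (M * RR) * RR => p.1.1) (fun p => p.1.2) (fun p => p.2)).
- exact: (measurableT_comp measurable_fst measurable_fst).
- exact: (measurableT_comp measurable_snd measurable_fst).
- exact: measurable_snd.
Qed.

Lemma measurable_slice1 k (g : M -> \bar R) (w : M) : measurable_fun setT g ->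
  measurable_fun setT (fun x : RR => \int[leb]_y g (upd w k (Complex x y))).
Proof.
move=> /(measurable_comp_upd k) /measurable_par_int mg.
exact: (measurableT_comp mg (measurable_pair1 w)).
Qed.
Lemma measurable_slice2 k (g : M -> \bar R) (w : M) (x : RR) : measurable_fun setT g ->
  measurable_fun setT (fun y : RR => g (upd w k (Complex x y))).
Proof.
move=> /(measurable_comp_upd k) mg.
exact: (measurableT_comp mg (measurable_pair1 (w, x))).
Qed.

Lemma measurable_iter_int k (g : M -> \bar R) : measurable_fun setT g ->
  measurable_fun setT (iter_int k g : M -> \bar R).
Proof.
move=> mg; elim: k => [|k IH] //=.
exact: (measurable_par_int (measurable_par_int (measurable_comp_upd k IH))).
Qed.

Lemma iter_int_ge0 k (g : M -> \bar R) (w : M) : (forall v, 0 <= g v) -> 0 <= iter_int k g w.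
Proof.
move=> g0; elim: k w => [|k IH] w //=.
by apply: integral_ge0 => x _; apply: integral_ge0 => y _; exact: IH.
Qed.

Lemma iter_intD k (g h : M -> \bar R) (w : M) : measurable_fun setT g -> measurable_fun setT h ->
  (forall v, 0 <= g v) -> (forall v, 0 <= h v) ->
  iter_int k (g \+ h) w = iter_int k g w + iter_int k h w.
Proof.
move=> mg mh g0 h0; elim: k w => [|k IH] w //=.
have mgk := measurable_iter_int k mg; have mhk := measurable_iter_int k mh.
rewrite -ge0_integralD //.
- apply: eq_integral => x _; rewrite -ge0_integralD //.
  + by apply: eq_integral => y _; rewrite IH.
  + by move=> y _; exact: iter_int_ge0.
  + exact: measurable_slice2.
  + by move=> y _; exact: iter_int_ge0.
  + exact: measurable_slice2.
- by move=> x _; apply: integral_ge0 => y _; exact: iter_int_ge0.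
- exact: measurable_slice1.
- by move=> x _; apply: integral_ge0 => y _; exact: iter_int_ge0.
- exact: measurable_slice1.
Qed.

Lemma iter_intZ k (c : \bar R) (g : M -> \bar R) (w : M) : measurable_fun setT g ->
  (forall v, 0 <= g v) -> 0 <= c ->
  iter_int k (fun v => c * g v) w = c * iter_int k g w.
Proof.
move=> mg g0 c0; elim: k w => [|k IH] w //=.
have mgk := measurable_iter_int k mg.
rewrite -ge0_integralZl //.
- apply: eq_integral => x _; rewrite -ge0_integralZl //.
  + by apply: eq_integral => y _; rewrite IH.
  + exact: measurable_slice2.
  + by move=> y _; exact: iter_int_ge0.
- exact: measurable_slice1.
- by move=> x _; apply: integral_ge0 => y _; exact: iter_int_ge0.
Qed.

Lemma le_iter_int k (g h : M -> \bar R) (w : M) : measurable_fun setT g -> measurable_fun setT h ->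
  (forall v, 0 <= g v) -> (forall v, g v <= h v) -> iter_int k g w <= iter_int k h w.
Proof.
move=> mg mh g0 gh; elim: k w => [|k IH] w //=.
have h0 v : 0 <= h v by exact: le_trans (g0 v) (gh v).
have mgk := measurable_iter_int k mg; have mhk := measurable_iter_int k mh.
apply: ge0_le_integral => //.
- by move=> x _; apply: integral_ge0 => y _; exact: iter_int_ge0.
- exact: measurable_slice1.
- exact: measurable_slice1.
- move=> x _; apply: ge0_le_integral => //.
  + by move=> y _; exact: iter_int_ge0.
  + exact: measurable_slice2.
  + exact: measurable_slice2.
Qed.

Lemma iter_int_nneseries k (g : (M -> \bar R)^nat) (w : M) : (forall j, measurable_fun setT (g j)) ->
  (forall j v, 0 <= g j v) ->
  iter_int k (fun v => \sum_(0 <= j <oo) g j v) w = \sum_(0 <= j <oo) iter_int k (g j) w.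
Proof.
move=> mg g0; elim: k w => [|k IH] w //=.
have mgk j := measurable_iter_int k (mg j).
rewrite -integral_nneseries //.
- apply: eq_integral => x _; rewrite -integral_nneseries //.
  + by apply: eq_integral => y _; rewrite IH.
  + by move=> j; exact: measurable_slice2.
  + by move=> j y _; exact: iter_int_ge0.
- by move=> j; exact: measurable_slice1.
- by move=> j x _; apply: integral_ge0 => y _; exact: iter_int_ge0.
Qed.

Lemma iter_int_lim k (g : (M -> \bar R)^nat) (w : M) : (forall j, measurable_fun setT (g j)) ->
  (forall j v, 0 <= g j v) -> (forall v, {homo (g ^~ v) : i j / (i <= j)%N >-> i <= j}) ->
  iter_int k (fun v => limn (g ^~ v)) w = limn (fun j => iter_int k (g j) w).
Proof.
move=> mg g0 ng; elim: k w => [|k IH] w //=.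
have mgk j := measurable_iter_int k (mg j).
have nk v : {homo (fun j => iter_int k (g j) v) : i j / (i <= j)%N >-> i <= j}.
  by move=> i j ij; apply: le_iter_int => // u; exact: ng.
rewrite -monotone_convergence //.
- apply: eq_integral => x _; rewrite -monotone_convergence //.
  + by apply: eq_integral => y _; rewrite IH.
  + by move=> j; exact: measurable_slice2.
  + by move=> j y _; exact: iter_int_ge0.
- by move=> j; exact: measurable_slice1.
- by move=> j x _; apply: integral_ge0 => y _; exact: iter_int_ge0.
- move=> x _ i j ij; apply: ge0_le_integral => //.
  + by move=> y _; exact: iter_int_ge0.
  + exact: measurable_slice2.
  + exact: measurable_slice2.
  + by move=> y _; exact: nk.
Qed.

Lemma iter_int0 k (w : M) : iter_int k (fun=> 0) w = 0.
Proof.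
elim: k w => [|k IH] w //=.
by under eq_integral => x _ do under eq_integral => y _ do rewrite IH; rewrite !integral0.
Qed.

Lemma iter_int_sum (I : Type) (s : seq I) k (g : I -> M -> \bar R) (w : M) :
  (forall j, measurable_fun setT (g j)) -> (forall j v, 0 <= g j v) ->
  iter_int k (fun v => \sum_(j <- s) g j v) w = \sum_(j <- s) iter_int k (g j) w.
Proof.
move=> mg g0; elim: s => [|j s IH].
  by rewrite big_nil -[RHS](iter_int0 k w); congr iter_int; apply/funext => v; rewrite big_nil.
rewrite big_cons -IH -iter_intD //; last 2 first.
  exact: emeasurable_sum.
  by move=> v; exact: sume_ge0.
by congr iter_int; apply/funext => v; rewrite big_cons.
Qed.

(** The iterated integral turned into a measure, so that Fubini, Fatou and the notion of
    integrability become available for it; [int_lebC] and [int_lebC_integrable] lead back to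
    [int_Cn]. *)
Definition lebC (A : set M) : \bar R := iter_int n (fun w : M => (\1_A w)%:E) (0%R : Cn R n).

Let m0 : lebC set0 = 0.
Proof. by rewrite /lebC -[RHS](iter_int0 n 0%R); congr iter_int; apply/funext => w; rewrite indic0. Qed.
Let mge0 A : 0 <= lebC A.
Proof. by apply: iter_int_ge0 => v; rewrite lee_fin. Qed.
Let msa : semi_sigma_additive lebC.
Proof.
move=> F mF tF mUF.
have -> : lebC (\bigcup_i F i) = \sum_(0 <= i <oo) lebC (F i).
  rewrite /lebC -iter_int_nneseries //.
  - congr iter_int; apply/funext => w.
    exact: (measure_semi_bigcup (dirac (w : M) : {measure set M -> \bar R}) mF tF mUF).
  - by move=> j; exact/measurable_EFinP/measurable_indic.
apply: is_cvg_nneseries => // i _ _; exact: mge0.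
Qed.
HB.instance Definition _ := isMeasure.Build _ _ _ lebC m0 mge0 msa.

Import HBNNSimple.

(** The two sides agree on indicators by construction, on simple functions by linearity, and in
    general by monotone convergence, which the iterated integral inherits one coordinate at a time
    ([iter_int_lim]). *)
Lemma int_lebC (g : M -> \bar R) : measurable_fun setT g -> (forall w, 0 <= g w) ->
  \int[lebC]_w g w = int_Cn g.
Proof.
move=> mg g0; pose f := nnsfun_approx measurableT mg.
have flim w : g w = limn (fun j => (f j w)%:E).
  by apply/esym/cvg_lim => //; apply: cvg_nnsfun_approx.
have mf j : measurable_fun setT (fun w => (f j w)%:E) by exact/measurable_EFinP.
have f0 j (w : M) : 0 <= (f j w)%:E by rewrite lee_fin.
have nf (w : M) : {homo (fun j => (f j w)%:E) : i j / (i <= j)%N >-> i <= j}.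
  by move=> i j ij; rewrite lee_fin; exact/lefP/nd_nnsfun_approx.
transitivity (limn (fun j => \int[lebC]_w (f j w)%:E)).
  rewrite -monotone_convergence //.
  by apply: eq_integral => w _.
transitivity (limn (fun j => int_Cn (fun w => (f j w)%:E))); last first.
  rewrite /int_Cn -iter_int_lim //; congr iter_int; apply/funext => w; by rewrite -flim.
congr (limn _); apply/funext => j; move: (f j) => {mf f0 nf flim f} f.
rewrite integral_nnsfun // patch_setT sintegralE.
rewrite fsbig_finite //=.
transitivity (int_Cn (fun w : M => \sum_(r <- finmap.enum_fset (fset_set (range f))) (r%:E * (\1_(f @^-1` [set r]) w)%:E))).
  rewrite /int_Cn iter_int_sum.
  - apply: eq_big_seq => r; rewrite in_fset_set // => /set_mem [w _ <-].
    rewrite iter_intZ //.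
    + exact/measurable_EFinP/measurable_indic.
    + by rewrite lee_fin; exact: fun_ge0.
  - by move=> r; apply: measurable_funeM; exact/measurable_EFinP/measurable_indic.
  (* At a negative [r] the level set of a nonnegative simple function is empty, so this term is
     0. *)
  - move=> r v; have [r0|r0] := leP 0%R r; first by rewrite mule_ge0 // lee_fin.
    by rewrite preimage_nnfun0 // indic0 mule0.
congr iter_int; apply/funext => w; rewrite [in RHS]fimfunE -fsumEFin //.
by rewrite fsbig_finite //=; apply: eq_bigr => r _; rewrite EFinM.
Qed.

End Meas.

(** * Integrals of product functions and sigma-finiteness *)

Section Meas2.
Variables (R : realType) (n : nat).
Local Notation C := R[i].
Local Notation RR := (measurableTypeR R).
Local Notation M := (MC R n).
Local Notation V := (Cn R n).
Local Notation leb := (@lebesgue_measure R).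
Local Notation lebC := (@lebC R n).

Local Open Scope ereal_scope.

Lemma iter_int_prod (h : RR -> R) (r : R) : measurable_fun setT h -> (forall x, 0 <= h x)%R ->
  \int[leb]_x (h x)%:E = r%:E -> forall k (w : V), (k <= n)%N ->
  iter_int k (fun w : V => (\prod_(i < n) (h (Re (w ord0 i)) * h (Im (w ord0 i))))%:E) w =
  ((r ^+ 2) ^+ k * \prod_(i < n | (k <= i)%N) (h (Re (w ord0 i)) * h (Im (w ord0 i))))%:E.
Proof.
move=> mh h0 hr; elim=> [|k IH] w kn.
  by rewrite expr0 mul1r /=.
have r0 : (0 <= r)%R by rewrite -lee_fin -hr; apply: integral_ge0 => x _; rewrite lee_fin.
set P := (\prod_(i < n | (k < i)%N) _)%R.
have P0 : (0 <= P)%R by apply: prodr_ge0 => i _; rewrite mulr_ge0.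
have E x y : iter_int k (fun w : V => (\prod_(i < n) (h (Re (w ord0 i)) * h (Im (w ord0 i))))%:E) (upd w k (Complex x y))
   = ((r ^+ 2) ^+ k * P * h x)%:E * (h y)%:E.
  rewrite IH; last exact: ltnW.
  rewrite -EFinM; congr (_%:E).
  rewrite (bigD1 (Ordinal kn)) //= !mxE /= eqxx /= -!mulrA; congr (_ * _)%R.
  set Q := (\prod_(i < n | _) _)%R; suff -> : Q = P by ring.
  apply: eq_big => i; first by rewrite ltn_neqAle andbC eq_sym.
  by move=> /andP[_ ik]; rewrite !mxE; have -> : (i == k :> nat) = false by apply: contraNF ik => /eqP e; apply/eqP/val_inj.
rewrite /=.
under eq_integral => x _ do under eq_integral => y _ do rewrite E.
transitivity (\int[leb]_x (((r ^+ 2) ^+ k * P * r)%:E * (h x)%:E)).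
  apply: eq_integral => x _; rewrite ge0_integralZl //.
  - by rewrite hr -!EFinM; congr (_%:E); rewrite mulrAC.
  - exact/measurable_EFinP.
  - by move=> y _; rewrite lee_fin.
  - by rewrite lee_fin !mulr_ge0 // exprn_ge0 // exprn_ge0.
rewrite ge0_integralZl //.
- by rewrite hr -EFinM; congr (_%:E); rewrite [(_ ^+ k.+1)%R]exprSr; ring.
- exact/measurable_EFinP.
- by move=> y _; rewrite lee_fin.
- by rewrite lee_fin !mulr_ge0 // exprn_ge0 // exprn_ge0.
Qed.

Lemma int_Cn_prod (h : RR -> R) (r : R) : measurable_fun setT h -> (forall x, 0 <= h x)%R ->
  \int[leb]_x (h x)%:E = r%:E ->
  int_Cn (fun w : V => (\prod_(i < n) (h (Re (w ord0 i)) * h (Im (w ord0 i))))%:E) = ((r ^+ 2) ^+ n)%:E.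
Proof.
move=> mh h0 hr; rewrite /int_Cn (iter_int_prod mh h0 hr) //.
by rewrite big1 ?mulr1 // => i; rewrite leqNgt ltn_ord.
Qed.

Lemma measurable_prod_coord (h : RR -> R) : measurable_fun setT h ->
  measurable_fun [set: M] (fun w : V => (\prod_(i < n) (h (Re (w ord0 i)) * h (Im (w ord0 i))))%R : RR).
Proof.
move=> mh; apply: measurable_prod => i _; apply: measurable_funM.
- exact: (measurableT_comp mh (measurable_Re_coord i)).
- exact: (measurableT_comp mh (measurable_Im_coord i)).
Qed.

(** The exhausting cubes [-N, N]^(2n) are written as the sets where a product of one-variable
    indicators equals 1, so that [int_Cn_prod] computes their measure. *)
Lemma lebC_sigma_finite : sigma_finite setT lebC.
Proof.
pose h (N : nat) : RR -> R := \1_([set` `[(- N%:R)%R, (N%:R : R)%R]]).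
pose F (N : nat) := [set w : M | (\prod_(i < n) (h N (Re (w ord0 i)) * h N (Im (w ord0 i))) = 1)%R].
have mh N : measurable_fun setT (h N) by apply: measurable_indic; exact: measurable_itv.
have h01 N x : h N x = 0%R \/ h N x = 1%R.
  by rewrite /h indicE; case: (_ \in _); [right | left].
exists F.
  apply/seteqP; split=> // w _.
  pose K := (\sum_(i < n) (`|Re (w ord0 i)| + `|Im (w ord0 i)|))%R.
  have [N HN] : exists N : nat, (K <= N%:R)%R.
    by exists (Num.Def.truncn K).+1; apply: ltW; rewrite truncnS_gt.
  exists N => //; rewrite /F /= big1 // => i _.
  have Ki : (`|Re (w ord0 i)| + `|Im (w ord0 i)| <= N%:R)%R.
    apply: le_trans HN; rewrite /K (bigD1 i) //= lerDl; apply: sumr_ge0 => j _.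
    exact: addr_ge0.
  have a := normr_ge0 (Re (w ord0 i)); have b := normr_ge0 (Im (w ord0 i)).
  rewrite /h !indicE !mem_set ?mulr1 //= in_itv /= -ler_norml; lra.
move=> N; split.
  have -> : F N = (fun w : M => (\prod_(i < n) (h N (Re (w ord0 i)) * h N (Im (w ord0 i))))%R : RR) @^-1` [set 1%R].
    by [].
  rewrite -[_ @^-1` _]setTI; exact: measurable_prod_coord.
rewrite /lebC.
have -> : (fun w : V => (\1_(F N) w)%:E) = (fun w => (\prod_(i < n) (h N (Re (w ord0 i)) * h N (Im (w ord0 i))))%:E).
  apply/funext => w; congr (_%:E); rewrite indicE.
  have [/set_mem /= ->//|] := boolP (w \in F N).
  move=> /negP nw.
  have : (\prod_(i < n) (h N (Re (w ord0 i)) * h N (Im (w ord0 i))) = 0)%R \/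
         (\prod_(i < n) (h N (Re (w ord0 i)) * h N (Im (w ord0 i))) = 1)%R.
    elim/big_ind: _ => [|x y [->|->] [->|->]|i _]; rewrite ?mulr0 ?mul0r ?mulr1; auto.
    have [->|->] := h01 N (Re (w ord0 i)); have [->|->] := h01 N (Im (w ord0 i)); rewrite ?mulr0 ?mul0r ?mulr1; auto.
  by case=> // H; case: nw; apply/mem_set.
rewrite -/(int_Cn _) (@int_Cn_prod (h N) (N%:R - - N%:R)%R) ?ltry //.
rewrite integral_indic ?setIT //.
apply: (etrans (@lebesgue_measure_itv R `[(- N%:R)%R, N%:R%R])).
rewrite /= lte_fin; case: ifP => [_|/negbT]; first by rewrite EFinB.
(* Only N = 0 remains: the interval is a point, and the difference of its ends is still its
   length. *)
rewrite -leNgt => N0; have N1 : (0 <= N%:R :> R)%R by [].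
by congr (_%:E); lra.
Qed.

HB.instance Definition _ := Measure_isSigmaFinite.Build _ _ _ lebC lebC_sigma_finite.

End Meas2.

Section IntSub.
Local Open Scope ereal_scope.
(** Inner integrals of an iterated integral are finite only almost everywhere. Therefore b = p - q
    is asked only where the dominating [a] is finite, which is almost everywhere once [a] is
    integrable. *)
Lemma int_sub_ae d (T : measurableType d) (R : realType) (mu : {measure set T -> \bar R})
  (a b p q : T -> \bar R) : measurable_fun setT a -> measurable_fun setT b ->
  measurable_fun setT p -> measurable_fun setT q ->
  (forall y, 0 <= p y <= a y) -> (forall y, 0 <= q y <= a y) ->
  \int[mu]_y a y < +oo -> (forall y, a y < +oo -> b y = p y - q y) ->
  \int[mu]_y b y = \int[mu]_y p y - \int[mu]_y q y.
Proof.
move=> ma mb mp mq pa qa ia bpq.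
have a0 y : 0 <= a y by have /andP[x1 x2] := pa y; exact: le_trans x1 x2.
have Ia : mu.-integrable setT a.
  apply/integrableP; split => //; apply: le_lt_trans ia.
  by rewrite le_eqVlt; apply/orP; left; apply/eqP; apply: eq_integral => y _; rewrite gee0_abs.
have Ip : mu.-integrable setT p.
  apply: (le_integrable measurableT mp _ Ia) => y _.
  by have /andP[x1 x2] := pa y; rewrite !gee0_abs.
have Iq : mu.-integrable setT q.
  apply: (le_integrable measurableT mq _ Ia) => y _.
  by have /andP[x1 x2] := qa y; rewrite !gee0_abs.
rewrite -integralB //; apply: ae_eq_integral => //; first exact: emeasurable_funB.
have := integrable_ae measurableT Ia.
apply: filterS => y /(_ I) fy _; apply: bpq.
by move: fy; rewrite fin_numE -ltey => /andP[].
Qed.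
End IntSub.

(** * Signed integrals and measure preserving changes of variables *)

Section Meas3.
Variables (R : realType) (n : nat).
Local Notation C := R[i].
Local Notation RR := (measurableTypeR R).
Local Notation M := (MC R n).
Local Notation V := (Cn R n).
Local Notation leb := (@lebesgue_measure R).
Local Notation lebC := (@lebC R n).

Local Open Scope ereal_scope.

(** Splitting into positive and negative parts must avoid a difference of infinities at each of the
    nested integrals. Finiteness for |g| passes inward almost everywhere, and [int_sub_ae] is
    applied twice per complex coordinate. *)
Lemma iter_int_signed k (g : M -> \bar R) (w : V) : measurable_fun setT g ->
  iter_int k (fun v => `|g v|) w < +oo ->
  iter_int k g w = iter_int k g^\+ w - iter_int k g^\- w.
Proof.
move=> mg.
have ma : measurable_fun setT (fun v : M => `|g v|) by exact: measurableT_comp.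
have mp : measurable_fun setT g^\+ by exact: measurable_funepos.
have mn : measurable_fun setT g^\- by exact: measurable_funeneg.
have a0 v : 0 <= `|g v| by exact: abse_ge0.
have p0 v : 0 <= g^\+ v by exact: funepos_ge0.
have n0 v : 0 <= g^\- v by exact: funeneg_ge0.
have ap v : g^\+ v <= `|g v| by rewrite -[leRHS]/((abse \o g) v) fune_abse leeDl.
have an v : g^\- v <= `|g v| by rewrite -[leRHS]/((abse \o g) v) fune_abse leeDr.
elim: k w => [|k IH] w /=.
  by move=> _; rewrite -[LHS]/(g w) {1}(funeposneg g).
have mak := measurable_iter_int k ma; have mpk := measurable_iter_int k mp.
have mnk := measurable_iter_int k mn; have mgk := measurable_iter_int k mg.
move=> fin.
apply: (int_sub_ae _ _ _ _ _ _ fin).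
- exact: measurable_slice1.
- exact: measurable_slice1.
- exact: measurable_slice1.
- exact: measurable_slice1.
- move=> x; apply/andP; split; first by apply: integral_ge0 => y _; exact: iter_int_ge0.
  apply: ge0_le_integral => //.
  + by move=> y _; exact: iter_int_ge0.
  + exact: measurable_slice2.
  + exact: measurable_slice2.
  + by move=> y _; exact: le_iter_int.
- move=> x; apply/andP; split; first by apply: integral_ge0 => y _; exact: iter_int_ge0.
  apply: ge0_le_integral => //.
  + by move=> y _; exact: iter_int_ge0.
  + exact: measurable_slice2.
  + exact: measurable_slice2.
  + by move=> y _; exact: le_iter_int.
- move=> x finx; apply: (int_sub_ae _ _ _ _ _ _ finx).
  + exact: measurable_slice2.
  + exact: measurable_slice2.
  + exact: measurable_slice2.
  + exact: measurable_slice2.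
  + by move=> y; rewrite iter_int_ge0 //= le_iter_int.
  + by move=> y; rewrite iter_int_ge0 //= le_iter_int.
  + by move=> y; exact: IH.
Qed.

Lemma int_lebC_integrable (g : M -> \bar R) : lebC.-integrable setT g ->
  \int[lebC]_w g w = int_Cn g.
Proof.
move=> /integrableP[mg fin].
rewrite /int_Cn iter_int_signed //.
  rewrite integralE -[X in _ = X - _]/(int_Cn _) -[X in _ = _ - X]/(int_Cn _) !int_lebC //.
  exact: measurable_funeneg. exact: measurable_funepos.
rewrite -/(int_Cn _) -int_lebC //; exact: measurableT_comp.
Qed.

(** Invariance of planar Lebesgue measure, phrased with the iterated integrals that occur in one
    step of [iter_int]. Measurability of the composite is part of the notion so that it is stable
    under composition. *)
Definition plane_preserving (tau : C -> C) := forall h : C -> \bar R,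
  measurable_fun setT (fun p : RR * RR => h (Complex p.1 p.2)) -> (forall c, 0 <= h c) ->
  measurable_fun setT (fun p : RR * RR => h (tau (Complex p.1 p.2))) /\
  \int[leb]_x \int[leb]_y h (tau (Complex x y)) = \int[leb]_x \int[leb]_y h (Complex x y).

Lemma plane_preserving_comp tau sig : plane_preserving tau -> plane_preserving sig ->
  plane_preserving (tau \o sig).
Proof.
move=> pt ps h mh h0; have [m1 e1] := pt h mh h0.
by have [m2 e2] := ps (h \o tau) m1 (fun c => h0 _); split; [exact: m2 | exact: (etrans e2 e1)].
Qed.

Lemma upd_upd (w : V) k i (c d : C) : k != i -> upd (upd w k c) i d = upd (upd w i d) k c.
Proof.
move=> ki; apply/rowP => j; rewrite !mxE.
by case: eqP => // ->; rewrite eq_sym (negbTE ki).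
Qed.
Lemma upd_same (w : V) k (c d : C) : upd (upd w k c) k d = upd w k d.
Proof. by apply/rowP => j; rewrite !mxE; case: eqP. Qed.
Lemma upd_other (w : V) k (i : 'I_n) (c : C) : (i : nat) != k -> upd w k c 0%R i = w 0%R i.
Proof. by move=> ik; rewrite mxE (negbTE ik). Qed.
Lemma upd_self (w : V) (i : 'I_n) (c : C) : upd w i c 0%R i = c.
Proof. by rewrite mxE eqxx. Qed.

Lemma measurable_upd_slice k (g : M -> \bar R) (w : V) : measurable_fun setT g ->
  measurable_fun setT (fun p : RR * RR => g (upd w k (Complex p.1 p.2))).
Proof.
move=> mg; apply: (measurableT_comp mg).
exact: (@measurable_upd R n k _ (RR * RR)%type (fun _ => w : M) (fun p => p.1) (fun p => p.2)
  (measurable_cst _) measurable_fst measurable_snd).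
Qed.

(** The integrals over coordinates below [i] update other entries and commute with the change
    ([H1]); the planar integral over coordinate [i] absorbs it, and nothing is left for the outer
    integrals ([H2]). *)
Lemma int_Cn_coord_change (i : 'I_n) (tau : C -> C) (g : M -> \bar R) :
  plane_preserving tau -> measurable_fun setT g -> (forall v, 0 <= g v) ->
  int_Cn (fun w => g (upd w i (tau (w 0%R i)))) = int_Cn g.
Proof.
move=> pt mg g0; rewrite /int_Cn.
have H1 k (w : V) : (k <= i)%N ->
    iter_int k (fun w => g (upd w i (tau (w 0%R i)))) w = iter_int k g (upd w i (tau (w 0%R i))).
  elim: k w => [|k IH] w ki; first by [].
  rewrite /=.
  apply: eq_integral => x _; apply: eq_integral => y _.
  rewrite IH; last exact: ltnW.
  by rewrite upd_other ?gtn_eqF // upd_upd // ltn_eqF.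
have H2 k (w : V) : (i < k)%N ->
    iter_int k (fun w => g (upd w i (tau (w 0%R i)))) w = iter_int k g w.
  elim: k w => [|k IH] w; first by rewrite ltn0.
  rewrite ltnS leq_eqVlt => /orP[/eqP e|ik] /=; last first.
    by apply: eq_integral => x _; apply: eq_integral => y _; exact: IH.
  subst k; have [_ <-] := pt (fun c => iter_int i g (upd w i c))
    (measurable_upd_slice i w (measurable_iter_int i mg)) (fun c => iter_int_ge0 _ _ g0).
  by apply: eq_integral => x _; apply: eq_integral => y _; rewrite H1 // upd_self upd_same.
exact: H2.
Qed.

(** The image of Lebesgue measure under a shift gives half-open intervals their length, and this
    determines the measure. *)
Lemma lebesgue_shift (a : R) (h : RR -> \bar R) : measurable_fun setT h -> (forall x, 0 <= h x) ->
  \int[leb]_x h (x + a)%R = \int[leb]_x h x.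
Proof.
move=> mh h0.
have ms : measurable_fun setT ((fun x : RR => x + a)%R : RR -> RR).
  by apply: measurable_funD.
pose sh : {mfun RR >-> RR} := HB.pack ((fun x : RR => x + a)%R : RR -> RR) (isMeasurableFun.Build _ _ RR RR _ ms).
have H (A : set R) : measurable A -> leb A = pushforward leb sh A.
  move=> mA; apply: lebesgue_measure_unique mA => _ [[p q] _ <-].
  change (leb [set` `]p, q]] = leb (sh @^-1` [set` `]p, q]])).
  have -> : sh @^-1` [set` `]p, q]] = [set` `](p - a)%R, (q - a)%R]].
    by apply/seteqP; split=> x /=; rewrite !in_itv /= ltrBlDr lerBrDr.
  apply: (etrans (@lebesgue_measure_itv R `]p, q])); apply/esym.
  apply: (etrans (@lebesgue_measure_itv R `](p - a)%R, (q - a)%R])).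
  rewrite /= !lte_fin ltrD2r; case: ifP => // _.
  by rewrite -!EFinB; congr (_%:E); ring.
transitivity (\int[pushforward leb sh]_x h x).
  by rewrite (ge0_integral_pushforward ms).
by apply: eq_measure_integral => A mA _; exact/esym/H.
Qed.

Lemma plane_preserving_translation (a : C) : plane_preserving (fun c => c + a)%R.
Proof.
move=> h mh h0.
have E (x y : R) : (Complex x y + a)%R = Complex (x + Re a)%R (y + Im a)%R by case: a.
split.
  have -> : (fun p : RR * RR => h (Complex p.1 p.2 + a)%R) =
    (fun p : RR * RR => h (Complex p.1 p.2)) \o (fun p : RR * RR => (p.1 + Re a, p.2 + Im a)%R : RR * RR).
    by apply/funext => p /=; rewrite E.
  apply: (measurableT_comp mh); apply: measurable_fun_pair; exact: measurable_funD.
have H2 (x : R) : \int[leb]_y h (Complex x y + a)%R = \int[leb]_y h (Complex (x + Re a)%R y).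
  rewrite -[RHS](@lebesgue_shift (Im a)).
  - by apply: eq_integral => y _; rewrite E.
  - exact: (measurableT_comp mh (measurable_pair1 (x + Re a)%R)).
  - by move=> y.
transitivity (\int[leb]_x (\int[leb]_y h (Complex (x + Re a)%R y))).
  by apply: eq_integral => x _.
rewrite (@lebesgue_shift (Re a) (fun x => \int[leb]_y h (Complex x y))) //.
- exact: (measurable_fun_fubini_tonelli_F (m2 := leb) _ mh).
- by move=> x; exact: integral_ge0.
Qed.

Let shear_y (b : R) : plane_preserving (fun c => Complex (Re c) (Im c + b * Re c)%R).
Proof.
move=> h mh h0; split.
  have mg : measurable_fun setT (fun p : RR * RR => ((p.1, (p.2 + b * p.1)%R) : RR * RR)).
    by apply: measurable_fun_pair => //; apply: measurable_funD => //; apply: measurable_funM.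
  exact: (measurableT_comp mh mg).
apply: eq_integral => x _ /=.
apply: (@lebesgue_shift (b * x)%R (fun y => h (Complex x y))) => //.
exact: (measurableT_comp mh (measurable_pair1 x)).
Qed.

Let shear_x (b : R) : plane_preserving (fun c => Complex (Re c + b * Im c)%R (Im c)).
Proof.
move=> h mh h0.
have ms : measurable_fun setT (fun p : RR * RR => h (Complex (p.1 + b * p.2)%R p.2)).
  have mg : measurable_fun setT (fun p : RR * RR => (((p.1 + b * p.2)%R, p.2) : RR * RR)).
    by apply: measurable_fun_pair => //; apply: measurable_funD => //; apply: measurable_funM.
  exact: (measurableT_comp mh mg).
split; first exact: ms.
(* Exchanging the integrals on both sides puts the sheared variable [x] innermost, where the shear
   is a shift. *)
rewrite (fubini_tonelli (m1 := leb) (m2 := leb) _ ms (fun=> h0 _)).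
rewrite (fubini_tonelli (m1 := leb) (m2 := leb) _ mh (fun=> h0 _)).
apply: eq_integral => y _ /=.
apply: (@lebesgue_shift (b * y)%R (fun x => h (Complex x y))) => //.
exact: (measurableT_comp mh (measurable_pair2 y)).
Qed.

(* A rotation of angle not in pi Z is the product of three shears. *)
Let rotation_shears (t : R) : sin t != 0%R -> plane_preserving (fun c => cexp (Complex 0%R t) * c)%R.
Proof.
move=> s0; pose a := ((cos t - 1) / sin t)%R.
have -> : (fun c : C => cexp (Complex 0%R t) * c)%R =
  (fun c => Complex (Re c + a * Im c) (Im c))%R \o (fun c => Complex (Re c) (Im c + sin t * Re c))%R \o
  (fun c => Complex (Re c + a * Im c) (Im c))%R.
  have as' : (a * sin t = cos t - 1)%R by rewrite /a divfK.
  have aa : (a * (1 + cos t) = - sin t)%R.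
    apply: (mulIf s0); rewrite mulrAC as'.
    have := cos2Dsin2 t; rewrite !expr2 => e; lra.
  have Ec (c : C) : (cexp (Complex 0%R t) * c =
      Complex (cos t * Re c - sin t * Im c) (cos t * Im c + sin t * Re c))%R.
    by case: c => u v; rewrite /cexp /= expR0 !mul1r.
  apply/funext => c; rewrite Ec; apply: eqReIm; rewrite /=.
    transitivity ((1 + a * sin t) * Re c + a * (2 + a * sin t) * Im c)%R; last by ring.
    rewrite as'; have -> : (2 + (cos t - 1) = 1 + cos t)%R by ring.
    rewrite aa; ring.
  transitivity (sin t * Re c + (1 + a * sin t) * Im c)%R; last by ring.
  rewrite as'; ring.
by apply: plane_preserving_comp; [apply: plane_preserving_comp|]; [exact: shear_x | exact: shear_y | exact: shear_x].
Qed.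

(** Halving the angle disposes of the exceptional angles: either rotation by t/2 is a product of
    shears and is applied twice, or sin (t/2) = 0 and the rotation by t is the identity. *)
Lemma plane_preserving_rotation (t : R) : plane_preserving (fun c => cexp (Complex 0%R t) * c)%R.
Proof.
have [s0|s0] := eqVneq (sin (t / 2)%R) 0%R; last first.
  have -> : (fun c : C => cexp (Complex 0%R t) * c)%R =
     (fun c : C => cexp (Complex 0%R (t / 2)%R) * c)%R \o (fun c : C => cexp (Complex 0%R (t / 2)%R) * c)%R.
    apply/funext => c /=; rewrite mulrA -cexpD; congr (cexp _ * _)%R.
    by apply: eqReIm; [rewrite ReD /= addr0 | rewrite ImD; exact: splitr].
  by apply: plane_preserving_comp; exact: rotation_shears.
have e1 : cexp (Complex 0%R t) = 1%R.
  rewrite (splitr t).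
  apply: eqReIm; rewrite /cexp /= expR0 mul1r ?cosD ?sinD s0 ?mulr0 ?mul0r ?subr0 ?addr0 //.
  by have := cos2Dsin2 (t / 2)%R; rewrite s0 expr0n /= addr0 expr2.
have -> : (fun c : C => cexp (Complex 0%R t) * c)%R = id by apply/funext => c; rewrite e1 mul1r.
by move=> h mh h0; split; [exact: mh|].
Qed.

Lemma int_Cn_shift (z : V) (g : M -> \bar R) : measurable_fun setT g -> (forall v, 0 <= g v) ->
  int_Cn (fun w => g (w + z)%R) = int_Cn g.
Proof.
move=> mg g0.
(* Integrating a coordinate absorbs its shift, so after [k] steps only the coordinates from [k] on
   are still shifted. *)
have H k (w : V) : (k <= n)%N ->
    iter_int k (fun w => g (w + z)%R) w = iter_int k g (\row_j (w 0%R j + (if (j < k)%N then 0%R else z 0%R j)))%R.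
  elim: k w => [|k IH] w kn.
    by rewrite /=; congr g; apply/rowP => j; rewrite !mxE.
  rewrite /=; pose ck := z 0%R (Ordinal kn).
  set v := (\row_j _)%R.
  have [_ <-] := @plane_preserving_translation ck (fun c => iter_int k g (upd v k c))
    (measurable_upd_slice k v (measurable_iter_int k mg)) (fun c => iter_int_ge0 _ _ g0).
  apply: eq_integral => x _; apply: eq_integral => y _; rewrite IH; last exact: ltnW.
  congr iter_int; apply/rowP => j; rewrite !mxE; case: eqP => jk.
    by rewrite jk ltnn /ck; congr (_ + z 0 _)%R; apply: val_inj.
  by rewrite ltnS [(j <= k)%N]leq_eqVlt; move/eqP/negbTE: jk => ->.
rewrite {1}/int_Cn H // /int_Cn.
have E j : (\row_(j < n) ((0 : V) 0 j + (if (j < n)%N then 0 else z 0 j)))%R 0%R j = (0 : V)%R 0%R j.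
  by rewrite !mxE ltn_ord addr0.
by congr iter_int; apply/rowP => j; exact: E.
Qed.
End Meas3.

(** * Gaussian integrals *)

Section Gauss.
Variables (R : realType) (n : nat).
Local Notation C := R[i].
Local Notation RR := (measurableTypeR R).
Local Notation M := (MC R n).
Local Notation V := (Cn R n).
Local Notation leb := (@lebesgue_measure R).
Local Notation lebC := (@lebC R n).

Lemma integral_gauss_scale (c : R) : 0 < c ->
  (\int[leb]_x (expR (- (x * c) ^+ 2))%:E = (Num.sqrt pi / c)%:E)%E.
Proof.
move=> c0; pose F : R -> R := fun x => x * c.
have dF (x : R) : is_derive x 1 F c by exact: is_derive_mulr_id.
have F' : derive1 F = cst c.
  by apply/funext => x; rewrite derive1E; exact: derive_val.
have := @increasing_ge0_integration_by_substitutionT R F gauss_fun.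
rewrite integralT_gauss F'.
move=> H.
have {H} : ((Num.sqrt pi)%:E = \int[leb]_x (((gauss_fun \o F) * cst c) x)%:E)%E.
  apply: H.
  - by move=> x y xy; rewrite /F ltr_pM2r.
  - by move=> x; exact: cvg_cst.
  - exact: is_cvg_cst.
  - exact: is_cvg_cst.
  - by move=> x; have [] := dF x.
  - by apply: gt0_cvgMlNy => //.
  - by apply: gt0_cvgMly => //.
  - exact: continuous_gauss_fun.
  - by move=> x; exact: gauss_fun_ge0.
move=> H.
have mE : measurable_fun setT (fun x : RR => expR (- (x * c) ^+ 2)).
  apply: (measurableT_comp (@measurable_expR R)); apply: measurableT_comp => //.
  by apply: measurable_funX; apply: measurable_funM.
rewrite EFinM H -ge0_integralZr //.
- by apply: eq_integral => x _; rewrite /gauss_fun /F /= -!EFinM mulfK // gt_eqF.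
- apply/measurable_EFinP; apply: measurable_funM => //.
- by move=> x _; rewrite lee_fin; apply: mulr_ge0; [exact: gauss_fun_ge0 | exact: ltW].
- by rewrite lee_fin invr_ge0 ltW.
Qed.

Lemma gauss_prod (w : V) : gauss w =
  \prod_(i < n) (expR (- (pi * Re (w ord0 i) ^+ 2)) * expR (- (pi * Im (w ord0 i) ^+ 2))).
Proof.
rewrite /gauss /sqn mulr_sumr -sumrN expR_sum; apply: eq_bigr => i _.
by rewrite -expRD cabs_sq mulrDr opprD.
Qed.

Let pi0 : 0 < pi :> R := pi_gt0 R.

Lemma int_gauss : int_Cn (fun w : V => (gauss w)%:E) = 1%E.
Proof.
have -> : (fun w : V => (gauss w)%:E) = (fun w : V => (\prod_(i < n)
   (expR (- (pi * Re (w ord0 i) ^+ 2)) * expR (- (pi * Im (w ord0 i) ^+ 2))))%:E).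
  by apply/funext => w; rewrite gauss_prod.
rewrite (@int_Cn_prod R n (fun x => expR (- (pi * x ^+ 2))) 1).
- by rewrite expr1n expr1n.
- apply: (measurableT_comp (@measurable_expR R)); apply: measurableT_comp => //.
  by apply: measurable_funM => //; apply: measurable_funX.
- by move=> x; exact: expR_ge0.
- rewrite -[in RHS](divff (x := Num.sqrt (pi : R))) ?sqrtr_eq0 -?ltNge //.
  rewrite -integral_gauss_scale ?sqrtr_gt0 //; apply: eq_integral => x _.
  by rewrite exprMn sqr_sqrtr ?ltW // mulrC.
Qed.

(** Growth is measured by a sum over real coordinates because its exponential is then a product, and
    the Gaussian integral factors into one-dimensional ones. *)
Definition l1 (w : V) : R := \sum_(i < n) (`|Re (w ord0 i)| + `|Im (w ord0 i)|).

Lemma int_exp_l1 (c : R) : (int_Cn (fun w : V => (expR (c * l1 w) * gauss w)%:E) < +oo)%E.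
Proof.
pose h : RR -> R := fun x => expR (c * `|x| - pi * x ^+ 2).
have mh : measurable_fun setT h.
  apply: (measurableT_comp (@measurable_expR R)); apply: measurable_funB.
    by apply: measurable_funM => //; exact: measurableT_comp.
  by apply: measurable_funM => //; apply: measurable_funX.
have -> : (fun w : V => (expR (c * l1 w) * gauss w)%:E) =
  (fun w : V => (\prod_(i < n) (h (Re (w ord0 i)) * h (Im (w ord0 i))))%:E).
  apply/funext => w; congr (_%:E); rewrite gauss_prod /l1 mulr_sumr expR_sum -big_split /=.
  apply: eq_bigr => i _; rewrite -!expRD /h; congr expR.
  rewrite mulrDr; ring.
have hfin : (\int[leb]_x (h x)%:E < +oo)%E.
  pose s := Num.sqrt (pi / 2 : R).
  have s0 : 0 < s by rewrite sqrtr_gt0 divr_gt0.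
  (* Completing the square: c|x| - pi x^2 <= c^2/(2 pi) - (pi/2) x^2, and half of the Gaussian decay
     survives. *)
  apply: (@le_lt_trans _ _ (\int[leb]_x ((expR (c ^+ 2 / (2 * pi)))%:E * (expR (- (x * s) ^+ 2))%:E))%E).
    apply: ge0_le_integral => //.
    - by move=> x _; rewrite lee_fin expR_ge0.
    - exact/measurable_EFinP.
    - apply: measurable_funeM; apply/measurable_EFinP; apply: (measurableT_comp (@measurable_expR R)); apply: measurableT_comp => //.
      by apply: measurable_funX; apply: measurable_funM.
    - move=> x _; rewrite lee_fin -expRD ler_expR exprMn sqr_sqrtr ?divr_ge0 ?(ltW pi0) //.
      rewrite -(real_normK (num_real x)).
      set y := `|x|; have : 0 <= (c - pi * y) ^+ 2 / (2 * pi) by rewrite divr_ge0 ?sqr_ge0 // mulr_ge0 // (ltW pi0).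
      have -> : (c - pi * y) ^+ 2 / (2 * pi) = c ^+ 2 / (2 * pi) - c * y + y ^+ 2 * (pi / 2).
        have pin : pi != 0 :> R by rewrite gt_eqF.
        by move: (pi : R) pin => p pin; field.
      lra.
  rewrite ge0_integralZl //.
  - by rewrite integral_gauss_scale // -EFinM ltry.
  - apply/measurable_EFinP; apply: (measurableT_comp (@measurable_expR R)); apply: measurableT_comp => //.
    by apply: measurable_funX; apply: measurable_funM.
have h0 : (0 <= \int[leb]_x (h x)%:E)%E by apply: integral_ge0 => x _; rewrite lee_fin expR_ge0.
rewrite (@int_Cn_prod R n h (fine (\int[leb]_x (h x)%:E)%E)) ?ltry //.
- by move=> x; exact: expR_ge0.
- by rewrite fineK // ge0_fin_numE.
Qed.
End Gauss.

(** * Goursat's theorem and the mean value property *)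

Section Goursat.
Variable R : realType.
Local Notation C := R[i].
Local Notation leb := (@lebesgue_measure R).

Let integrable_itv (f : R -> R) (a b : R) : continuous f ->
  leb.-integrable `[a, b]%classic (EFin \o f).
Proof.
move=> cf; apply: continuous_compact_integrable; first exact: segment_compact.
exact: continuous_subspaceT.
Qed.

Definition rint (f : R -> R) (a b : R) : R := (\int[leb]_(x in `[a, b]%classic) f x)%R.

Lemma rintD f g a b : continuous f -> continuous g ->
  rint (fun x => f x + g x) a b = rint f a b + rint g a b.
Proof. by move=> cf cg; rewrite /rint RintegralD //; exact: integrable_itv. Qed.
Lemma rint_split f a c b : continuous f -> a <= c -> c <= b ->
  rint f a b = rint f a c + rint f c b.
Proof.
move=> cf ac cb; rewrite /rint -[X in _ + X]Rintegral_itv_obnd_cbnd; last first.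
  apply: (integrableS _ _ _ (integrable_itv c b cf)) => //.
  by apply: subset_itvr; rewrite bnd_simp.
rewrite -(@Rintegral_itvB _ _ (BLeft a)) ?bnd_simp //; last exact: integrable_itv.
by rewrite addrC subrK.
Qed.
Lemma rint_near_cst f a b c K : continuous f -> a <= b ->
  (forall x, a <= x <= b -> `|f x - c| <= K) -> `|rint f a b - c * (b - a)| <= K * (b - a).
Proof.
move=> cf ab H.
have cst_int (r : R) : rint (cst r) a b = r * (b - a).
  rewrite /rint Rintegral_cst //.
  have := @lebesgue_measure_itv R `[a, b]; rewrite /= lte_fin => ->.
  by case: ltgtP ab => //= ->; rewrite subrr.
have ccst (r : R) : continuous (cst r : R -> R) by move=> x; exact: cvg_cst.
rewrite ler_norml; apply/andP; split.
- rewrite lerBrDr -mulNr -mulrDl -cst_int.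
  apply: le_Rintegral => //; [exact: integrable_itv | exact: integrable_itv |].
  by move=> x; rewrite /= in_itv /= => /H; rewrite ler_norml => /andP[]; rewrite lerBrDr.
- rewrite lerBlDr -mulrDl -cst_int.
  apply: le_Rintegral => //; [exact: integrable_itv | exact: integrable_itv |].
  by move=> x; rewrite /= in_itv /= => /H; rewrite ler_norml => /andP[_]; rewrite lerBlDr.
Qed.

Definition cpath (f : R -> C) := continuous (fun x => Re (f x)) /\ continuous (fun x => Im (f x)).
Definition cint (f : R -> C) (a b : R) : C :=
  Complex (rint (fun x => Re (f x)) a b) (rint (fun x => Im (f x)) a b).

Lemma cintD f g a b : cpath f -> cpath g -> cint (fun x => f x + g x) a b = cint f a b + cint g a b.
Proof.
move=> [f1 f2] [g1 g2]; apply: eqReIm; rewrite ?ReD ?ImD /= -rintD //.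
  by congr rint; apply/funext => x; rewrite ReD.
by congr rint; apply/funext => x; rewrite ImD.
Qed.
Lemma cint_split f a c b : cpath f -> a <= c -> c <= b -> cint f a b = cint f a c + cint f c b.
Proof. by move=> [f1 f2] ac cb; apply: eqReIm; rewrite ?ReD ?ImD /= -rint_split. Qed.
Lemma cint_near_cst f a b (c : C) K : cpath f -> a <= b ->
  (forall x, a <= x <= b -> cabs (f x - c) <= K) ->
  cabs (cint f a b - c * (b - a)%:C) <= 2 * K * (b - a).
Proof.
move=> [f1 f2] ab H; apply: le_trans (cabs_le_ReIm _) _.
rewrite -mulrA mulr_natl mulr2n; apply: lerD.
  rewrite !ReImE mulr0 subr0 /=; apply: rint_near_cst => // x /H h.
  by apply: le_trans h; rewrite -ReN -ReD Re_le_cabs.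
rewrite !ReImE mulr0 add0r /=; apply: rint_near_cst => // x /H h.
by apply: le_trans h; rewrite -ImN -ImD Im_le_cabs.
Qed.
Lemma cpathD f g : cpath f -> cpath g -> cpath (fun x => f x + g x).
Proof.
move=> [f1 f2] [g1 g2]; split=> x.
  by under eq_fun do rewrite ReD; apply: cvgD; [exact: f1 | exact: g1].
by under eq_fun do rewrite ImD; apply: cvgD; [exact: f2 | exact: g2].
Qed.
Lemma cpathN f : cpath f -> cpath (fun x => - f x).
Proof.
move=> [f1 f2]; split=> x.
  by under eq_fun do rewrite ReN; apply: cvgN; exact: f1.
by under eq_fun do rewrite ImN; apply: cvgN; exact: f2.
Qed.
Lemma cpath_eps f : (forall x e, 0 < e -> exists2 d : R, 0 < d & forall y, `|y - x| < d -> cabs (f y - f x) < e) ->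
  cpath f.
Proof.
move=> H; split=> x; apply/cvgrPdist_lt => e e0; have [d d0 Hd] := H x e e0.
- near=> y; rewrite distrC -ReN -ReD; apply: le_lt_trans (Re_le_cabs _) _; apply: Hd.
  by near: y; rewrite near_simpl; apply: filterS (@nbhsx_ballx _ _ x d d0) => y; rewrite /ball /= distrC.
- near=> y; rewrite distrC -ImN -ImD; apply: le_lt_trans (Im_le_cabs _) _; apply: Hd.
  by near: y; rewrite near_simpl; apply: filterS (@nbhsx_ballx _ _ x d d0) => y; rewrite /ball /= distrC.
Unshelve. all: by end_near. Qed.

Definition cdiff (g : C -> C) := forall z, exists l : C, forall eps : R, 0 < eps ->
  exists2 d : R, 0 < d & forall h, cabs h < d -> cabs (g (z + h) - g z - h * l) <= eps * cabs h.

Lemma cdiff_cont g z e : cdiff g -> 0 < e -> exists2 d : R, 0 < d & forall w, cabs (w - z) < d -> cabs (g w - g z) < e.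
Proof.
move=> dg e0; have [l Hl] := dg z; have [d d0 H] := Hl 1 ltr01.
have l0 := cabs_ge0 l; have L0 : 0 < cabs l + 1 by lra.
exists (Num.min d (e / (cabs l + 1))); first by rewrite lt_min d0 divr_gt0.
move=> w; rewrite lt_min => /andP[/H h1 h2]; rewrite [z + _]addrC subrK in h1.
move: h2; rewrite ltr_pdivlMr // => h2.
have := cabsD (g w - g z - (w - z) * l) ((w - z) * l); rewrite subrK cabsM; lra.
Qed.

Lemma four_pigeons (x s1 s2 s3 s4 : R) : 4 * x <= s1 + s2 + (s3 + s4) ->
  [\/ x <= s1, x <= s2, x <= s3 | x <= s4].
Proof.
move=> H; have [h1|h1] := leP x s1; first by constructor 1.
have [h2|h2] := leP x s2; first by constructor 2.
have [h3|h3] := leP x s3; first by constructor 3.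
by constructor 4; lra.
Qed.

Section Square.
Variables (f : C -> C) (df : cdiff f).

Let hpath (b : R) : cpath (fun x => f (Complex x b)).
Proof.
apply: cpath_eps => x e e0; have [d d0 H] := cdiff_cont (Complex x b) df e0.
exists d => // y yx; apply: H; apply: le_lt_trans yx.
by apply: le_trans (cabs_le_ReIm _) _; rewrite !ReImE /= subrr normr0 addr0.
Qed.
Let vpath (a : R) : cpath (fun y => f (Complex a y)).
Proof.
apply: cpath_eps => x e e0; have [d d0 H] := cdiff_cont (Complex a x) df e0.
exists d => // y yx; apply: H; apply: le_lt_trans yx.
by apply: le_trans (cabs_le_ReIm _) _; rewrite !ReImE /= subrr normr0 add0r.
Qed.
Let hpathB b c : cpath (fun x => f (Complex x b) - f (Complex x c)).
Proof. by apply: cpathD => //; exact: cpathN. Qed.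
Let vpathB b c : cpath (fun x => f (Complex b x) - f (Complex c x)).
Proof. by apply: cpathD => //; exact: cpathN. Qed.

(* the contour integral of f along the boundary of the square [a,a+d] x [b,b+d] *)
Definition square_int (a b d : R) : C :=
  cint (fun x => f (Complex x b) - f (Complex x (b + d))) a (a + d) +
  'i * cint (fun y => f (Complex (a + d) y) - f (Complex a y)) b (b + d).

Lemma square_int_split a b d : 0 <= d ->
  square_int a b (d + d) = square_int a b d + square_int (a + d) b d +
    (square_int a (b + d) d + square_int (a + d) (b + d) d).
Proof.
move=> d0; rewrite /square_int !addrA.
rewrite (@cint_split _ a (a + d)) ?lerDl // -?addrA ?lerD2l ?lerDl //.
rewrite (@cint_split _ b (b + d)) ?lerDl // -?addrA ?lerD2l ?lerDl //.
have E1 p q : cint (fun x => f (Complex x b) - f (Complex x (b + (d + d)))) p q =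
   cint (fun x => f (Complex x b) - f (Complex x (b + d))) p q +
   cint (fun x => f (Complex x (b + d)) - f (Complex x (b + (d + d)))) p q.
  by rewrite -cintD //; congr cint; apply/funext => x; ring.
have E2 p q : cint (fun y => f (Complex (a + (d + d)) y) - f (Complex a y)) p q =
   cint (fun y => f (Complex (a + (d + d)) y) - f (Complex (a + d) y)) p q +
   cint (fun y => f (Complex (a + d) y) - f (Complex a y)) p q.
  by rewrite -cintD //; congr cint; apply/funext => x; ring.
rewrite !E1 !E2; ring.
Qed.

(** For the affine part of [f] the differences between opposite sides are the constants -idl and dl,
    whose contributions to the contour integral cancel. The remainder errs by 4ed on each pair of
    sides, [cint_near_cst] doubles this, and two pairs of length d give 16 e d^2. *)
Lemma square_int_small a b d (z l : C) e : 0 <= d -> 0 <= e -> a <= Re z <= a + d -> b <= Im z <= b + d ->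
  (forall h, cabs h <= 2 * d -> cabs (f (z + h) - f z - h * l) <= e * cabs h) ->
  cabs (square_int a b d) <= 16 * e * d ^+ 2.
Proof.
move=> d0 e0 az bz H.
have near x y : a <= x <= a + d -> b <= y <= b + d ->
    cabs (f (Complex x y) - f z - (Complex x y - z) * l) <= 2 * e * d.
  move=> xa yb.
  have hz : cabs (Complex x y - z) <= 2 * d.
    apply: le_trans (cabs_le_ReIm _) _; rewrite !ReImE /=.
    have : `|x - Re z| <= d by rewrite ler_norml; lra.
    have : `|y - Im z| <= d by rewrite ler_norml; lra.
    lra.
  have := H _ hz; rewrite [z + _]addrC subrK => h.
  apply: le_trans h _; nra.
have B1 : cabs (cint (fun x => f (Complex x b) - f (Complex x (b + d))) a (a + d) - (- (d%:C * 'i * l)) * (a + d - a)%:C)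
    <= 2 * (4 * e * d) * (a + d - a).
  apply: cint_near_cst; [exact: hpathB | by rewrite lerDl |].
  move=> x xa; have n1 := near x b xa; have n2 := near x (b + d) xa.
  have {}n1 := n1 ltac:(lra); have {}n2 := n2 ltac:(lra).
  have -> : f (Complex x b) - f (Complex x (b + d)) - - (d%:C * 'i * l) =
    (f (Complex x b) - f z - (Complex x b - z) * l) - (f (Complex x (b + d)) - f z - (Complex x (b + d) - z) * l).
    have -> : Complex x (b + d) = Complex x b + d%:C * 'i by apply: eqReIm; rewrite !ReImE /=; ring.
    ring.
  apply: le_trans (cabsBD _ _) _; lra.
have B2 : cabs (cint (fun y => f (Complex (a + d) y) - f (Complex a y)) b (b + d) - (d%:C * l) * (b + d - b)%:C)
    <= 2 * (4 * e * d) * (b + d - b).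
  apply: cint_near_cst; [exact: vpathB | by rewrite lerDl |].
  move=> y yb; have n1 := near (a + d) y; have n2 := near a y.
  have {}n1 := n1 ltac:(lra) yb; have {}n2 := n2 ltac:(lra) yb.
  have -> : f (Complex (a + d) y) - f (Complex a y) - d%:C * l =
    (f (Complex (a + d) y) - f z - (Complex (a + d) y - z) * l) - (f (Complex a y) - f z - (Complex a y - z) * l).
    have -> : Complex (a + d) y = Complex a y + d%:C by apply: eqReIm; rewrite /= ?addr0.
    ring.
  apply: le_trans (cabsBD _ _) _; lra.
rewrite /square_int; move: B1 B2; set I1 := cint _ _ _; set I2 := cint _ _ _.
rewrite ![_ + d - _]addrAC !subrr !add0r => B1 B2.
have -> : I1 + 'i * I2 = (I1 - - (d%:C * 'i * l) * d%:C) + 'i * (I2 - d%:C * l * d%:C) by ring.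
apply: le_trans (cabsD _ _) _; rewrite cabsM cabsI mul1r; nra.
Qed.

(** Repeated quartering: some quarter keeps a quarter of the integral, so the integral over the k-th
    square stays at least c times its area. Differentiability at the common point of the squares
    bounds it by 16 (c/32) = c/2 times the area, which is absurd for c > 0. *)
Lemma goursat a b d : 0 < d -> square_int a b d = 0.
Proof.
move=> d0; apply: contrapT => /eqP J0.
have {}J0 := cabs_gt0 J0.
pose c := cabs (square_int a b d) / d ^+ 2.
have c0 : 0 < c by rewrite divr_gt0 // exprn_gt0.
pose D k := d / 2 ^+ k.
have D0 k : 0 < D k by rewrite divr_gt0 // exprn_gt0.
have DS k : D k = D k.+1 + D k.+1.
  by rewrite /D exprS; have : (2 : R) ^+ k != 0 by [rewrite expf_neq0]; set q := (2 : R) ^+ k; move: q => q q0; field.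
pose good (p : R * R) k := c * D k ^+ 2 <= cabs (square_int p.1 p.2 (D k)).
(* The implication stands inside the existential so that [next] is a total function; the invariant
   [good] is recovered afterwards by induction. *)
have step (p : R * R) k : exists q : R * R, good p k ->
   good q k.+1 /\ (p.1 <= q.1 /\ q.1 + D k.+1 <= p.1 + D k) /\ (p.2 <= q.2 /\ q.2 + D k.+1 <= p.2 + D k).
  have [gp|ngp] := pselect (good p k); last by exists p => /ngp.
  move: gp; rewrite /good DS square_int_split; last exact: ltW.
  set e := D k.+1; have e0 : 0 < e := D0 k.+1.
  set J1 := square_int p.1 p.2 e; set J2 := square_int (p.1 + e) p.2 e.
  set J3 := square_int p.1 (p.2 + e) e; set J4 := square_int (p.1 + e) (p.2 + e) e.
  move=> gp; have T := le_trans (cabsD (J1 + J2) (J3 + J4)) (lerD (cabsD J1 J2) (cabsD J3 J4)).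
  have T4 : 4 * (c * e ^+ 2) <= cabs J1 + cabs J2 + (cabs J3 + cabs J4).
    by apply: le_trans T; apply: le_trans gp; rewrite le_eqVlt; apply/orP; left; apply/eqP; ring.
  have e1 : p.1 + (e + e) = p.1 + e + e by rewrite addrA.
  have e2 : p.2 + (e + e) = p.2 + e + e by rewrite addrA.
  rewrite !addrA; have l1 : p.1 <= p.1 + e by rewrite lerDl ltW.
  have l2 : p.2 <= p.2 + e by rewrite lerDl ltW.
  have m1 : p.1 + e <= p.1 + e + e by rewrite lerDl ltW.
  have m2 : p.2 + e <= p.2 + e + e by rewrite lerDl ltW.
  have [h|h|h|h] := four_pigeons T4.
  - by exists p.
  - by exists (p.1 + e, p.2).
  - by exists (p.1, p.2 + e).
  - by exists (p.1 + e, p.2 + e).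
pose next k p := projT1 (cid (step p k)).
pose P := fix P k := if k is k'.+1 then next k' (P k') else (a, b).
have PP k : good (P k) k.
  elim: k => [|k IH]; last by have [] := projT2 (cid (step (P k) k)) IH.
  by rewrite /good /= /D expr0 divr1 /c divfK // expf_neq0 // gt_eqF.
have PS k : ((P k).1 <= (P k.+1).1 /\ (P k.+1).1 + D k.+1 <= (P k).1 + D k) /\
            ((P k).2 <= (P k.+1).2 /\ (P k.+1).2 + D k.+1 <= (P k).2 + D k).
  by have [_] := projT2 (cid (step (P k) k)) (PP k).
(* The supremum of the left ends lies in all the nested intervals; this is used for each
   coordinate. *)
have nest (s : R * R -> R) : (forall k, s (P k) <= s (P k.+1) /\ s (P k.+1) + D k.+1 <= s (P k) + D k) ->
    exists x, forall k, s (P k) <= x <= s (P k) + D k.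
  move=> hs.
  have up k m : s (P k) <= s (P (k + m)%N) /\ s (P (k + m)%N) + D (k + m)%N <= s (P k) + D k.
    elim: m => [|m [i1 i2]]; first by rewrite addn0.
    by rewrite addnS; have [j1 j2] := hs (k + m)%N; lra.
  have bound k m : s (P k) <= s (P m) + D m.
    have [km|mk] := leqP k m.
      by have [u1 _] := up k (m - k)%N; rewrite subnKC // in u1; have := D0 m; lra.
    have [_] := up m (k - m)%N; rewrite subnKC; last exact: ltnW.
    by have := D0 k; lra.
  pose E := [set s (P k) | k in [set: nat]].
  exists (sup E) => k; apply/andP; split.
    by apply: ub_le_sup; [exists (s (P 0%N) + D 0%N) => _ [m _ <-]; exact: bound | exists k].
  by apply: ge_sup; [exists (s (P k)); exists k | move=> _ [m _ <-]; exact: bound].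
have [x Hx] := nest fst (fun k => (PS k).1).
have [y Hy] := nest snd (fun k => (PS k).2).
have [l Hl] := df (Complex x y).
have e0 : 0 < c / 32 by rewrite divr_gt0.
have [de de0 Hd] := Hl _ e0.
have [k hk] : exists k, 2 * D k < de.
  have q0 : 0 < de / (2 * d) by rewrite divr_gt0 // mulr_gt0.
  exists (Num.Def.truncn (2 * d / de)).+1.
  set N := (Num.Def.truncn _).+1; have N1 : 2 * d / de < N%:R by exact: truncnS_gt.
  rewrite ltr_pdivrMr // in N1.
  have N2 : N%:R <= 2 ^+ N :> R by rewrite -natrX ler_nat ltnW // ltn_expl.
  rewrite /D mulrA ltr_pdivrMr ?exprn_gt0 //; nra.
have := PP k; rewrite /good => g.
have B : cabs (square_int (P k).1 (P k).2 (D k)) <= 16 * (c / 32) * D k ^+ 2.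
  apply: (@square_int_small _ _ _ (Complex x y) l) => //; try exact: ltW.
  by move=> h hh; apply: Hd; apply: le_lt_trans hh hk.
have : 0 < D k ^+ 2 by rewrite exprn_gt0.
nra.
Qed.
End Square.
Lemma cdiff_comp g k : cdiff g -> cdiff k -> cdiff (g \o k).
Proof.
move=> dg dk z; have [l Hl] := dk z; have [m Hm] := dg (k z).
exists (l * m) => e e0.
have l0 := cabs_ge0 l; have m0 := cabs_ge0 m.
have L1 : 0 < cabs l + 1 by lra.
have M1 : 0 < cabs m + 1 by lra.
have p1 : 0 < e / 2 / (cabs l + 1) by rewrite !divr_gt0.
have p2 : 0 < e / 2 / (cabs m + 1) by rewrite !divr_gt0.
have [d1 d10 H1] := Hm _ p1; have [d2 d20 H2] := Hl _ p2; have [d3 d30 H3] := Hl _ ltr01.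
exists (Num.min (Num.min d2 d3) (d1 / (cabs l + 1))); first by rewrite !lt_min d20 d30 divr_gt0.
move=> h; rewrite !lt_min => /andP[/andP[/H2 h2 /H3 h3] h1].
rewrite ltr_pdivlMr // in h1.
have hh := cabs_ge0 h.
set u := k (z + h) - k z in h2 h3 *.
have ub : cabs u <= cabs h * (cabs l + 1).
  have := cabsD (u - h * l) (h * l); rewrite subrK cabsM; lra.
have := H1 u (le_lt_trans ub h1); rewrite {1}/u [k z + _]addrC subrK => h4.
have -> : (g \o k) (z + h) - (g \o k) z - h * (l * m) =
  (g (k (z + h)) - g (k z) - u * m) + (u - h * l) * m by rewrite /=; ring.
apply: le_trans (cabsD _ _) _; rewrite cabsM.
have b1 : e / 2 / (cabs l + 1) * cabs u <= e / 2 * cabs h.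
  rewrite mulrAC ler_pdivrMr // -[leRHS]mulrA ler_wpM2l //; lra.
have b2 : cabs (u - h * l) * cabs m <= e / 2 * cabs h.
  apply: le_trans (ler_wpM2r m0 h2) _; rewrite mulrAC ler_wpM2r // mulrAC ler_pdivrMr //; nra.
lra.
Qed.

Lemma cdiff_cexp : cdiff (@cexp R).
Proof.
move=> z; exists (1 * cexp (z + 0)) => e e0.
have [|d d0 H] := @cder_cexp R (fun h => z + h) 1 _ e e0; first by move=> h; rewrite addr0 mulr1.
by exists d => // h /H; rewrite addr0.
Qed.

Lemma cdiff_scale (c : C) : cdiff (fun z => z * c).
Proof.
move=> z; exists c => e e0; exists 1 => // h _.
have -> : (z + h) * c - z * c - h * c = 0 by ring.
by rewrite cabs0 mulr_ge0 ?cabs_ge0 // ltW.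
Qed.

Lemma cexp_2pi (x y : R) : cexp (Complex x (y + (pi + pi))) = cexp (Complex x y).
Proof.
rewrite /cexp /= (cosD y) (sinD y) (cosD pi pi) (sinD pi pi) cospi sinpi; congr Complex; ring.
Qed.

Lemma cpath_cdiff (f : C -> C) (s : R) : cdiff f -> cpath (fun y => f (Complex s y)).
Proof.
move=> df; apply: cpath_eps => x e e0; have [d d0 H] := cdiff_cont (Complex s x) df e0.
exists d => // y yx; apply: H; apply: le_lt_trans yx.
by apply: le_trans (cabs_le_ReIm _) _; rewrite !ReImE /= subrr normr0 add0r.
Qed.

Lemma cint0 (a b : R) : a <= b -> cint (fun=> 0) a b = 0.
Proof.
move=> ab; have c0 : cpath (fun=> 0 : C) by split=> x; exact: cvg_cst.
apply: cabs_eq0; apply/eqP; rewrite eq_le cabs_ge0 andbT.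
have H0 x : a <= x <= b -> cabs ((0 : C) - 0) <= 0 by rewrite subrr cabs0.
have := cint_near_cst c0 ab H0; rewrite mulr0 mul0r => h; apply: le_trans _ h.
by rewrite (_ : 0 * (b - a)%:C = 0) ?subr0 // mul0r.
Qed.

(** The mean over the circle of radius e^s is the integral of g o exp over a vertical segment of
    length 2 pi. On a square of that side the horizontal edges cancel by periodicity, so Goursat
    equates the means at s and s + 2 pi. Going down by steps of 2 pi shrinks the circle to 0, where
    continuity of [g] gives the value. *)
Lemma circle_mean0 (g : C -> C) : cdiff g ->
  cint (fun t => g (cexp (Complex 0 t))) 0 (pi + pi) = g 0 * (pi + pi)%:C.
Proof.
move=> dg; have p0 : 0 < pi + pi :> R by rewrite addr_gt0 ?pi_gt0.
pose phi := g \o @cexp R; have dphi : cdiff phi by apply: cdiff_comp => //; exact: cdiff_cexp.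
pose A s := cint (fun y => phi (Complex s y)) 0 (pi + pi).
have AS s : A (s + (pi + pi)) = A s.
  have := goursat dphi s 0 p0; rewrite /square_int !add0r.
  have -> : cint (fun x => phi (Complex x 0) - phi (Complex x (pi + pi))) s (s + (pi + pi)) = 0.
    have -> : (fun x => phi (Complex x 0) - phi (Complex x (pi + pi))) = fun=> 0.
      by apply/funext => x; have := cexp_2pi x 0; rewrite /phi /= add0r => ->; rewrite subrr.
    by rewrite cint0 // lerDl ltW.
  rewrite add0r => /(congr1 (fun z => - 'i * z)); rewrite mulr0 mulrA mulNr -expr2.
  have -> : - ('i : C) ^+ 2 = 1 by apply: eqReIm; rewrite expr2 !ReImE; ring.
  rewrite mul1r cintD; [|exact: cpath_cdiff | exact/cpathN/cpath_cdiff].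
  rewrite -/(A _) => e; apply/eqP; rewrite -subr_eq0 -e; apply/eqP; congr (_ + _).
  have := cintD 0 (pi + pi) (cpathN (cpath_cdiff s dphi)) (cpath_cdiff s dphi).
  have -> : (fun x => - phi (Complex s x) + phi (Complex s x)) = (fun x => 0).
    by apply/funext => x; rewrite addNr.
  rewrite cint0 ?ltW //.
  by move=> /esym/eqP; rewrite addr_eq0 => /eqP ->.
have AN m : A 0 = A (- (m%:R * (pi + pi))).
  elim: m => [|m ->]; first by rewrite mul0r oppr0.
  rewrite -(AS (- (m.+1%:R * _))); congr A; rewrite -natr1; ring.
rewrite -/(A 0); apply: subr0_eq; apply: cabs_eq0; apply/eqP; rewrite eq_le cabs_ge0 andbT.
apply/ler_addgt0Pr => e e0; rewrite add0r.
have e1 : 0 < e / (2 * (pi + pi)) by rewrite divr_gt0 // mulr_gt0.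
have [d d0 H] := cdiff_cont 0 dg e1.
(* Since 1 + x <= e^x, this [m] makes the radius e^(-2 pi m) smaller than the modulus of continuity
   [d] at 0. *)
pose m := (Num.Def.truncn (d^-1 / (pi + pi))).+1.
have Hm : d^-1 < m%:R * (pi + pi) by rewrite -ltr_pdivrMr // truncnS_gt.
rewrite (AN m).
have -> : e = 2 * (e / (2 * (pi + pi))) * (pi + pi - 0).
  by rewrite subr0; move: (pi + pi : R) p0 => q /lt0r_neq0 q0; field.
rewrite -[X in g 0 * X%:C]subr0; apply: cint_near_cst; [exact: cpath_cdiff | exact: ltW |].
move=> y _; apply: ltW; apply: H; rewrite subr0 cabs_cexp /= expRN.
rewrite invf_plt ?posrE ?expR_gt0 //; apply: lt_le_trans Hm _.
by apply: le_trans (expR_ge1Dx _); rewrite lerDr.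
Qed.

Lemma circle_mean (g : C -> C) (c : C) : cdiff g ->
  cint (fun t => g (cexp (Complex 0 t) * c)) 0 (pi + pi) = g 0 * (pi + pi)%:C.
Proof.
move=> dg; have := circle_mean0 (cdiff_comp dg (cdiff_scale c)).
by rewrite /= mul0r.
Qed.
End Goursat.

(** * Rotation of coordinates and the mean value against the Gaussian *)

Section MeanValue.
Variables (R : realType) (n : nat).
Local Notation C := R[i].
Local Notation RR := (measurableTypeR R).
Local Notation M := (MC R n).
Local Notation V := (Cn R n).
Local Notation leb := (@lebesgue_measure R).
Local Notation lebC := (@lebC R n).

Definition rot (i : 'I_n) (t : R) (w : V) : V := upd w i (cexp (Complex 0 t) * w 0 i).

Lemma measurable_rot (i : 'I_n) : measurable_fun setT (fun p : M * RR => rot i p.2 p.1 : M).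
Proof.
have E (t : R) (c : C) : cexp (Complex 0 t) * c =
    Complex (cos t * Re c - sin t * Im c) (cos t * Im c + sin t * Re c).
  by case: c => u v; rewrite /cexp /= expR0 !mul1r.
have -> : (fun p : M * RR => rot i p.2 p.1 : M) = (fun p : M * RR =>
    upd (p.1 : M) i (Complex (cos p.2 * Re (p.1 0 i) - sin p.2 * Im (p.1 0 i))
                             (cos p.2 * Im (p.1 0 i) + sin p.2 * Re (p.1 0 i)))).
  by apply/funext => p; rewrite /rot E.
have mc : measurable_fun setT (fun p : M * RR => cos p.2 : RR).
  apply: measurableT_comp; last exact: measurable_snd.
  by apply: continuous_measurable_fun; exact: continuous_cos.
have ms : measurable_fun setT (fun p : M * RR => sin p.2 : RR).
  apply: measurableT_comp; last exact: measurable_snd.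
  by apply: continuous_measurable_fun; exact: continuous_sin.
have mR : measurable_fun setT (fun p : M * RR => Re (p.1 0 i) : RR).
  exact: (measurableT_comp (measurable_Re_coord i) measurable_fst).
have mI : measurable_fun setT (fun p : M * RR => Im (p.1 0 i) : RR).
  exact: (measurableT_comp (measurable_Im_coord i) measurable_fst).
apply: measurable_upd; first exact: measurable_fst.
  by apply: measurable_funB; exact: measurable_funM.
by apply: measurable_funD; exact: measurable_funM.
Qed.

Lemma measurable_rot1 (i : 'I_n) (t : R) : measurable_fun setT (rot i t : M -> M).
Proof. exact: (measurableT_comp (measurable_rot i) (measurable_pair2 t)). Qed.

Lemma gauss_rot (i : 'I_n) (t : R) (w : V) : gauss (rot i t w) = gauss w.
Proof.
rewrite /gauss; congr (expR (- (_ * _))); apply: eq_bigr => j _.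
rewrite /rot mxE; case: eqP => // /val_inj ->.
by rewrite cabsM cabs_cexp /= expR0 mul1r.
Qed.

Lemma integral_rot (i : 'I_n) (t : R) (g : M -> \bar R) : measurable_fun setT g ->
  (\int[lebC]_w g (rot i t w) = \int[lebC]_w g w)%E.
Proof.
have pos (h : M -> \bar R) : measurable_fun setT h -> (forall w, 0 <= h w)%E ->
    (\int[lebC]_w h (rot i t w) = \int[lebC]_w h w)%E.
  move=> mh h0; rewrite !int_lebC //.
    exact: (@int_Cn_coord_change R n i _ h (plane_preserving_rotation t) mh h0).
  exact: (measurableT_comp mh (measurable_rot1 i t)).
move=> mg; rewrite integralE [RHS]integralE; congr (_ - _)%E.
  rewrite -(pos g^\+%E); [|exact: measurable_funepos|by move=> w; exact: funepos_ge0].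
  by apply: eq_integral => w _; rewrite !funeposE.
rewrite -(pos g^\-%E); [|exact: measurable_funeneg|by move=> w; exact: funeneg_ge0].
by apply: eq_integral => w _; rewrite !funenegE.
Qed.

Let T : R := pi + pi.
Let T0 : 0 < T. Proof. by rewrite addr_gt0 // pi_gt0. Qed.
Let Tn : T != 0. Proof. by rewrite lt0r_neq0. Qed.
Let I01 : set RR := `[0, T]%classic.
Let mI : measurable I01. Proof. exact: measurable_itv. Qed.
Let lebI : leb I01 = T%:E.
Proof. by apply: (etrans (@lebesgue_measure_itv R `[0, T])); rewrite /= lte_fin T0 sube0. Qed.

Let intI : (\int[leb]_x (\1_I01 x)%:E = T%:E)%E.
Proof. by rewrite integral_indic // setIT; exact: lebI. Qed.

(** Fubini on the product of C^n with [0, 2 pi]. Measure and Gaussian are invariant under rotation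
    of coordinate [i], so averaging over the angle does not change the integral, while [hu] says
    that the average puts 0 in that coordinate. *)
Lemma integral_circle_mean (i : 'I_n) (u : V -> R) : measurable_fun [set: M] (u : M -> RR) ->
  lebC.-integrable setT (fun w : M => (u w * gauss w)%:E) ->
  (forall w, continuous (fun t => u (rot i t w))) ->
  (forall w, rint (fun t => u (rot i t w)) 0 T = u (upd w i 0) * T) ->
  lebC.-integrable setT (fun w : M => (u (upd w i 0) * gauss w)%:E) /\
  (\int[lebC]_w (u (upd w i 0) * gauss w)%:E = \int[lebC]_w (u w * gauss w)%:E)%E.
Proof.
move=> mu iu cu hu.
have mG : measurable_fun [set: M] (fun w : M => (u w * gauss w)%:E) by case/integrableP: iu.
pose g w := u w * gauss w.
pose f (p : M * RR) : \bar R := (g (rot i p.2 p.1) * \1_I01 p.2)%:E.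
have mf : measurable_fun setT f.
  apply/measurable_EFinP; apply: measurable_funM.
    have mg : measurable_fun [set: M] (g : M -> RR) by exact/measurable_EFinP.
    exact: (measurableT_comp mg (measurable_rot i)).
  apply: (@measurableT_comp _ _ _ _ _ _ (\1_I01 : RR -> RR)) => //.
have fin : (\int[leb]_t \int[lebC]_w `|f (w, t)| < +oo)%E.
  have E t : (\int[lebC]_w `|f (w, t)| = (\int[lebC]_w `|(g w)%:E|) * (\1_I01 t)%:E)%E.
    have mag : measurable_fun setT (fun w : M => `|(g w)%:E|%E) by apply: measurableT_comp.
    rewrite -(@integral_rot i t (fun w => `|(g w)%:E|)%E) // -ge0_integralZr //.
    - apply: eq_integral => w _; rewrite -[f _]/((g (rot i t w) * \1_I01 t)%:E) EFinM abseM; congr (_ * _)%E.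
      by rewrite gee0_abs // lee_fin.
    - exact: (measurableT_comp mag (measurable_rot1 i t)).
  under eq_integral => t _ do rewrite E.
  rewrite ge0_integralZl //; last 2 first.
  - exact/measurable_EFinP.
  - exact: integral_ge0.
  rewrite intI.
  case/integrableP: iu => _; have : (0 <= \int[lebC]_w `|(g w)%:E|)%E by exact: integral_ge0.
  by rewrite /g; case: (integral _ _ _) => // r _ _; rewrite -EFinM ltry.
have If : (lebC \x leb)%E.-integrable setT f by apply/integrable21ltyP.
have slice w : (\int[leb]_t f (w, t) = (u (upd w i 0) * gauss w * T)%:E)%E.
  rewrite mulrAC -hu.
  have ci : leb.-integrable `[0, T]%classic (EFin \o (fun t => u (rot i t w))).
    apply: continuous_compact_integrable; first exact: segment_compact.
    exact: continuous_subspaceT.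
  transitivity (\int[leb]_(t in I01) ((gauss w)%:E * (u (rot i t w))%:E))%E.
    rewrite [RHS]integral_mkcond; apply: eq_integral => t _.
    rewrite /f /g gauss_rot patchE indicE /=.
    by case: (t \in I01) => /=; rewrite ?mulr1 ?mulr0 // EFinM muleC.
  rewrite integralZl // /rint /Rintegral mulrC EFinM fineK //.
  exact: integrable_fin_num.
have IF := integrable_fubini_F If.
have -> : (fun w : M => (u (upd w i 0) * gauss w)%:E) = (fun w => (T^-1)%:E * fubini_F leb f w)%E.
  apply/funext => w; rewrite /fubini_F slice -EFinM; congr (_%:E); rewrite [RHS]mulrC mulfK //; exact: Tn.
split; first exact: integrableZl.
rewrite integralZl // integral12_prod_meas1 // -integral21_prod_meas1 // /fubini_G.
have E t : (\int[lebC]_w f (w, t) = (\int[lebC]_w (g w)%:E) * (\1_I01 t)%:E)%E.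
  rewrite -(@integral_rot i t (fun w => (g w)%:E)) //.
  have I1 : lebC.-integrable setT (fun w : M => (g (rot i t w))%:E).
    apply/integrableP; split; first exact: (measurableT_comp mG (measurable_rot1 i t)).
    rewrite (@integral_rot i t (fun w => `|(g w)%:E|)%E); last by apply: measurableT_comp.
    by case/integrableP: iu.
  rewrite muleC -integralZl //; apply: eq_integral => w _.
  by rewrite /f /= -EFinM mulrC.
under eq_integral => t _ do rewrite E.
have Ifin := integrable_fin_num measurableT iu.
rewrite -[X in (\int[_]_t (X * _))%E]fineK // integralZl //; last first.
  by apply/integrableP; split; [exact/measurable_EFinP | under eq_integral => t _ do rewrite gee0_abs ?lee_fin //; rewrite intI ltry].
rewrite intI fineK // muleC -muleA -EFinM divff ?mule1 //; exact: Tn.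
Qed.
Lemma updD_ec (w : V) (i : 'I_n) (c h : C) : upd w i c + h *: ec R i = upd w i (c + h).
Proof.
apply/rowP => j; rewrite !mxE /=; case: (eqVneq j i) => [->|ji]; first by rewrite !eqxx mulr1.
by rewrite (_ : (j == i :> nat) = false) ?mulr0 ?addr0 //; exact: negbTE.
Qed.
Lemma upd_addZ_ec (w : V) (i j : 'I_n) (c h : C) : j != i ->
  upd (w + h *: ec R j) i c = upd w i c + h *: ec R j.
Proof.
move=> ji; apply/rowP => k; rewrite !mxE /=; case: (eqVneq (k : nat) i) => // /val_inj ->.
by rewrite eq_sym (negbTE ji) mulr0 addr0.
Qed.
Lemma upd_addZ_ec_same (w : V) (i : 'I_n) (c h : C) : upd (w + h *: ec R i) i c = upd w i c.
Proof.
apply/rowP => k; rewrite !mxE /=; case: (eqVneq (k : nat) i) => // ki.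
by rewrite (_ : (k == i) = false) ?mulr0 ?addr0 //; apply: contraNF ki => /eqP ->.
Qed.

Lemma entire_upd (f : V -> C) (i : 'I_n) (c : C) : entire f -> entire (fun w => f (upd w i c)).
Proof.
move=> /entireP[cf df]; apply/entireP; split.
  apply: (@ccont_comp R n f (fun w => upd w i c) 1 ltr01) => // z w.
  rewrite mul1r; apply: ler_sum => j _; rewrite !mxE.
  by case: eqP => // _; rewrite subrr cabs0 expr0n exprn_ge0 // cabs_ge0.
move=> z j; have [->|ji] := eqVneq j i.
  exists 0; have -> : (fun h => f (upd (z + h *: ec R i) i c)) = fun=> f (upd z i c).
    by apply/funext => h; rewrite upd_addZ_ec_same.
  exact: cder_cst.
have [l H] := df (upd z i c) j; exists l.
have -> // : (fun h => f (upd (z + h *: ec R j) i c)) = (fun h => f (upd z i c + h *: ec R j)).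
by apply/funext => h; rewrite upd_addZ_ec.
Qed.

Lemma entire_cdiff (f : V -> C) (w : V) (i : 'I_n) : entire f -> cdiff (fun c => f (upd w i c)).
Proof.
move=> /entireP[cf df] c; have [l H] := df (upd w i c) i; exists l => e e0.
by have [d d0 {}H] := H e e0; exists d => // h /H; rewrite !updD_ec addr0.
Qed.

Lemma entire_circle (f : V -> C) (w : V) (i : 'I_n) : entire f ->
  cpath (fun t => f (rot i t w)) /\ cint (fun t => f (rot i t w)) 0 T = f (upd w i 0) * T%:C.
Proof.
move=> ef; have dg := entire_cdiff w i ef; split; last exact: (circle_mean (w 0 i) dg).
exact: (cpath_cdiff 0 (cdiff_comp (cdiff_comp dg (cdiff_scale (w 0 i))) (@cdiff_cexp R))).
Qed.

Definition gauss_integrable (f : V -> C) :=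
  lebC.-integrable setT (fun w : M => (Re (f w) * gauss w)%:E) /\
  lebC.-integrable setT (fun w : M => (Im (f w) * gauss w)%:E).

Lemma gauss_integrable_upd0 (f : V -> C) (i : 'I_n) : entire f -> gauss_integrable f ->
  gauss_integrable (fun w => f (upd w i 0)) /\
  (\int[lebC]_w (Re (f (upd w i 0)) * gauss w)%:E = \int[lebC]_w (Re (f w) * gauss w)%:E)%E /\
  (\int[lebC]_w (Im (f (upd w i 0)) * gauss w)%:E = \int[lebC]_w (Im (f w) * gauss w)%:E)%E.
Proof.
move=> ef [iR iI]; have [/entireP[cf _]] := (ef, ef).
have [] := @integral_circle_mean i (fun w => Re (f w)) (measurable_ccont_Re cf) iR.
- by move=> w; have [[]] := entire_circle w i ef.
- move=> w; have [_ /(congr1 (@Re R))] := entire_circle w i ef.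
  by rewrite /= => ->; rewrite ReM /= mulr0 subr0.
move=> r1 r2 _.
have [] := @integral_circle_mean i (fun w => Im (f w)) (measurable_ccont_Im cf) iI.
- by move=> w; have [[]] := entire_circle w i ef.
- move=> w; have [_ /(congr1 (@Im R))] := entire_circle w i ef.
  by rewrite /= => ->; rewrite ImM /= mulr0 add0r.
by move=> i1 i2; split; [split|split].
Qed.

Let Z (k : nat) (w : V) : V := \row_j (if (j < k)%N then 0 else w 0 j).

(** [Z k] sets the first [k] coordinates to 0. Each further coordinate is one circle mean, which is
    why entirety and integrability are carried along the induction. *)
Lemma gauss_mean (f : V -> C) : entire f -> gauss_integrable f ->
  (\int[lebC]_w (Re (f w) * gauss w)%:E = (Re (f 0))%:E)%E /\
  (\int[lebC]_w (Im (f w) * gauss w)%:E = (Im (f 0))%:E)%E.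
Proof.
move=> ef gf.
have H k : (k <= n)%N -> [/\ entire (f \o Z k), gauss_integrable (f \o Z k),
   (\int[lebC]_w (Re (f (Z k w)) * gauss w)%:E = \int[lebC]_w (Re (f w) * gauss w)%:E)%E &
   (\int[lebC]_w (Im (f (Z k w)) * gauss w)%:E = \int[lebC]_w (Im (f w) * gauss w)%:E)%E].
  elim: k => [_|k IH kn].
    have -> : f \o Z 0 = f by apply/funext => w /=; congr f; apply/rowP => j; rewrite mxE.
    have Z0 w : f (Z 0 w) = f w by congr f; apply/rowP => j; rewrite mxE.
    by split => //; apply: eq_integral => w _; rewrite Z0.
  have [e1 g1 r1 i1] := IH (ltnW kn).
  have ZS w : Z k.+1 w = Z k (upd w (Ordinal kn) 0).
    apply/rowP => j; rewrite !mxE ltnS leq_eqVlt /=.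
    by case: ltngtP => //= _; case: eqP.
  have fZS : f \o Z k.+1 = fun w => (f \o Z k) (upd w (Ordinal kn) 0).
    by apply/funext => w /=; rewrite ZS.
  have [g2 [r2 i2]] := gauss_integrable_upd0 (Ordinal kn) e1 g1.
  split; rewrite ?fZS //; first exact: entire_upd.
    by rewrite -r1 -r2; apply: eq_integral => w _; rewrite ZS.
  by rewrite -i1 -i2; apply: eq_integral => w _; rewrite ZS.
have [_ _ <- <-] := H n (leqnn n).
have Zn w : Z n w = 0 by apply/rowP => j; rewrite !mxE ltn_ord.
have mg : measurable_fun [set: M] (fun w : M => (gauss w)%:E).
  have -> : (fun w : M => (gauss w)%:E) = fun w => (Re ((gauss w)%:C : C))%:E by [].
  apply/measurable_EFinP.
  have -> : (fun w : M => Re ((gauss w)%:C : C)) = fun w =>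
    (\prod_(i < n) (expR (- (pi * Re (w ord0 i) ^+ 2)) * expR (- (pi * Im (w ord0 i) ^+ 2)))).
    by apply/funext => w /=; rewrite gauss_prod.
  apply: (measurable_prod_coord (h := fun x => expR (- (pi * x ^+ 2)))).
  apply: (measurableT_comp (@measurable_expR R)); apply: measurableT_comp => //.
  by apply: measurable_funM => //; apply: measurable_funX.
have Ig : lebC.-integrable setT (fun w : M => (gauss w)%:E).
  apply/integrableP; split => //.
  under eq_integral => w _ do rewrite gee0_abs ?lee_fin ?expR_ge0 //.
  by rewrite int_lebC // ?int_gauss ?ltry // => w; rewrite lee_fin expR_ge0.
have Ic (c : R) : (\int[lebC]_w (c * gauss w)%:E = c%:E)%E.
  under eq_integral => w _ do rewrite EFinM.
  by rewrite integralZl // int_lebC // ?int_gauss ?mule1 // => w; rewrite lee_fin expR_ge0.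
by split; rewrite -[RHS]Ic; apply: eq_integral => w _; rewrite Zn.
Qed.
End MeanValue.

(** * The Fock space *)

Section Hilbert.
Variables (R : realType) (n : nat).
Local Notation C := R[i].
Local Notation RR := (measurableTypeR R).
Local Notation M := (MC R n).
Local Notation V := (Cn R n).
Local Notation lebC := (@lebC R n).
Implicit Types (f g h : V -> C).

Lemma gauss_ge0 (w : V) : 0 <= gauss w. Proof. exact: expR_ge0. Qed.

Lemma measurable_gauss : measurable_fun [set: M] (@gauss R n : M -> RR).
Proof.
have -> : (@gauss R n : M -> RR) = fun w =>
  (\prod_(i < n) (expR (- (pi * Re (w ord0 i) ^+ 2)) * expR (- (pi * Im (w ord0 i) ^+ 2)))).
  by apply/funext => w /=; rewrite gauss_prod.
apply: (measurable_prod_coord (h := fun x => expR (- (pi * x ^+ 2)))).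
apply: (measurableT_comp (@measurable_expR R)); apply: measurableT_comp => //.
by apply: measurable_funM => //; apply: measurable_funX.
Qed.

Lemma measurable_cabs2 f : ccont f -> measurable_fun [set: M] (fun w : M => cabs (f w) ^+ 2 * gauss w : RR).
Proof.
move=> cf; apply: measurable_funM; last exact: measurable_gauss.
under eq_fun do rewrite cabs_sq.
apply: measurable_funD; apply: measurable_funX; [exact: measurable_ccont_Re | exact: measurable_ccont_Im].
Qed.

Lemma fock_norm2E f : ccont f ->
  fock_norm2 f = (\int[lebC]_w (cabs (f w) ^+ 2 * gauss w)%:E)%E.
Proof.
move=> cf; rewrite /fock_norm2 int_lebC //; first by apply/measurable_EFinP; exact: measurable_cabs2.
by move=> w; rewrite lee_fin mulr_ge0 ?gauss_ge0 // exprn_ge0 // cabs_ge0.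
Qed.

Definition L2 f := ccont f /\ (fock_norm2 f < +oo)%E.

Lemma fockL2 f : in_fock f -> L2 f.
Proof. by move=> [/entireP[cf _] nf]. Qed.

Lemma L2_integrable f : L2 f -> lebC.-integrable setT (fun w : M => (cabs (f w) ^+ 2 * gauss w)%:E).
Proof.
move=> [cf nf]; apply/integrableP; split; first by apply/measurable_EFinP; exact: measurable_cabs2.
rewrite fock_norm2E // in nf; apply: le_lt_trans nf.
rewrite le_eqVlt; apply/orP; left; apply/eqP; apply: eq_integral => w _.
by rewrite gee0_abs // lee_fin mulr_ge0 ?gauss_ge0 // exprn_ge0 // cabs_ge0.
Qed.

Lemma L2_dom f : ccont f -> (exists2 b : M -> R, lebC.-integrable setT (EFin \o b) &
   forall w, cabs (f w) ^+ 2 * gauss w <= b w) -> L2 f.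
Proof.
move=> cf [b ib H]; split => //; rewrite fock_norm2E //.
case/integrableP: (ib) => mb fb; apply: le_lt_trans fb; apply: ge0_le_integral => //.
- by move=> w _; rewrite lee_fin mulr_ge0 ?gauss_ge0 // exprn_ge0 // cabs_ge0.
- by apply/measurable_EFinP; exact: measurable_cabs2.
- exact: measurableT_comp.
- by move=> w _; rewrite lee_fin; apply: le_trans (H w) (ler_norm _).
Qed.

Lemma L2D f g : L2 f -> L2 g -> L2 (fun w => f w + g w).
Proof.
move=> Lf Lg; have [cf _] := Lf; have [cg _] := Lg.
apply: L2_dom; first exact: ccontD.
exists (fun w => 2 * (cabs (f w) ^+ 2 * gauss w) + 2 * (cabs (g w) ^+ 2 * gauss w)).
  have -> : EFin \o (fun w : M => 2 * (cabs (f w) ^+ 2 * gauss w) + 2 * (cabs (g w) ^+ 2 * gauss w)) =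
    (fun w => 2%:E * (cabs (f w) ^+ 2 * gauss w)%:E + 2%:E * (cabs (g w) ^+ 2 * gauss w)%:E)%E.
    by apply/funext => w.
  by apply: integrableD => //; apply: integrableZl => //; exact: L2_integrable.
move=> w; rewrite !mulrA -mulrDl ler_wpM2r ?gauss_ge0 //.
have := cabsD (f w) (g w); have := cabs_ge0 (f w + g w).
have := cabs_ge0 (f w); have := cabs_ge0 (g w).
move: (cabs _) (cabs _) (cabs _) => a b c; have : 0 <= (b - c) ^+ 2 by exact: sqr_ge0.
nra.
Qed.
Lemma L2Z (c : C) f : L2 f -> L2 (fun w => c * f w).
Proof.
move=> Lf; have [cf _] := Lf; apply: L2_dom.
  by apply: ccontM => //; exact: ccont_cst.
exists (fun w => cabs c ^+ 2 * (cabs (f w) ^+ 2 * gauss w)).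
  have -> : EFin \o (fun w : M => cabs c ^+ 2 * (cabs (f w) ^+ 2 * gauss w)) =
    (fun w => (cabs c ^+ 2)%:E * (cabs (f w) ^+ 2 * gauss w)%:E)%E by apply/funext => w.
  by apply: integrableZl => //; exact: L2_integrable.
by move=> w; rewrite cabsM exprMn mulrA.
Qed.
Lemma L2N f : L2 f -> L2 (fun w => - f w).
Proof. by move=> /(L2Z (-1)); under eq_fun do rewrite mulN1r. Qed.
Lemma L2B f g : L2 f -> L2 g -> L2 (fun w => f w - g w).
Proof. by move=> Lf /L2N; exact: L2D. Qed.

Lemma in_fockD f g : in_fock f -> in_fock g -> in_fock (fun w => f w + g w).
Proof.
move=> Ff Fg; split; first by apply: entireD; [case: Ff | case: Fg].
by have [] := L2D (fockL2 Ff) (fockL2 Fg).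
Qed.
Lemma in_fockZ (c : C) f : in_fock f -> in_fock (fun w => c * f w).
Proof.
move=> Ff; split; first by apply: entireM; [exact: entire_cst | case: Ff].
by have [] := L2Z c (fockL2 Ff).
Qed.
Lemma in_fockB f g : in_fock f -> in_fock g -> in_fock (fun w => f w - g w).
Proof.
move=> Ff /(in_fockZ (-1)) Fg; have := in_fockD Ff Fg.
by under [X in in_fock X -> _]eq_fun do rewrite mulN1r.
Qed.
Lemma in_fock0 : in_fock (fun _ : V => 0 : C).
Proof.
split; first exact: entire_cst.
rewrite /fock_norm2 (_ : (fun w : V => _) = fun=> 0%E) ?iter_int0 ?ltry //.
  by rewrite /int_Cn iter_int0 ltry.
by apply/funext => w; rewrite cabs0 expr0n mul0r.
Qed.

Lemma measurable_prod_gauss f g : ccont f -> ccont g ->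
  measurable_fun [set: M] (fun w : M => Re (f w * (g w)^*) * gauss w : RR).
Proof.
move=> cf cg; apply: measurable_funM; last exact: measurable_gauss.
under eq_fun do rewrite !ReImE.
apply: measurable_funB; apply: measurable_funM; try exact: measurable_ccont_Re.
  exact: measurable_ccont_Im.
by apply: measurableT_comp => //; exact: measurable_ccont_Im.
Qed.

Lemma rip_integrable f g : L2 f -> L2 g ->
  lebC.-integrable setT (EFin \o (fun w : M => Re (f w * (g w)^*) * gauss w)).
Proof.
move=> Lf Lg; have [cf _] := Lf; have [cg _] := Lg.
have I : lebC.-integrable setT (fun w : M => (cabs (f w) ^+ 2 * gauss w)%:E + (cabs (g w) ^+ 2 * gauss w)%:E)%E.
  by apply: integrableD => //; exact: L2_integrable.
apply: (le_integrable measurableT _ _ I); first by apply/measurable_EFinP; exact: measurable_prod_gauss.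
move=> w _; rewrite -EFinD !abse_EFin lee_fin -mulrDl !normrM.
rewrite ler_wpM2r // [leRHS]ger0_norm ?addr_ge0 ?exprn_ge0 ?cabs_ge0 //.
apply: le_trans (Re_le_cabs _) _; rewrite cabsM cabs_conj.
have := cabs_ge0 (f w); have := cabs_ge0 (g w).
move: (cabs _) (cabs _) => a b a0 b0; have : 0 <= (a - b) ^+ 2 by exact: sqr_ge0.
nra.
Qed.

(* Re <f, g>; only this real form is integrated, and [fock_innerE] recovers the complex one. *)
Definition rip f g : R := (\int[lebC]_(w in setT) (Re (f w * (g w)^*) * gauss w))%R.

Lemma int_Cn_rip f g : L2 f -> L2 g -> fine (int_Cn (fun w => (Re (f w * (g w)^*) * gauss w)%:E)) = rip f g.
Proof. by move=> Lf Lg; rewrite -int_lebC_integrable //; exact: rip_integrable. Qed.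

Lemma fock_innerE f g : L2 f -> L2 g ->
  fock_inner f g = Complex (rip f g) (rip f (fun w => 'i * g w)).
Proof.
move=> Lf Lg; rewrite /fock_inner; congr Complex.
  rewrite -int_Cn_rip //; congr (fine (int_Cn _)); apply/funext => w.
  by rewrite !ReImE mulr0 subr0.
rewrite -int_Cn_rip //; last exact: L2Z.
congr (fine (int_Cn _)); apply/funext => w; congr (_%:E).
by rewrite !ReImE; ring.
Qed.

Lemma ripC f g : rip f g = rip g f.
Proof.
by rewrite /rip; apply: eq_Rintegral => w _; rewrite !ReImE; congr (_ * _); ring.
Qed.
Lemma ripDl f g h : L2 f -> L2 g -> L2 h -> rip (fun w => f w + g w) h = rip f h + rip g h.
Proof.
move=> Lf Lg Lh; rewrite /rip -RintegralD //; try exact: rip_integrable.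
by apply: eq_Rintegral => w _; rewrite mulrDl ReD mulrDl.
Qed.
Lemma ripDr f g h : L2 f -> L2 g -> L2 h -> rip h (fun w => f w + g w) = rip h f + rip h g.
Proof. by move=> Lf Lg Lh; rewrite ripC ripDl // !(ripC h). Qed.
Lemma ripZl (r : R) f g : L2 f -> L2 g -> rip (fun w => r%:C * f w) g = r * rip f g.
Proof.
move=> Lf Lg; rewrite /rip -RintegralZl //; last exact: rip_integrable.
by apply: eq_Rintegral => w _; rewrite !ReImE; ring.
Qed.
Lemma ripZr (r : R) f g : L2 f -> L2 g -> rip g (fun w => r%:C * f w) = r * rip g f.
Proof. by move=> Lf Lg; rewrite ripC ripZl // ripC. Qed.
Lemma ripNl f g : L2 f -> L2 g -> rip (fun w => - f w) g = - rip f g.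
Proof.
move=> Lf Lg; have -> : (fun w => - f w) = (fun w => (-1 : R)%:C * f w).
  by apply/funext => w; rewrite realCN mulN1r.
by rewrite ripZl // mulN1r.
Qed.
Lemma ripNr f g : L2 f -> L2 g -> rip g (fun w => - f w) = - rip g f.
Proof. by move=> Lf Lg; rewrite ripC ripNl // ripC. Qed.
Lemma ripBl f g h : L2 f -> L2 g -> L2 h -> rip (fun w => f w - g w) h = rip f h - rip g h.
Proof. by move=> Lf Lg Lh; rewrite ripDl ?ripNl //; exact: L2N. Qed.
Lemma ripBr f g h : L2 f -> L2 g -> L2 h -> rip h (fun w => f w - g w) = rip h f - rip h g.
Proof. by move=> Lf Lg Lh; rewrite ripC ripBl // !(ripC h). Qed.
Lemma rip_ZZ (c : C) f g : L2 f -> L2 g -> rip (fun w => c * f w) (fun w => c * g w) = cabs c ^+ 2 * rip f g.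
Proof.
move=> Lf Lg; rewrite /rip -RintegralZl //; last exact: rip_integrable.
by apply: eq_Rintegral => w _; rewrite cabs_sq !ReImE; ring.
Qed.
Lemma rip_il f g : L2 f -> L2 g -> rip (fun w => 'i * f w) g = - rip f (fun w => 'i * g w).
Proof.
move=> Lf Lg; rewrite -ripNr //; last exact: L2Z.
by rewrite /rip; apply: eq_Rintegral => w _; rewrite !ReImE; congr (_ * _); ring.
Qed.
Lemma rip_cl (c : C) f g : L2 f -> L2 g ->
  rip (fun w => c * f w) g = Re c * rip f g + Im c * rip (fun w => 'i * f w) g.
Proof.
move=> Lf Lg; rewrite -!ripZl //; last exact: L2Z.
rewrite -ripDl //; try by do ?apply: L2Z.
by rewrite /rip; apply: eq_Rintegral => w _; rewrite !ReImE; congr (_ * _); ring.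
Qed.

Lemma ripff f : ccont f -> rip f f = fine (fock_norm2 f).
Proof.
move=> cf; rewrite fock_norm2E // /rip /Rintegral; congr fine; apply: eq_integral => w _.
by rewrite mul_conj.
Qed.
Lemma rip_ge0 f : 0 <= rip f f.
Proof.
apply: Rintegral_ge0 => w _; rewrite mul_conj Re_real mulr_ge0 ?gauss_ge0 //.
by rewrite exprn_ge0 // cabs_ge0.
Qed.
Lemma fock_norm2_rip f : L2 f -> fock_norm2 f = (rip f f)%:E.
Proof.
move=> [cf nf]; rewrite ripff // fineK // ge0_fin_numE // fock_norm2E //.
apply: integral_ge0 => w _; rewrite lee_fin mulr_ge0 ?gauss_ge0 //.
by rewrite exprn_ge0 // cabs_ge0.
Qed.
Lemma fock_norm_sq f : ccont f -> fock_norm f ^+ 2 = rip f f.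
Proof. by move=> cf; rewrite /fock_norm -ripff // sqr_sqrtr // rip_ge0. Qed.
Lemma fock_norm_ge0 f : 0 <= fock_norm f. Proof. exact: sqrtr_ge0. Qed.

Lemma rip_CS f g : L2 f -> L2 g -> `|rip f g| <= fock_norm f * fock_norm g.
Proof.
move=> Lf Lg; have [cf _] := Lf; have [cg _] := Lg.
rewrite -(@ler_pXn2r _ 2) ?nnegrE ?mulr_ge0 ?fock_norm_ge0 // exprMn !fock_norm_sq //.
rewrite real_normK ?num_real //.
have Q (s t : R) : 0 <= s ^+ 2 * rip f f + t ^+ 2 * rip g g - 2 * s * t * rip f g.
  have Ls := L2Z s%:C Lf; have Lt := L2Z t%:C Lg.
  have := rip_ge0 (fun w => s%:C * f w - t%:C * g w).
  rewrite (ripBl Ls Lt (L2B Ls Lt)) (ripBr Ls Lt Ls) (ripBr Ls Lt Lt).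
  rewrite !(ripZl _ Lf Ls) !(ripZl _ Lg Ls) !(ripZl _ Lf Lt) !(ripZl _ Lg Lt).
  rewrite !(ripZr _ Lf Lf) !(ripZr _ Lf Lg) !(ripZr _ Lg Lf) !(ripZr _ Lg Lg).
  by rewrite (ripC g f) => H; apply: le_trans H _; rewrite le_eqVlt; apply/orP; left; apply/eqP; ring.
have a0 := rip_ge0 f; have b0 := rip_ge0 g.
have [g0|gn] := eqVneq (rip g g) 0.
  have [fg0|fgn] := eqVneq (rip f g) 0; first by rewrite fg0 expr0n mulr_ge0.
  (* With [rip g g = 0] the form is affine in [t], and this [t] gives it the value -1. *)
  have := Q 1 ((rip f f + 1) / (2 * rip f g)); rewrite g0.
  have -> : 1 ^+ 2 * rip f f + ((rip f f + 1) / (2 * rip f g)) ^+ 2 * 0 -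
     2 * 1 * ((rip f f + 1) / (2 * rip f g)) * rip f g = - 1 by field.
  lra.
have := Q (rip g g) (rip f g).
have -> : rip g g ^+ 2 * rip f f + rip f g ^+ 2 * rip g g - 2 * rip g g * rip f g * rip f g =
  rip g g * (rip f f * rip g g - rip f g ^+ 2) by ring.
by rewrite pmulr_rge0 ?subr_ge0 // lt_def gn.
Qed.

Lemma fock_normZ (c : C) f : L2 f -> fock_norm (fun w => c * f w) = cabs c * fock_norm f.
Proof.
move=> Lf; have [cf _] := Lf; have [cZ _] := L2Z c Lf.
apply/eqP; rewrite -(@eqrXn2 _ 2) ?mulr_ge0 ?fock_norm_ge0 ?cabs_ge0 // exprMn !fock_norm_sq //.
by rewrite rip_ZZ.
Qed.
Lemma fock_normN f : L2 f -> fock_norm (fun w => - f w) = fock_norm f.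
Proof.
move=> Lf; have -> : (fun w => - f w) = (fun w => (-1) * f w) by apply/funext => w; rewrite mulN1r.
by rewrite fock_normZ // cabsN cabs1 mul1r.
Qed.
Lemma fock_normD f g : L2 f -> L2 g -> fock_norm (fun w => f w + g w) <= fock_norm f + fock_norm g.
Proof.
move=> Lf Lg; have [cf _] := Lf; have [cg _] := Lg; have [cD _] := L2D Lf Lg.
rewrite -(@ler_pXn2r _ 2) ?nnegrE ?addr_ge0 ?fock_norm_ge0 // sqrrD !fock_norm_sq //.
rewrite ripDl ?ripDr //; try exact: L2D.
have := rip_CS Lf Lg; rewrite (ripC g f) ler_norml => /andP[_].
rewrite mulr2n; lra.
Qed.
Lemma fock_normB f g : L2 f -> L2 g -> fock_norm (fun w => f w - g w) <= fock_norm f + fock_norm g.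
Proof. by move=> Lf Lg; rewrite -(fock_normN Lg); apply: fock_normD => //; exact: L2N. Qed.
Lemma fock_norm_distC f g : L2 f -> L2 g -> fock_norm (fun w => f w - g w) = fock_norm (fun w => g w - f w).
Proof.
move=> Lf Lg; rewrite -fock_normN; last exact: L2B.
by congr fock_norm; apply/funext => w; rewrite opprB.
Qed.
Lemma fock_norm_tri f g h : L2 f -> L2 g -> L2 h ->
  fock_norm (fun w => f w - h w) <= fock_norm (fun w => f w - g w) + fock_norm (fun w => g w - h w).
Proof.
move=> Lf Lg Lh; apply: le_trans (fock_normD (L2B Lf Lg) (L2B Lg Lh)).
by rewrite le_eqVlt; apply/orP; left; apply/eqP; congr fock_norm; apply/funext => w; rewrite addrA subrK.
Qed.
Lemma fock_norm0 : fock_norm (fun _ : V => 0 : C) = 0.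
Proof.
have L0 := fockL2 in_fock0.
have -> : (fun _ : V => 0 : C) = (fun w : V => 0 * (0 : C)) by apply/funext => w; rewrite mul0r.
by rewrite fock_normZ // cabs0 mul0r.
Qed.

(** The factor 2 comes from estimating real and imaginary part separately; the sharp constant would
    not improve anything later. *)
Lemma fock_inner_le f g : L2 f -> L2 g -> cabs (fock_inner f g) <= 2 * (fock_norm f * fock_norm g).
Proof.
move=> Lf Lg; rewrite fock_innerE //; apply: le_trans (cabs_le_ReIm _) _ => /=.
rewrite mulr_natl mulr2n; apply: lerD; first exact: rip_CS.
apply: le_trans (rip_CS Lf (L2Z 'i Lg)) _.
by rewrite fock_normZ // cabsI mul1r.
Qed.

Lemma fock_norm_le f g : ccont f -> L2 g -> (forall w, cabs (f w) <= cabs (g w)) ->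
  L2 f /\ fock_norm f <= fock_norm g.
Proof.
move=> cf Lg H; have [cg _] := Lg.
have Hw w : cabs (f w) ^+ 2 * gauss w <= cabs (g w) ^+ 2 * gauss w.
  by rewrite ler_wpM2r ?gauss_ge0 // ler_pXn2r // ?nnegrE ?cabs_ge0.
have Lf : L2 f.
  apply: L2_dom => //; exists (fun w => cabs (g w) ^+ 2 * gauss w) => //.
  exact: L2_integrable.
split => //; rewrite -(@ler_pXn2r _ 2) ?nnegrE ?fock_norm_ge0 // !fock_norm_sq //.
rewrite -lee_fin -!fock_norm2_rip // !fock_norm2E //; apply: ge0_le_integral => //.
- by move=> w _; rewrite lee_fin mulr_ge0 ?gauss_ge0 // exprn_ge0 // cabs_ge0.
- by apply/measurable_EFinP; exact: measurable_cabs2.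
- by apply/measurable_EFinP; exact: measurable_cabs2.
- by move=> w _; rewrite lee_fin.
Qed.

(** Fatou's lemma. Applied to F_k - F_m with m tending to infinity, it yields in [fock_complete]
    both the square integrability of the limit and the convergence in norm. *)
Lemma fock_norm_fatou (F : nat -> V -> C) f (B : R) : (forall k, L2 (F k)) -> ccont f -> 0 <= B ->
  (forall w (e : R), 0 < e -> exists N, forall k, (N <= k)%N -> cabs (F k w - f w) < e) ->
  (forall k, fock_norm (F k) <= B) -> L2 f /\ fock_norm f <= B.
Proof.
move=> LF cf B0 cvF HB.
pose u k (w : M) := (cabs (F k w) ^+ 2 * gauss w)%:E.
have mu k : measurable_fun setT (u k) by apply/measurable_EFinP; apply: measurable_cabs2; case: (LF k).
have u0 k (w : M) : setT w -> (0 <= u k w)%E.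
  by move=> _; rewrite lee_fin mulr_ge0 ?gauss_ge0 // exprn_ge0 // cabs_ge0.
have lim w : limn_einf (u ^~ w) = (cabs (f w) ^+ 2 * gauss w)%:E.
  have cu : u ^~ w @ \oo --> (cabs (f w) ^+ 2 * gauss w)%:E.
    apply: cvg_EFin; first by near=> k.
    apply: cvgMl; rewrite /comp /=; under eq_fun do rewrite expr2; rewrite expr2.
    have cc : (fun k => cabs (F k w)) @ \oo --> cabs (f w).
      apply/cvgrPdist_lt => e e0; have [N HN] := cvF w e e0.
      exists N => // k /= Nk; apply: le_lt_trans (HN k Nk).
      rewrite ler_norml; have := cabsBB (f w) (F k w); have := cabsBB (F k w) (f w).
      rewrite (cabsB (f w)); lra.
    exact: cvgM.
  rewrite is_cvg_limn_einfE; [exact: cvg_lim | exact: cvgP cu].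
have := fatou lebC measurableT mu u0.
under eq_integral => w _ do rewrite lim.
rewrite -fock_norm2E // => H.
have bnd : (limn_einf (fun k => \int[lebC]_w u k w) <= (B ^+ 2)%:E)%E.
  rewrite limn_einf_lim; apply: lime_le; first exact: is_cvg_einfs.
  near=> k; apply: (@le_trans _ _ (\int[lebC]_w u k w)%E).
    by apply: ereal_inf_lbound; exists k => /=.
  have [ck _] := LF k.
  rewrite -fock_norm2E // fock_norm2_rip // lee_fin -fock_norm_sq //.
  by rewrite ler_pXn2r // ?nnegrE ?fock_norm_ge0.
have fin := le_trans H bnd.
have Lf : L2 f by split => //; apply: le_lt_trans fin _; rewrite ltry.
split => //; rewrite -(@ler_pXn2r _ 2) ?nnegrE ?fock_norm_ge0 // fock_norm_sq //.
by rewrite -lee_fin -fock_norm2_rip.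
Unshelve. all: by end_near. Qed.
End Hilbert.

(** * Weyl operators and the reproducing property *)

Section Weyl.
Variables (R : realType) (n : nat).
Local Notation C := R[i].
Local Notation RR := (measurableTypeR R).
Local Notation M := (MC R n).
Local Notation V := (Cn R n).
Local Notation lebC := (@lebC R n).
Implicit Types (f g h : V -> C) (z w : V).

Lemma measurable_translate z : measurable_fun setT (fun w : M => w + z : M).
Proof.
apply: measurable_fun_MC => i.
  under eq_fun do rewrite mxE ReD.
  by apply: measurable_funD => //; exact: measurable_Re_coord.
under eq_fun do rewrite mxE ImD.
by apply: measurable_funD => //; exact: measurable_Im_coord.
Qed.

Lemma integral_shift z (g : M -> \bar R) : measurable_fun setT g ->
  (\int[lebC]_w g (w + z)%R = \int[lebC]_w g w)%E.
Proof.
have pos (h : M -> \bar R) : measurable_fun setT h -> (forall w, 0 <= h w)%E ->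
    (\int[lebC]_w h (w + z)%R = \int[lebC]_w h w)%E.
  move=> mh h0; rewrite !int_lebC //; first exact: int_Cn_shift.
  exact: (measurableT_comp mh (measurable_translate z)).
move=> mg; rewrite integralE [RHS]integralE; congr (_ - _)%E.
  rewrite -(pos g^\+%E); [|exact: measurable_funepos|by move=> w; exact: funepos_ge0].
  by apply: eq_integral => w _; rewrite !funeposE.
rewrite -(pos g^\-%E); [|exact: measurable_funeneg|by move=> w; exact: funeneg_ge0].
by apply: eq_integral => w _; rewrite !funenegE.
Qed.

Lemma cabs_kz z w : cabs (kz z w) = expR (pi * Re (dotc z w) - pi / 2 * sqn z).
Proof. by rewrite cabs_cexp !ReImE mul0r subr0. Qed.

(** Completing the square in the exponent; together with translation invariance this makes [weyl z]
    isometric. *)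
Lemma kz_gauss z w : cabs (kz z w) ^+ 2 * gauss w = gauss (w - z).
Proof.
rewrite cabs_kz -expRM_natl -expRD /gauss; congr expR.
rewrite sqnD sqnN dotcNr ReN dotcC Re_conj; set p := pi; by field.
Qed.

Lemma kz0l w : kz 0 w = 1 :> C.
Proof. by rewrite /kz dotc0l sqn0 mulr0 mulr0 realC0 subr0 cexp0. Qed.
Lemma kz_0r z : kz z 0 = (expR (- (pi / 2 * sqn z)))%:C.
Proof.
rewrite /kz dotc0r mulr0 sub0r -realCN.
by apply: eqReIm; rewrite /cexp /= ?cos0 ?sin0 ?mulr1 ?mulr0.
Qed.

Lemma ccont_weyl z f : ccont f -> ccont (weyl z f).
Proof.
move=> cf; apply: ccontM; first by have /entireP[] := @entire_kz R n z.
by apply: (@ccont_comp R n f (fun w => w - z) 1 ltr01) => // x w; rewrite opprB addrA subrK mul1r.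
Qed.

Lemma entire_weyl z f : entire f -> entire (weyl z f).
Proof. by move=> ef; apply: entireM; [exact: entire_kz | exact: entire_shift]. Qed.

Lemma rip_weyl z f g : ccont f -> ccont g -> rip (weyl z f) (weyl z g) = rip f g.
Proof.
move=> cf cg; rewrite /rip /Rintegral; congr fine.
rewrite -[RHS](integral_shift (- z)); last by apply/measurable_EFinP; exact: measurable_prod_gauss.
apply: eq_integral => w _; rewrite -kz_gauss; congr (_%:E).
by rewrite /weyl cabs_sq !ReImE; ring.
Qed.

Lemma L2_weyl z f : L2 f -> L2 (weyl z f).
Proof.
move=> [cf nf]; split; first exact: ccont_weyl.
rewrite fock_norm2E; last exact: ccont_weyl.
rewrite fock_norm2E // in nf; apply: le_lt_trans nf; rewrite le_eqVlt; apply/orP; left; apply/eqP.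
rewrite -[RHS](integral_shift (- z)); last by apply/measurable_EFinP; exact: measurable_cabs2.
by apply: eq_integral => w _; rewrite -kz_gauss /weyl cabsM exprMn; congr (_%:E); ring.
Qed.

Lemma fock_weyl z f : in_fock f -> in_fock (weyl z f).
Proof.
move=> Ff; split; first by apply: entire_weyl; case: Ff.
by have [] := L2_weyl z (fockL2 Ff).
Qed.

Lemma fock_norm_weyl z f : ccont f -> fock_norm (weyl z f) = fock_norm f.
Proof.
move=> cf; apply/eqP; rewrite -(@eqrXn2 _ 2) ?fock_norm_ge0 // !fock_norm_sq //.
  by rewrite rip_weyl.
exact: ccont_weyl.
Qed.

(** The unimodular cocycle of the projective representation given by the Weyl operators, see
    [weyl_weyl]. *)
Definition wphase z w : C := cexp (Complex 0 (- (pi * Im (dotc w z)))).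
Lemma cabs_wphase z w : cabs (wphase z w) = 1.
Proof. by rewrite cabs_cexp /= expR0. Qed.

Lemma weyl_weyl z w f : weyl z (weyl w f) = fun x => wphase z w * weyl (z + w) f x.
Proof.
apply/funext => x; rewrite /weyl !mulrA opprD addrA; congr (_ * _).
rewrite /kz /wphase -!cexpD; congr cexp.
apply: eqReIm; rewrite !ReImE !dotcDl !dotcDr !dotcNr !ReImE /= ?sqnD ?(dotcC w z) ?Re_conj ?Im_conj; set p := (pi : R); rewrite ?add0r; by field.
Qed.

Lemma weyl0 f : weyl 0 f = f.
Proof. by apply/funext => x; rewrite /weyl kz0l subr0 mul1r. Qed.
Lemma weylK z f : weyl z (weyl (- z) f) = f.
Proof.
rewrite weyl_weyl subrr weyl0; apply/funext => x.
by rewrite /wphase dotcNl dotcc ImN Im_real oppr0 mulr0 oppr0 cexp0 mul1r.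
Qed.
Lemma weylZ z (c : C) f : weyl z (fun w => c * f w) = fun w => c * weyl z f w.
Proof. by apply/funext => x; rewrite /weyl; ring. Qed.
Lemma weylD z f g : weyl z (fun w => f w + g w) = fun w => weyl z f w + weyl z g w.
Proof. by apply/funext => x; rewrite /weyl; ring. Qed.
Lemma weylB z f g : weyl z (fun w => f w - g w) = fun w => weyl z f w - weyl z g w.
Proof. by apply/funext => x; rewrite /weyl; ring. Qed.
Lemma rip_weyl_adj z f g : ccont f -> ccont g -> rip (weyl z f) g = rip f (weyl (- z) g).
Proof. by move=> cf cg; rewrite -{1}(weylK z g) rip_weyl //; exact: ccont_weyl. Qed.

Lemma in_fock1 : in_fock (fun _ : V => 1 : C).
Proof.
split; first exact: entire_cst.
rewrite /fock_norm2 (_ : (fun w : V => _) = fun w : V => (gauss w)%:E) ?int_gauss ?ltry //.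
by apply/funext => w; rewrite cabs1 expr1n mul1r.
Qed.
Lemma fock_norm1 : fock_norm (fun _ : V => 1 : C) = 1.
Proof.
rewrite /fock_norm /fock_norm2 (_ : (fun w : V => _) = fun w : V => (gauss w)%:E) ?int_gauss ?sqrtr1 //.
by apply/funext => w; rewrite cabs1 expr1n mul1r.
Qed.
Lemma kz_weyl z : kz z = weyl z (fun=> 1).
Proof. by apply/funext => x; rewrite /weyl mulr1. Qed.
Lemma in_fock_kz z : in_fock (kz z). Proof. by rewrite kz_weyl; apply: fock_weyl; exact: in_fock1. Qed.
Lemma fock_norm_kz z : fock_norm (kz z) = 1.
Proof. by rewrite kz_weyl fock_norm_weyl ?fock_norm1 //; exact: ccont_cst. Qed.

(** Pairing with a constant is taking the mean against the Gaussian, so the mean value property is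
    the reproducing property at 0. The Weyl operators move it to every other point in [rip_kz]. *)
Lemma rip_one f : in_fock f -> rip f (fun=> 1) = Re (f 0) /\ rip f (fun=> 'i) = Im (f 0).
Proof.
move=> Ff; have Lf := fockL2 Ff; have L1 := fockL2 in_fock1; have Li := L2Z 'i L1.
have E1 : EFin \o (fun w : M => Re (f w * (1 : C)^*) * gauss w) = fun w : M => (Re (f w) * gauss w)%:E.
  by apply/funext => w /=; congr (_%:E); rewrite !ReImE; ring.
have Ei : EFin \o (fun w : M => Re (f w * ('i * 1 : C)^*) * gauss w) = fun w : M => (Im (f w) * gauss w)%:E.
  by apply/funext => w /=; congr (_%:E); rewrite !ReImE; ring.
have G : gauss_integrable f.
  by split; [rewrite -E1; exact: (rip_integrable Lf L1) | rewrite -Ei; exact: (rip_integrable Lf Li)].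
have [r i] := gauss_mean (proj1 Ff) G.
split.
  by rewrite /rip /Rintegral -[RHS]/(fine (Re (f 0))%:E) -r -E1.
by under [X in rip _ X]eq_fun do rewrite -['i]mulr1; rewrite /rip /Rintegral -[RHS]/(fine (Im (f 0))%:E) -i -Ei.
Qed.

Lemma rip_kz z f : in_fock f -> rip f (kz z) = expR (- (pi / 2 * sqn z)) * Re (f z) /\
  rip f (fun w => 'i * kz z w) = expR (- (pi / 2 * sqn z)) * Im (f z).
Proof.
move=> Ff; have [[ef _] [cf _]] := (Ff, fockL2 Ff).
have [h1 h2] := rip_one (fock_weyl (- z) Ff).
have E c : rip f (weyl z (fun=> c)) = rip (weyl (- z) f) (fun=> c).
  by rewrite rip_weyl_adj ?opprK //; exact: ccont_cst.
have F : weyl (- z) f 0 = (expR (- (pi / 2 * sqn z)))%:C * f z.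
  by rewrite /weyl kz_0r sqnN sub0r opprK.
split; first by rewrite kz_weyl E h1 F !ReImE mul0r subr0.
have -> : (fun w => 'i * kz z w) = weyl z (fun=> 'i).
  by apply/funext => w; rewrite /weyl mulrC.
by rewrite E h2 F !ReImE mul0r addr0.
Qed.

Lemma fock_inner_kz z f : in_fock f -> fock_inner f (kz z) = (expR (- (pi / 2 * sqn z)))%:C * f z.
Proof.
move=> Ff; rewrite fock_innerE; [|exact: fockL2|by apply: fockL2; exact: in_fock_kz].
by have [-> ->] := rip_kz z Ff; apply: eqReIm; rewrite ?ReM ?ImM /= mul0r ?subr0 ?addr0.
Qed.

Lemma fock_point_le z f : in_fock f -> cabs (f z) <= 2 * expR (pi / 2 * sqn z) * fock_norm f.
Proof.
move=> Ff; have := fock_inner_le (fockL2 Ff) (fockL2 (in_fock_kz z)).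
rewrite fock_inner_kz // fock_norm_kz mulr1 cabsM cabs_real ger0_norm ?expR_ge0 // expRN.
by rewrite mulrC ler_pdivrMr ?expR_gt0 // mulrAC.
Qed.
End Weyl.

(** * Functions of exponential growth and derivatives of kernels *)

Section Kernels.
Variables (R : realType) (n : nat).
Local Notation C := R[i].
Local Notation RR := (measurableTypeR R).
Local Notation M := (MC R n).
Local Notation V := (Cn R n).
Local Notation lebC := (@lebC R n).
Implicit Types (f g h P : V -> C) (z w q a : V).

Lemma fock_innerDl f g h : L2 f -> L2 g -> L2 h ->
  fock_inner (fun w => f w + g w) h = fock_inner f h + fock_inner g h.
Proof.
move=> Lf Lg Lh; have Li := L2Z 'i Lh.
by rewrite !fock_innerE ?ripDl //; exact: L2D.
Qed.
Lemma fock_innerDr f g h : L2 f -> L2 g -> L2 h ->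
  fock_inner h (fun w => f w + g w) = fock_inner h f + fock_inner h g.
Proof.
move=> Lf Lg Lh; rewrite !fock_innerE ?ripDr //; last exact: L2D.
have -> : (fun w => 'i * (f w + g w)) = fun w => 'i * f w + 'i * g w.
  by apply/funext => w; rewrite mulrDr.
by rewrite ripDr //; exact: L2Z.
Qed.
Lemma rip_cr (c : C) f g : L2 f -> L2 g ->
  rip g (fun w => c * f w) = Re c * rip g f + Im c * rip g (fun w => 'i * f w).
Proof. by move=> Lf Lg; rewrite ripC rip_cl // !(ripC g). Qed.
Lemma fock_innerZr (c : C) f g : L2 f -> L2 g ->
  fock_inner g (fun w => c * f w) = c^* * fock_inner g f.
Proof.
move=> Lf Lg; have Li := L2Z 'i Lf; have Lc := L2Z c Lf.
rewrite !fock_innerE // rip_cr //.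
have -> : (fun w => 'i * (c * f w)) = fun w => c * ('i * f w).
  by apply/funext => w; ring.
rewrite rip_cr //.
have -> : (fun w => 'i * ('i * f w)) = fun w => - f w.
  by apply/funext => w; apply: eqReIm; rewrite !ReImE; ring.
rewrite ripNr //; apply: eqReIm; rewrite ?ReM ?ImM ?Re_conj ?Im_conj /=; ring.
Qed.
Lemma fock_innerC f g : L2 f -> L2 g -> fock_inner g f = (fock_inner f g)^*.
Proof.
move=> Lf Lg; rewrite !fock_innerE //; apply: eqReIm; rewrite ?Re_conj ?Im_conj /= 1?ripC //.
by rewrite rip_il.
Qed.
Lemma fock_innerZl (c : C) f g : L2 f -> L2 g ->
  fock_inner (fun w => c * f w) g = c * fock_inner f g.
Proof.
move=> Lf Lg; have Lc := L2Z c Lf.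
by rewrite (fock_innerC Lg Lc) fock_innerZr // conjM conjCK -(fock_innerC Lg Lf).
Qed.
Lemma fock_innerBr f g h : L2 f -> L2 g -> L2 h ->
  fock_inner h (fun w => f w - g w) = fock_inner h f - fock_inner h g.
Proof.
move=> Lf Lg Lh.
have -> : (fun w => f w - g w) = fun w => f w + (-1) * g w.
  by apply/funext => w; rewrite mulN1r.
rewrite fock_innerDr //; last exact: L2Z.
by rewrite fock_innerZr // conjN -[1](realC1 R) conj_real mulN1r.
Qed.
Lemma fock_innerBl f g h : L2 f -> L2 g -> L2 h ->
  fock_inner (fun w => f w - g w) h = fock_inner f h - fock_inner g h.
Proof.
move=> Lf Lg Lh.
have -> : (fun w => f w - g w) = fun w => f w + (-1) * g w.
  by apply/funext => w; rewrite mulN1r.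
rewrite fock_innerDl //; last exact: L2Z.
by rewrite fock_innerZl // mulN1r.
Qed.

Lemma l1_ge0 w : 0 <= l1 w.
Proof. by apply: sumr_ge0 => i _; rewrite addr_ge0. Qed.
Lemma coord_le_l1 w i : cabs (w 0 i) <= l1 w.
Proof.
apply: le_trans (cabs_le_ReIm _) _; rewrite /l1 (bigD1 i) //= lerDl.
by apply: sumr_ge0 => j _; rewrite addr_ge0.
Qed.
Lemma dotc_le_l1 a w : cabs (dotc a w) <= (\sum_(i < n) cabs (a 0 i)) * l1 w.
Proof.
apply: le_trans (cabs_sum _ _ _) _; rewrite mulr_suml; apply: ler_sum => i _.
by rewrite cabsM cabs_conj ler_wpM2l ?cabs_ge0 // coord_le_l1.
Qed.

Lemma ccont_Re f : ccont f -> ccont (fun w => (Re (f w))%:C).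
Proof.
move=> cf z e e0; have [d d0 H] := cf z e e0; exists d => // w /H; apply: le_lt_trans.
by rewrite -realCB cabs_real -ReN -ReD Re_le_cabs.
Qed.
Lemma ccont_Im f : ccont f -> ccont (fun w => (Im (f w))%:C).
Proof.
move=> cf z e e0; have [d d0 H] := cf z e e0; exists d => // w /H; apply: le_lt_trans.
by rewrite -realCB cabs_real -ImN -ImD Im_le_cabs.
Qed.
Lemma ccont_cabs f : ccont f -> ccont (fun w => (cabs (f w))%:C).
Proof.
move=> cf z e e0; have [d d0 H] := cf z e e0; exists d => // w /H; apply: le_lt_trans.
rewrite -realCB cabs_real ler_norml; have := cabsBB (f w) (f z); have := cabsBB (f z) (f w).
rewrite (cabsB (f z)); lra.
Qed.

Definition expl1 (c : R) (w : V) : C := cexp ((c * l1 w)%:C).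
Lemma expl1E c w : expl1 c w = (expR (c * l1 w))%:C.
Proof. by rewrite /expl1 /cexp; apply: eqReIm; rewrite /= ?cos0 ?sin0 ?mulr1 ?mulr0. Qed.
Lemma cabs_expl1 c w : cabs (expl1 c w) = expR (c * l1 w).
Proof. by rewrite expl1E cabs_real ger0_norm // expR_ge0. Qed.
Lemma ccont_expl1 c : ccont (expl1 c).
Proof.
apply: ccont_cexp; have -> : (fun w : V => (c * l1 w)%:C) = (fun w : V => c%:C * \sum_(i < n)
   ((cabs ((Re (w 0 i))%:C : C))%:C + (cabs ((Im (w 0 i))%:C : C))%:C)).
  apply/funext => w; rewrite realCM; congr (_ * _).
  rewrite (big_morph (real_complex R) (@realCD R) (realC0 R)); apply: eq_bigr => i _.
  by rewrite realCD !cabs_real.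
apply: ccontM; first exact: ccont_cst.
apply: (@ccont_sum R n _ _ _ (fun i w => (cabs ((Re (w 0 i))%:C : C))%:C + (cabs ((Im (w 0 i))%:C : C))%:C)) => i.
by apply: ccontD; apply: ccont_cabs; [apply: ccont_Re | apply: ccont_Im]; exact: ccont_coord.
Qed.
Lemma L2_expl1 c : L2 (expl1 c).
Proof.
split; first exact: ccont_expl1.
have := @int_exp_l1 R n (2 * c); rewrite /fock_norm2.
have -> // : (fun w : V => (expR (2 * c * l1 w) * gauss w)%:E) =
  (fun w : V => (cabs (expl1 c w) ^+ 2 * gauss w)%:E).
by apply/funext => w; rewrite cabs_expl1 -expRM_natl mulrA.
Qed.

(** An algebra of functions that contains the linear forms and the kernels and consists of square
    integrable functions; products P K_z stay inside it, whereas L^2 is not stable under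
    products. *)
Definition expbd f := ccont f /\ exists A c : R, [/\ 0 <= A, 0 <= c &
  forall w, cabs (f w) <= A * expR (c * l1 w)].

Lemma expbd_bound f A c : ccont f -> 0 <= A -> (forall w, cabs (f w) <= A * expR (c * l1 w)) ->
  L2 f /\ fock_norm f <= A * fock_norm (expl1 c).
Proof.
move=> cf A0 H; have LA := L2Z A%:C (L2_expl1 c).
have [|Lf nf] := fock_norm_le cf LA.
  by move=> w; rewrite cabsM cabs_real cabs_expl1 ger0_norm.
by split => //; apply: le_trans nf _; rewrite fock_normZ ?cabs_real ?ger0_norm //; exact: L2_expl1.
Qed.
Lemma expbd_L2 f : expbd f -> L2 f.
Proof. by move=> [cf [A [c [A0 c0 H]]]]; have [] := expbd_bound cf A0 H. Qed.
Lemma expbd_fock f : entire f -> expbd f -> in_fock f.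
Proof. by move=> ef /expbd_L2[_ nf]; split. Qed.
Lemma expbd_cst (c : C) : expbd (fun=> c).
Proof.
split; first exact: ccont_cst.
by exists (cabs c), 0; split => // [|w]; rewrite ?cabs_ge0 // mul0r expR0 mulr1.
Qed.
Lemma expbdM f g : expbd f -> expbd g -> expbd (fun w => f w * g w).
Proof.
move=> [cf [A [c [A0 c0 H]]]] [cg [B [d [B0 d0 K]]]]; split; first exact: ccontM.
exists (A * B), (c + d); split; rewrite ?mulr_ge0 ?addr_ge0 // => w.
by rewrite cabsM mulrDl expRD mulrACA; apply: ler_pM; rewrite ?cabs_ge0.
Qed.
Lemma expbdD f g : expbd f -> expbd g -> expbd (fun w => f w + g w).
Proof.
move=> [cf [A [c [A0 c0 H]]]] [cg [B [d [B0 d0 K]]]]; split; first exact: ccontD.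
exists (A + B), (c + d); split; rewrite ?addr_ge0 // => w.
apply: le_trans (cabsD _ _) _; rewrite mulrDl; have := l1_ge0 w => l0.
apply: lerD; [apply: le_trans (H w) _|apply: le_trans (K w) _]; rewrite ler_wpM2l // ler_expR ler_wpM2r //.
  by rewrite lerDl.
by rewrite lerDr.
Qed.
Lemma expbdX f k : expbd f -> expbd (fun w => f w ^+ k).
Proof.
move=> ef; elim: k => [|k IH]; first by under eq_fun do rewrite expr0; exact: expbd_cst.
by under eq_fun do rewrite exprS; exact: expbdM.
Qed.
Lemma expbd_dotc a : expbd (dotc a).
Proof.
split; first exact: ccont_dotc.
have s0 : 0 <= \sum_(i < n) cabs (a 0 i) by apply: sumr_ge0 => i _; exact: cabs_ge0.
exists (\sum_(i < n) cabs (a 0 i)), 1; split => // w.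
apply: le_trans (dotc_le_l1 _ _) _; rewrite ler_wpM2l // mul1r.
by have := expR_ge1Dx (l1 w); lra.
Qed.

(** The linear form x_a, conjugate linear in [a]. [ker z] is the unnormalized kernel K_z = exp x_z:
    without the factor e^(-pi|z|^2/2) it is antiholomorphic in z, and its derivative along q is
    simply x_q K_z. *)
Definition xdot a w : C := (pi : R)%:C * dotc a w.
Definition ker z w : C := cexp (xdot z w).
Definition xdot_cst a : R := pi * \sum_(i < n) cabs (a 0 i).
Lemma xdot_cst_ge0 a : 0 <= xdot_cst a.
Proof. by rewrite mulr_ge0 ?pi_ge0 //; apply: sumr_ge0 => i _; exact: cabs_ge0. Qed.
Lemma cabs_xdot a w : cabs (xdot a w) <= xdot_cst a * l1 w.
Proof.
rewrite cabsM cabs_real ger0_norm ?pi_ge0 // -mulrA ler_wpM2l ?pi_ge0 //; exact: dotc_le_l1.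
Qed.
Lemma expbd_xdot a : expbd (xdot a).
Proof. by apply: expbdM; [exact: expbd_cst | exact: expbd_dotc]. Qed.
Lemma entire_xdot a : entire (xdot a).
Proof. by apply: entireM; [exact: entire_cst | exact: entire_dotc]. Qed.
Lemma xdotDl z a w : xdot (z + a) w = xdot z w + xdot a w.
Proof. by rewrite /xdot dotcDl mulrDr. Qed.
Lemma xdotZl (c : C) a w : xdot (c *: a) w = c^* * xdot a w.
Proof. by rewrite /xdot dotcZl mulrCA. Qed.
Lemma kerD z a w : ker (z + a) w = ker z w * cexp (xdot a w).
Proof. by rewrite /ker xdotDl cexpD. Qed.
Lemma ker0 w : ker 0 w = 1.
Proof. by rewrite /ker /xdot dotc0l mulr0 cexp0. Qed.
Lemma expbd_ker z : expbd (ker z).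
Proof.
split; first by apply: ccont_cexp; have [] := expbd_xdot z.
exists 1, (xdot_cst z); split; rewrite ?xdot_cst_ge0 // => w.
by rewrite mul1r cabs_cexp ler_expR; apply: le_trans (Re_lec _) (cabs_xdot _ _).
Qed.
Lemma entire_ker z : entire (ker z).
Proof.
have := entire_cexp_dotc z (pi : R)%:C 0; congr entire.
by apply/funext => w; rewrite subr0.
Qed.
Lemma in_fock_ker z : in_fock (ker z).
Proof. by apply: expbd_fock; [exact: entire_ker | exact: expbd_ker]. Qed.
Lemma kzE z : kz z = fun w => (expR (- (pi / 2 * sqn z)))%:C * ker z w.
Proof.
apply/funext => w; rewrite /kz cexpD mulrC -realCN; congr (_ * _).
by apply: eqReIm; rewrite /cexp /= ?cos0 ?sin0 ?mulr1 ?mulr0.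
Qed.
Lemma kerE z : ker z = fun w => (expR (pi / 2 * sqn z))%:C * kz z w.
Proof. by rewrite kzE; apply/funext => w; rewrite mulrA -realCM -expRD subrr expR0 mul1r. Qed.
Lemma fock_inner_ker z f : in_fock f -> fock_inner f (ker z) = f z.
Proof.
move=> Ff; rewrite kerE fock_innerZr; [|exact: fockL2 (in_fock_kz z)|exact: fockL2].
by rewrite conj_real fock_inner_kz // mulrA -realCM -expRD subrr expR0 mul1r.
Qed.

(** The factor |h|^2 of the Taylor remainder is absorbed by 2 e^|h|, which leaves a pure
    exponential, uniform over |c| <= 1. *)
Lemma exp_taylor_dom (h c : C) : cabs c <= 1 ->
  cabs (cexp (c * h) - 1 - c * h) <= cabs c ^+ 2 * (4 * expR (2 * cabs h)).
Proof.
move=> c1; apply: le_trans (cexp_taylor1 _) _; rewrite cabsM exprMn.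
have h0 := cabs_ge0 h; have c0 := cabs_ge0 c.
have E : expR (cabs c * cabs h) <= expR (cabs h) by rewrite ler_expR ler_piMl.
have S : cabs h ^+ 2 <= 2 * expR (cabs h).
  have := @expR_ge1Dxn R (cabs h) 1 h0; rewrite (_ : (2`! = 2)%N) //; lra.
have E0 := expR_ge0 (cabs h).
have -> : expR (2 * cabs h) = expR (cabs h) * expR (cabs h) by rewrite -expRD mulr_natl.
rewrite [leLHS](_ : _ = cabs c ^+ 2 * (2 * (cabs h ^+ 2 * expR (cabs c * cabs h)))); last by ring.
rewrite ler_wpM2l ?exprn_ge0 //.
have : cabs h ^+ 2 * expR (cabs c * cabs h) <= 2 * expR (cabs h) * expR (cabs h).
  by apply: ler_pM; rewrite ?exprn_ge0 ?expR_ge0.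
lra.
Qed.

(** Differentiability of z |-> P K_z in norm, with quadratic remainder. The increment [c] enters
    conjugated since K_z is antiholomorphic in z. The remainder is P K_z times the Taylor remainder
    of exp at conj(c) x_q, dominated by an exponential of [l1]. *)
Lemma kernel_diff P z q : expbd P -> exists2 B : R, 0 <= B & forall c : C, cabs c <= 1 ->
  fock_norm (fun w => P w * ker (z + c *: q) w - P w * ker z w - c^* * (xdot q w * P w * ker z w))
    <= B * cabs c ^+ 2.
Proof.
move=> eP; have [cP [A [d [A0 d0 HP]]]] := expbdM eP (expbd_ker z).
exists (4 * A * fock_norm (expl1 (d + 2 * xdot_cst q))); first by rewrite !mulr_ge0 // fock_norm_ge0.
move=> c c1.
have -> : (fun w => P w * ker (z + c *: q) w - P w * ker z w - c^* * (xdot q w * P w * ker z w)) =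
  fun w => (P w * ker z w) * (cexp (c^* * xdot q w) - 1 - c^* * xdot q w).
  by apply/funext => w; rewrite kerD xdotZl; ring.
rewrite mulrAC; apply: (proj2 (expbd_bound _ _ _)).
- apply: ccontM => //; apply: ccontD; first apply: ccontD; last first.
  + under eq_fun do rewrite -mulNr; apply: ccontM; [exact: ccont_cst | by case: (expbd_xdot q)].
  + exact: ccont_cst.
  + by apply: ccont_cexp; apply: ccontM; [exact: ccont_cst | by case: (expbd_xdot q)].
- by rewrite !mulr_ge0 // cabs_ge0.
- move=> w; rewrite cabsM.
  have -> : 4 * A * cabs c ^+ 2 * expR ((d + 2 * xdot_cst q) * l1 w) =
     (A * expR (d * l1 w)) * (cabs c ^+ 2 * (4 * expR (2 * (xdot_cst q * l1 w)))).
    by rewrite (mulrDl d) expRD -(mulrA 2 (xdot_cst q)); ring.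
  apply: ler_pM; rewrite ?cabs_ge0 //.
  rewrite -(cabs_conj c); apply: le_trans (exp_taylor_dom _ _) _; first by rewrite cabs_conj.
  rewrite ler_wpM2l ?exprn_ge0 ?cabs_ge0 // ler_wpM2l // ler_expR ler_wpM2l //; exact: cabs_xdot.
Qed.

(** The kernels are norm differentiable in z, hence so is f(z) = <f, K_z>; the conjugation in the
    second slot undoes the one in [kernel_diff] and makes the derivative complex linear. In
    [fock_complete] this does the work of the theorem that locally uniform limits of holomorphic
    functions are holomorphic. *)
Lemma repro_entire f : L2 f -> (forall z, fock_inner f (ker z) = f z) -> entire f.
Proof.
move=> Lf H; apply/entireP; split; first by case: Lf.
move=> z i; have L1 := expbd_L2 (expbd_ker _).
have Lx : L2 (fun w => xdot (ec R i) w * 1 * ker z w).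
  apply: expbd_L2; apply: expbdM (expbd_ker z); apply: expbdM (expbd_cst _); exact: expbd_xdot.
exists (fock_inner f (fun w => xdot (ec R i) w * 1 * ker z w)) => e e0.
have [B B0 HB] := kernel_diff z (ec R i) (expbd_cst 1).
pose K := 2 * (fock_norm f * B) + 1; have K0 : 0 < K.
  by rewrite /K ltr_wpDl // !mulr_ge0 // fock_norm_ge0.
exists (Num.min 1 (e / K)); first by rewrite lt_min ltr01 divr_gt0.
move=> h; rewrite lt_min => /andP[h1 h2]; rewrite scale0r addr0 -(H z) -(H (z + _)).
have Lz := L1 z; have Lh := L1 (z + h *: ec R i); have Lc := L2Z h^* Lx.
rewrite -[h in h * _]conjCK -(fock_innerZr _ Lx Lf) -(fock_innerBr Lh Lz Lf) -(fock_innerBr (L2B Lh Lz) Lc Lf).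
apply: le_trans (fock_inner_le Lf (L2B (L2B Lh Lz) Lc)) _.
have := HB h (ltW h1).
under [X in fock_norm X <= _ -> _]eq_fun do rewrite !mul1r.
move=> Hh; have hh := cabs_ge0 h.
apply: (@le_trans _ _ (K * cabs h * cabs h)); last first.
  by rewrite ler_wpM2r // mulrC -ler_pdivlMr // ltW.
rewrite -(mulrA K) -expr2; apply: (@le_trans _ _ (2 * (fock_norm f * B) * cabs h ^+ 2)).
  by rewrite -(mulrA 2) ler_wpM2l // -mulrA ler_wpM2l ?fock_norm_ge0.
by rewrite ler_wpM2r ?exprn_ge0 // /K lerDl.
Qed.
End Kernels.

(** * Completeness of the Fock space and density of the kernels *)

Section Completeness.
Variables (R : realType) (n : nat).
Local Notation C := R[i].
Local Notation V := (Cn R n).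
Implicit Types (f g h P : V -> C) (z w q a : V).

Lemma real_cauchy (u : nat -> R) :
  (forall e, 0 < e -> exists N, forall m k, (N <= m)%N -> (N <= k)%N -> `|u m - u k| <= e) ->
  exists l, forall e, 0 < e -> exists N, forall k, (N <= k)%N -> `|u k - l| <= e.
Proof.
move=> H; have /cauchy_cvgP /cvg_ex[l ul] : cauchy (u @ \oo).
  apply/cauchy_exP => e e0; have [N HN] := H (e / 2) (divr_gt0 e0 (ltr0n _ 2)).
  exists (u N); exists N => // k /= Nk; rewrite /ball /=.
  by apply: le_lt_trans (HN _ _ (leqnn N) Nk) _; lra.
exists l => e e0; have /cvgrPdist_le /(_ e e0) [N _ HN] := ul.
by exists N => k Nk; rewrite distrC; exact: HN.
Qed.

Lemma cplx_cauchy (u : nat -> C) :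
  (forall e, 0 < e -> exists N, forall m k, (N <= m)%N -> (N <= k)%N -> cabs (u m - u k) <= e) ->
  exists l, forall e, 0 < e -> exists N, forall k, (N <= k)%N -> cabs (u k - l) <= e.
Proof.
move=> H.
have [|a Ha] := @real_cauchy (fun k => Re (u k)).
  move=> e /H[N HN]; exists N => m k Nm Nk; rewrite -ReN -ReD.
  exact: le_trans (Re_le_cabs _) (HN _ _ Nm Nk).
have [|b Hb] := @real_cauchy (fun k => Im (u k)).
  move=> e /H[N HN]; exists N => m k Nm Nk; rewrite -ImN -ImD.
  exact: le_trans (Im_le_cabs _) (HN _ _ Nm Nk).
exists (Complex a b) => e e0; have e2 : 0 < e / 2 by rewrite divr_gt0.
have [N1 H1] := Ha _ e2; have [N2 H2] := Hb _ e2.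
exists (maxn N1 N2) => k; rewrite geq_max => /andP[/H1 h1 /H2 h2].
apply: le_trans (cabs_le_ReIm _) _; rewrite !ReImE /=; lra.
Qed.

Lemma limit_unique (u : nat -> C) (l m : C) :
  (forall e, 0 < e -> exists N, forall k, (N <= k)%N -> cabs (u k - l) <= e) ->
  (forall e, 0 < e -> exists N, forall k, (N <= k)%N -> cabs (u k - m) <= e) -> l = m.
Proof.
move=> Hl Hm; apply/eqP; rewrite -subr_eq0; apply/negP => /negP /cabs_gt0 d0.
have e0 : 0 < cabs (l - m) / 3 by rewrite divr_gt0.
have [N1 H1] := Hl _ e0; have [N2 H2] := Hm _ e0.
have := H1 _ (leq_maxl N1 N2); have := H2 _ (leq_maxr N1 N2).
have := cabs_tri (u (maxn N1 N2)) l m; rewrite (cabsB l (u _)); lra.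
Qed.

Definition fock_cvg (F : nat -> V -> C) f := forall e : R, 0 < e ->
  exists N, forall k, (N <= k)%N -> fock_norm (fun w => F k w - f w) <= e.

(** Point evaluations are bounded locally uniformly, so a Cauchy sequence has a continuous pointwise
    limit. Fatou's lemma turns this into convergence in norm, the reproducing identity passes to the
    limit, and [repro_entire] makes the limit entire. *)
Lemma fock_complete (F : nat -> V -> C) : (forall k, in_fock (F k)) ->
  (forall e : R, 0 < e -> exists N, forall m k, (N <= m)%N -> (N <= k)%N ->
     fock_norm (fun w => F m w - F k w) <= e) ->
  exists2 f, in_fock f & fock_cvg F f.
Proof.
move=> FF HC.
pose E w : R := 2 * expR (pi / 2 * sqn w).
have E0 w : 0 < E w by rewrite mulr_gt0 // expR_gt0.
have pt m k w : cabs (F m w - F k w) <= E w * fock_norm (fun w => F m w - F k w).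
  by apply: (@fock_point_le _ _ w (fun w => F m w - F k w)); exact: in_fockB.
have Hw w : exists l, forall e, 0 < e -> exists N, forall k, (N <= k)%N -> cabs (F k w - l) <= e.
  apply: cplx_cauchy => e e0; have [N HN] := HC (e / E w) (divr_gt0 e0 (E0 w)).
  exists N => m k Nm Nk; apply: le_trans (pt _ _ _) _.
  by rewrite mulrC -ler_pdivlMr // HN.
pose f w := sval (cid (Hw w)).
have Hf w : forall e, 0 < e -> exists N, forall k, (N <= k)%N -> cabs (F k w - f w) <= e.
  by rewrite /f; case: (cid _).
have unif e : 0 < e -> exists N, forall k w, (N <= k)%N -> cabs (F k w - f w) <= E w * e.
  move=> e0; have [N HN] := HC e e0; exists N => k w Nk.
  apply/ler_addgt0Pr => d d0; have [N2 H2] := Hf w d d0.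
  have := H2 _ (leq_maxr N N2); have := pt k (maxn N N2) w.
  have := HN _ _ Nk (leq_maxl N N2) => h1 h2 h3.
  apply: le_trans (cabs_tri (F (maxn N N2) w) _ _) _; apply: lerD h3.
  by apply: le_trans h2 _; rewrite ler_wpM2l // ltW.
have cf : ccont f.
  move=> z e e0.
  pose K := 2 * expR (pi / 2 * (2 * 1 + 2 * sqn z)) : R.
  have K0 : 0 < K by rewrite mulr_gt0 // expR_gt0.
  have EK w : sqn (w - z) < 1 -> E w <= K.
    move=> wz; rewrite ler_wpM2l // ler_expR ler_wpM2l ?divr_ge0 ?pi_ge0 //.
    have := sqnD_le (w - z) z; rewrite subrK; lra.
  have [N HN] := unif (e / (4 * K)) (divr_gt0 e0 (mulr_gt0 (ltr0n _ 4) K0)).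
  have [[cN _] _] := FF N.
  have [d d0 Hd] := cN z (e / 4) (divr_gt0 e0 (ltr0n _ 4)).
  exists (Num.min 1 d); first by rewrite lt_min ltr01.
  move=> w; rewrite lt_min => /andP[w1 /Hd w2].
  have H w' : sqn (w' - z) < 1 -> cabs (F N w' - f w') <= e / 4.
    move=> wz; apply: le_trans (HN N w' (leqnn _)) _.
    rewrite invfM [e * _]mulrA mulrA ler_pdivrMr // mulrC ler_wpM2l ?EK // divr_ge0 // ltW //.
  have h1 := H _ w1; have h2 := H z; rewrite subrr sqn0 ltr01 in h2; have {}h2 := h2 isT.
  have := cabs_tri (F N w) (f w) (f z); have := cabs_tri (F N z) (F N w) (f z).
  rewrite (cabsB (f w) (F N w)); lra.
have cvf w (e : R) : 0 < e -> exists N, forall k, (N <= k)%N -> cabs (F k w - f w) < e.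
  move=> e0; have [N HN] := Hf w (e / 2) (divr_gt0 e0 (ltr0n _ 2)).
  by exists N => k /HN h; apply: le_lt_trans h _; lra.
have conv e : 0 < e -> exists N, forall k, (N <= k)%N -> L2 (fun w => F k w - f w) /\
    fock_norm (fun w => F k w - f w) <= e.
  move=> e0; have [N HN] := HC e e0; exists N => k Nk.
  have cFf : ccont (fun w => F k w - f w).
    have [[ck _] _] := FF k; apply: ccontD => //.
    by under eq_fun do rewrite -mulN1r; apply: ccontM => //; exact: ccont_cst.
  apply: (@fock_norm_fatou _ _ (fun m w => F k w - F (N + m)%N w)) => //.
  - by move=> m; apply: L2B; exact: fockL2.
  - exact: ltW.
  - move=> w d d0; have [N2 H2] := cvf w d d0; exists N2 => m Nm.
    rewrite opprB addrC addrA subrK cabsB cabsB -cabsB; apply: H2.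
    exact: leq_trans Nm (leq_addl _ _).
  - by move=> m; apply: HN => //; rewrite leq_addr.
have [N HN] := conv 1 ltr01.
have Lf : L2 f.
  have [L1 _] := HN N (leqnn _); have := L2B (fockL2 (FF N)) L1; congr L2.
  by apply/funext => w; rewrite opprB addrC subrK.
exists f; last first.
  by move=> e /conv[N' HN']; exists N' => k /HN'[].
split; last by case: Lf.
apply: repro_entire => // z.
have Lk := fockL2 (in_fock_ker z).
apply: (limit_unique (u := fun k => F k z)); last exact: Hf.
move=> e e0; pose K := 2 * fock_norm (ker z) + 1; have K0 : 0 < K.
  by rewrite /K ltr_wpDl // mulr_ge0 // fock_norm_ge0.
have [N' HN'] := conv (e / K) (divr_gt0 e0 K0); exists N' => k /HN'[L1 h].
rewrite -(fock_inner_ker z (FF k)) -fock_innerBl //; last exact: fockL2.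
apply: le_trans (fock_inner_le L1 Lk) _.
apply: (@le_trans _ _ (fock_norm (fun w => F k w - f w) * K)); last by rewrite -ler_pdivlMr.
by rewrite /K mulrDr mulr1 [2 * _]mulrCA lerDl fock_norm_ge0.
Qed.

Lemma fock_norm0_eq f : in_fock f -> fock_norm f = 0 -> f = fun=> 0.
Proof.
move=> Ff f0; apply/funext => w; apply: cabs_eq0; apply/eqP; rewrite eq_le cabs_ge0 andbT.
by have := fock_point_le w Ff; rewrite f0 mulr0.
Qed.

Lemma parallelogram f g : L2 f -> L2 g ->
  rip (fun w => f w - g w) (fun w => f w - g w) =
  2 * rip f f + 2 * rip g g - 4 * rip (fun w => (2^-1 : R)%:C * (f w + g w)) (fun w => (2^-1 : R)%:C * (f w + g w)).
Proof.
move=> Lf Lg; have LD := L2D Lf Lg; have LB := L2B Lf Lg.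
rewrite rip_ZZ // cabs_real ger0_norm ?invr_ge0 //.
rewrite (ripBl Lf Lg LB) (ripBr Lf Lg Lf) (ripBr Lf Lg Lg) (ripDl Lf Lg LD) (ripDr Lf Lg Lf) (ripDr Lf Lg Lg) (ripC g f); by field.
Qed.

(** Orthogonal projection onto the closure of [D]: by the parallelogram law a minimizing sequence is
    Cauchy, the residual [r0] in the limit is orthogonal to [D], in particular to all kernels, and
    so vanishes at every point by the reproducing property. *)
Lemma fock_dense (D : (V -> C) -> Prop) : (forall f, D f -> in_fock f) ->
  (forall (c : C) f g, D f -> D g -> D (fun w => c * f w + g w)) -> (forall z, D (kz z)) ->
  forall f, in_fock f -> forall e : R, 0 < e -> exists2 g, D g & fock_norm (fun w => f w - g w) <= e.
Proof.
move=> DF DZD Dk f Ff e e0.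
pose S := [set x : R | exists2 g, D g & x = rip (fun w => f w - g w) (fun w => f w - g w)].
have S0 : has_inf S.
  split; first by eexists; exists (kz 0) => //; exact: Dk.
  by exists 0 => _ [g _ ->]; exact: rip_ge0.
pose d := inf S.
have Sd g : D g -> d <= rip (fun w => f w - g w) (fun w => f w - g w).
  by move=> Dg; apply: ge_inf; [case: S0 | exists g].
have Hk (k : nat) : exists g, D g /\ rip (fun w => f w - g w) (fun w => f w - g w) < d + k.+1%:R^-1.
  have k0 : 0 < (k.+1%:R : R)^-1 by rewrite invr_gt0.
  by have [_ [g Dg ->] H] := inf_adherent k0 S0; exists g.
have [G HG] := choice Hk.
pose r k w := f w - G k w.
have Fr k : in_fock (r k) by apply: in_fockB => //; apply: DF; case: (HG k).
have rd k : rip (r k) (r k) < d + k.+1%:R^-1 by case: (HG k).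
have inv_small (e1 : R) : 0 < e1 -> exists N, forall k, (N <= k)%N -> (k.+1%:R : R)^-1 <= e1.
  move=> e10; exists (Num.trunc e1^-1) => k Nk.
  rewrite -[leRHS]invrK lef_pV2 ?posrE ?invr_gt0 ?ltr0n //.
  have /andP[_ /ltW h] := truncn_itv (ltW (eq_ind_r (fun b => is_true b) e10 (invr_gt0 e1))).
  by apply: le_trans h _; rewrite ler_nat.
have Dlin k (c : C) g : D g -> D (fun w => G k w + c * g w).
  move=> Dg; have := DZD c g (G k) Dg (proj1 (HG k)); congr D.
  by apply/funext => w; rewrite addrC.
have [|r0 Fr0 cvr] := fock_complete Fr.
  move=> e1 e10; have [N HN] := inv_small (e1 ^+ 2 / 4) (divr_gt0 (exprn_gt0 2 e10) (ltr0n _ 4)).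
  exists N => m k /HN hm /HN hk.
  have Lm := fockL2 (Fr m); have Lk := fockL2 (Fr k); have [cB _] := L2B Lm Lk.
  rewrite -(@ler_pXn2r _ 2) ?nnegrE ?fock_norm_ge0 ?(ltW e10) // fock_norm_sq // parallelogram //.
  have Dh : D (fun w => (2^-1 : R)%:C * G m w + (2^-1 : R)%:C * G k w).
    apply: (DZD (2^-1 : R)%:C _ _ (proj1 (HG m))) .
    (* Stability of [D] is given only for c f + g, so a multiple c g is obtained as (c - 1) g +
       g. *)
    have := DZD ((2^-1 : R)%:C - 1) (G k) (G k) (proj1 (HG k)) (proj1 (HG k)); congr D.
    by apply/funext => w; rewrite mulrBl mul1r subrK.
  have := Sd _ Dh; have := rd m; have := rd k.
  have -> : (fun w => f w - ((2^-1 : R)%:C * G m w + (2^-1 : R)%:C * G k w)) =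
    (fun w => (2^-1 : R)%:C * (r m w + r k w)).
    apply/funext => w; rewrite /r.
    have E : f w = (2^-1 : R)%:C * f w + (2^-1 : R)%:C * f w.
      rewrite -mulrDl -realCD (_ : 2^-1 + 2^-1 = 1 :> R) ?mul1r //; by field.
    by rewrite {1}E; ring.
  move: hm hk; move: (m.+1%:R^-1) (k.+1%:R^-1) (e1 ^+ 2) (rip _ _) (rip _ _) (rip _ _) => a b s x y v h1 h2 h3 h4 h5; clearbody d; clear -h1 h2 h3 h4 h5; lra.
suff r00 : fock_norm r0 = 0.
  have [N HN] := cvr e e0; exists (G N); first by case: (HG N).
  apply: le_trans (HN N (leqnn _)); rewrite (fock_norm0_eq Fr0 r00).
  by under [X in _ <= fock_norm X]eq_fun do rewrite subr0.
have key g : D g -> rip r0 g = 0.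
  move=> Dg; have Lg := fockL2 (DF _ Dg); have L0 := fockL2 Fr0.
  (* [G k] plus [t] times [g] competes for the infimum, and [G k] is within 1/(k+1) of attaining
     it. *)
  have bnd k (t : R) : 2 * t * rip (r k) g <= t ^+ 2 * rip g g + k.+1%:R^-1.
    have Lk := fockL2 (Fr k); have Lt := L2Z t%:C Lg.
    have := Sd _ (Dlin k t%:C g Dg); have := rd k.
    have -> : (fun w => f w - (G k w + t%:C * g w)) = (fun w => r k w - t%:C * g w).
      by apply/funext => w; rewrite /r opprD addrA.
    rewrite (ripBl Lk Lt (L2B Lk Lt)) (ripBr Lk Lt Lk) (ripBr Lk Lt Lt).
    rewrite !(ripZl _ Lg Lk) !(ripZl _ Lg Lt) !(ripZr _ Lg Lk) !(ripZr _ Lg Lg) (ripC g (r k)).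
    move: (rip (r k) g) (rip (r k) (r k)) (rip g g) (k.+1%:R^-1) => x y v b; clearbody d; clear; lra.
  have gg := rip_ge0 g.
  have small (e1 : R) : 0 < e1 -> exists2 k, (k.+1%:R : R)^-1 <= e1 & `|rip (r k) g - rip r0 g| <= e1.
    move=> e10; pose K := fock_norm g + 1; have K0 : 0 < K by rewrite ltr_wpDl // fock_norm_ge0.
    have [N1 H1] := inv_small _ e10; have [N2 H2] := cvr (e1 / K) (divr_gt0 e10 K0).
    exists (maxn N1 N2); first by apply: H1; exact: leq_maxl.
    have Lk := fockL2 (Fr (maxn N1 N2)).
    rewrite -ripBl //; apply: le_trans (rip_CS (L2B Lk L0) Lg) _.
    apply: (@le_trans _ _ (e1 / K * K)); last by rewrite divfK // gt_eqF.
    by apply: ler_pM; rewrite ?fock_norm_ge0 ?H2 ?leq_maxr // /K lerDl.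
  have all t : 2 * t * rip r0 g <= t ^+ 2 * rip g g.
    apply/ler_addgt0Pr => e1 e10.
    have K0 : 0 < 2 * `|t| + 1 by rewrite ltr_wpDl // mulr_ge0.
    have [k k1 k2] := small (e1 / (2 * `|t| + 1)) (divr_gt0 e10 K0).
    have := bnd k t; have : 2 * t * rip r0 g - 2 * t * rip (r k) g <= 2 * `|t| * (e1 / (2 * `|t| + 1)).
      rewrite -mulrBr; apply: le_trans (ler_norm _) _; rewrite !normrM (@ger0_norm _ 2) // distrC.
      by rewrite ler_wpM2l // mulr_ge0.
    have : e1 = (2 * `|t| + 1) * (e1 / (2 * `|t| + 1)) by rewrite mulrC divfK // gt_eqF.
    move: k1 (rip (r k) g) (rip r0 g) (rip g g); move: (k.+1%:R^-1) (e1 / _) => b c; clear; move=> h x y v h1 h2 h3; nra.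
  apply/eqP; apply/negP => /negP n0.
  have g1 : 0 < rip g g + 1 by lra.
  (* For this [t] the inequality becomes 2 (v + 1) <= v with v = [rip g g], up to a positive factor;
     the added 1 keeps the denominator positive. *)
  have := all (rip r0 g / (rip g g + 1)).
  have -> : 2 * (rip r0 g / (rip g g + 1)) * rip r0 g = (rip r0 g) ^+ 2 / (rip g g + 1) ^+ 2 * (2 * (rip g g + 1)).
    by field; rewrite gt_eqF.
  rewrite expr_div_n ler_pM2l; first lra.
  by rewrite divr_gt0 ?(exprn_gt0 2 g1) // lt_def sqr_ge0 sqrf_eq0 n0.
have keyC z : r0 z = 0.
  have [h1 h2] := rip_kz z Fr0.
  have Di : D (fun w => 'i * kz z w).
    have := DZD ('i - 1) (kz z) (kz z) (Dk z) (Dk z); congr D.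
    by apply/funext => w; rewrite mulrBl mul1r subrK.
  move: h1 h2; rewrite !key // => /esym/eqP; rewrite mulf_eq0 gt_eqF ?expR_gt0 //= => /eqP h1.
  move/esym/eqP; rewrite mulf_eq0 gt_eqF ?expR_gt0 //= => /eqP h2.
  exact: eqReIm.
have -> : r0 = fun=> 0 by apply/funext.
exact: fock_norm0.
Qed.
End Completeness.

(** * Matrix coefficients as limits of Berezin values *)

Section BerezinSpan.
Variables (R : realType) (n : nat).
Local Notation C := R[i].
Local Notation V := (Cn R n).
Local Notation op := (op R n).
Implicit Types (f g u v P Q : V -> C) (z w q a b : V) (A : op) (Phi Psi : op -> C).

Definition opbd A (M : R) := [/\ (forall f, in_fock f -> in_fock (A f)),
  (forall (c : C) f g, in_fock f -> in_fock g ->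
     A (fun w => c * f w + g w) = (fun w => c * A f w + A g w)), 0 <= M &
  forall f, in_fock f -> fock_norm (A f) <= M * fock_norm f].

(* The bound is uniform over norm balls of operators, so it applies to [A] and to all its translates at once. *)
Definition appr Phi := forall e : R, 0 < e -> exists s : seq (C * V), forall A M, opbd A M ->
  cabs (Phi A - \sum_(p <- s) p.1 * berezin A p.2) <= e * M.

Lemma appr_berezin z : appr (fun A => berezin A z).
Proof.
move=> e e0; exists [:: (1, z)] => A M [_ _ M0 _].
by rewrite big_seq1 mul1r subrr cabs0 mulr_ge0 // ltW.
Qed.

Lemma apprZ (c : C) Phi : appr Phi -> appr (fun A => c * Phi A).
Proof.
move=> h1 e e0; have c0 : 0 < cabs c + 1 by rewrite ltr_wpDl // cabs_ge0.
have [s Hs] := h1 (e / (cabs c + 1)) (divr_gt0 e0 c0).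
exists [seq (c * p.1, p.2) | p <- s] => A M bA; have [_ _ M0 _] := bA.
rewrite big_map /=; under eq_bigr do rewrite -mulrA.
rewrite -mulr_sumr -mulrBr cabsM; apply: le_trans (ler_wpM2l (cabs_ge0 _) (Hs A M bA)) _.
rewrite mulrA ler_wpM2r // mulrCA ler_piMr ?(ltW e0) // ler_pdivrMr // mul1r lerDl //.
Qed.
Lemma apprD Phi Psi : appr Phi -> appr Psi -> appr (fun A => Phi A + Psi A).
Proof.
move=> h1 h2 e e0; have e2 : 0 < e / 2 by rewrite divr_gt0.
have [s Hs] := h1 _ e2; have [t Ht] := h2 _ e2.
exists (s ++ t) => A M bA; rewrite big_cat /= opprD addrACA.
by apply: le_trans (cabsD _ _) _; have := Hs A M bA; have := Ht A M bA; lra.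
Qed.
Lemma eq_appr Phi Psi : (forall A M, opbd A M -> Phi A = Psi A) -> appr Phi -> appr Psi.
Proof.
by move=> E h e /h[s Hs]; exists s => A M bA; rewrite -(E A M bA); exact: Hs.
Qed.
Lemma appr_lim Phi : (forall e : R, 0 < e -> exists2 Psi, appr Psi &
   forall A M, opbd A M -> cabs (Phi A - Psi A) <= e * M) -> appr Phi.
Proof.
move=> H e e0; have e2 : 0 < e / 2 by rewrite divr_gt0.
have [Psi aP HP] := H _ e2; have [s Hs] := aP _ e2; exists s => A M bA.
apply: le_trans (cabs_tri (Psi A) _ _) _; have := HP A M bA; have := Hs A M bA; lra.
Qed.

Lemma opbd_fock A M f : opbd A M -> in_fock f -> in_fock (A f).
Proof. by case=> H _ _ _; exact: H. Qed.
Lemma opbd_comb A M (c : C) f g : opbd A M -> in_fock f -> in_fock g ->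
  A (fun w => c * f w + g w) = (fun w => c * A f w + A g w).
Proof. by case=> _ H _ _; exact: H. Qed.
Lemma opbd_le A M f : opbd A M -> in_fock f -> fock_norm (A f) <= M * fock_norm f.
Proof. by case=> _ _ _; exact. Qed.
Lemma opbd0 A M : opbd A M -> A (fun=> 0) = fun=> 0.
Proof.
move=> bA; have F0 := @in_fock0 R n; have := opbd_comb (-1) bA F0 F0.
under [X in A X]eq_fun do rewrite mulr0 addr0.
by move=> ->; apply/funext => w; rewrite mulN1r addNr.
Qed.
Lemma opbdZ A M (c : C) f : opbd A M -> in_fock f -> A (fun w => c * f w) = (fun w => c * A f w).
Proof.
move=> bA Ff; have := opbd_comb c bA Ff (@in_fock0 R n); rewrite (opbd0 bA).
by under [X in A X]eq_fun do rewrite addr0; under [X in _ = X]eq_fun do rewrite addr0.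
Qed.
Lemma opbdD A M f g : opbd A M -> in_fock f -> in_fock g ->
  A (fun w => f w + g w) = (fun w => A f w + A g w).
Proof.
move=> bA Ff Fg; have := opbd_comb 1 bA Ff Fg.
by under [X in A X]eq_fun do rewrite mul1r; under [X in _ = X]eq_fun do rewrite mul1r.
Qed.
Lemma opbdB A M f g : opbd A M -> in_fock f -> in_fock g ->
  A (fun w => f w - g w) = (fun w => A f w - A g w).
Proof.
move=> bA Ff Fg; have := opbd_comb (-1) bA Fg Ff.
have -> : (fun w => -1 * g w + f w) = fun w => f w - g w by apply/funext => w; rewrite mulN1r addrC.
by move=> ->; apply/funext => w; rewrite mulN1r addrC.
Qed.
Lemma opbd_inner A M f g : opbd A M -> in_fock f -> in_fock g ->
  cabs (fock_inner (A f) g) <= 2 * (fock_norm f * fock_norm g) * M.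
Proof.
move=> bA Ff Fg; apply: le_trans (fock_inner_le (fockL2 (opbd_fock bA Ff)) (fockL2 Fg)) _.
rewrite -[leRHS]mulrA ler_wpM2l // mulrAC ler_wpM2r ?fock_norm_ge0 // mulrC; exact: opbd_le.
Qed.

Definition mel f g A := fock_inner (A f) g.

Lemma appr_mel_combl (c : C) f f' g : in_fock f -> in_fock f' -> in_fock g ->
  appr (mel f g) -> appr (mel f' g) -> appr (mel (fun w => c * f w + f' w) g).
Proof.
move=> Ff Ff' Fg /(apprZ c) h h'; apply: eq_appr (apprD h h') => A M bA.
have Af := fockL2 (opbd_fock bA Ff); have Af' := fockL2 (opbd_fock bA Ff'); have Lg := fockL2 Fg.
by rewrite /mel (opbd_comb _ bA) // fock_innerDl ?fock_innerZl //; exact: L2Z.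
Qed.
Lemma appr_mel_combr (c : C) f f' g : in_fock f -> in_fock f' -> in_fock g ->
  appr (mel g f) -> appr (mel g f') -> appr (mel g (fun w => c * f w + f' w)).
Proof.
move=> Ff Ff' Fg /(apprZ c^*) h h'; apply: eq_appr (apprD h h') => A M bA.
have Ag := fockL2 (opbd_fock bA Fg); have Lf := fockL2 Ff; have Lf' := fockL2 Ff'.
by rewrite /mel fock_innerDr ?fock_innerZr //; exact: L2Z.
Qed.
Lemma appr_mel_liml f g : in_fock f -> in_fock g -> (forall e : R, 0 < e -> exists f',
  [/\ in_fock f', appr (mel f' g) & fock_norm (fun w => f w - f' w) <= e]) -> appr (mel f g).
Proof.
move=> Ff Fg H; apply: appr_lim => e e0; pose K := 2 * fock_norm g + 1.
have g0 := fock_norm_ge0 g; have K0 : 0 < K by rewrite /K ltr_wpDl // mulr_ge0.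
have [f' [Ff' af' h]] := H (e / K) (divr_gt0 e0 K0); exists (mel f' g) => // A M bA.
have M0 : 0 <= M by case: bA.
have Af := fockL2 (opbd_fock bA Ff); have Af' := fockL2 (opbd_fock bA Ff'); have Lg := fockL2 Fg.
rewrite /mel -fock_innerBl // -(opbdB bA) //.
apply: le_trans (opbd_inner bA (in_fockB Ff Ff') Fg) _; rewrite ler_wpM2r //.
apply: (@le_trans _ _ (e / K * K)); last by rewrite divfK // gt_eqF.
rewrite mulrCA; apply: ler_pM => //; rewrite ?fock_norm_ge0 ?mulr_ge0 //.
by rewrite /K lerDl.
Qed.
Lemma appr_mel_limr f g : in_fock f -> in_fock g -> (forall e : R, 0 < e -> exists g',
  [/\ in_fock g', appr (mel f g') & fock_norm (fun w => g w - g' w) <= e]) -> appr (mel f g).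
Proof.
move=> Ff Fg H; apply: appr_lim => e e0; pose K := 2 * fock_norm f + 1.
have g0 := fock_norm_ge0 f; have K0 : 0 < K by rewrite /K ltr_wpDl // mulr_ge0.
have [g' [Fg' ag' h]] := H (e / K) (divr_gt0 e0 K0); exists (mel f g') => // A M bA.
have M0 : 0 <= M by case: bA.
have Af := fockL2 (opbd_fock bA Ff); have Lg' := fockL2 Fg'; have Lg := fockL2 Fg.
rewrite /mel -fock_innerBr //.
apply: le_trans (opbd_inner bA Ff (in_fockB Fg Fg')) _; rewrite ler_wpM2r //.
apply: (@le_trans _ _ (K * (e / K))); last by rewrite mulrC divfK // gt_eqF.
rewrite mulrA; apply: ler_pM => //; rewrite ?fock_norm_ge0 ?mulr_ge0 //.
by rewrite /K lerDl.
Qed.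

(** Approximability of <A P K_z, Q K_z> is required at all [z] simultaneously, because the induction
    on [P] and [Q] differentiates in [z]. *)
Definition gen P Q := [/\ entire P, expbd P, entire Q, expbd Q &
  forall z, appr (mel (fun w => P w * ker z w) (fun w => Q w * ker z w))].

Lemma in_fock_expker P z : entire P -> expbd P -> in_fock (fun w => P w * ker z w).
Proof.
move=> eP bP; apply: expbd_fock; first by apply: entireM => //; exact: entire_ker.
by apply: expbdM => //; exact: expbd_ker.
Qed.

Lemma gen1 : gen (fun=> 1) (fun=> 1).
Proof.
split; try exact: entire_cst; try exact: expbd_cst; move=> z.
apply: eq_appr (apprZ ((expR (pi / 2 * sqn z))%:C * (expR (pi / 2 * sqn z))%:C) (appr_berezin z)) => A M bA.
rewrite /mel /berezin; have -> : (fun w => 1 * ker z w) = ker z by apply/funext => w; rewrite mul1r.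
have Fk := in_fock_kz z; have Lk := fockL2 Fk; have LA := fockL2 (opbd_fock bA Fk).
rewrite kerE (opbdZ _ bA) //.
rewrite fock_innerZl //; last exact: L2Z.
by rewrite fock_innerZr // conj_real mulrA.
Qed.

(* the derivative of [<A(P K_z), Q K_z>] in the real direction [q] *)
Lemma gen_diff P Q z q : gen P Q ->
  appr (fun A => mel (fun w => xdot q w * P w * ker z w) (fun w => Q w * ker z w) A +
                 mel (fun w => P w * ker z w) (fun w => xdot q w * Q w * ker z w) A).
Proof.
move=> [eP bP eQ bQ aPQ].
have [B B0 HB] := kernel_diff z q bP; have [D D0 HD] := kernel_diff z q bQ.
pose u0 w := P w * ker z w; pose v0 w := Q w * ker z w.
pose u1 w := xdot q w * P w * ker z w; pose v1 w := xdot q w * Q w * ker z w.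
have Fu0 : in_fock u0 by exact: in_fock_expker.
have Fv0 : in_fock v0 by exact: in_fock_expker.
have Fu1 : in_fock u1.
  by apply: in_fock_expker; [apply: entireM => //; exact: entire_xdot | apply: expbdM => //; exact: expbd_xdot].
have Fv1 : in_fock v1.
  by apply: in_fock_expker; [apply: entireM => //; exact: entire_xdot | apply: expbdM => //; exact: expbd_xdot].
have n0 := @fock_norm_ge0 R n.
pose K := 2 * (B * (D + (fock_norm v0 + fock_norm v1)) + (fock_norm u0 + fock_norm u1) * D + fock_norm u1 * fock_norm v1).
have K0 : 0 <= K by rewrite !(mulr_ge0, addr_ge0).
have K1 : 0 < K + 1 by rewrite ltr_wpDl.
apply: appr_lim => e e0.
pose t := Num.min 1 (e / (K + 1)).
have t0 : 0 < t by rewrite lt_min ltr01 divr_gt0.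
have t1 : t <= 1 by rewrite ge_min lexx.
have tn : t != 0 by rewrite gt_eqF.
have tK : t * K <= e.
  apply: (@le_trans _ _ (t * (K + 1))); first by rewrite ler_wpM2l ?(ltW t0) // lerDl.
  by rewrite -ler_pdivlMr // ge_min lexx orbT.
pose ut w := P w * ker (z + t%:C *: q) w; pose vt w := Q w * ker (z + t%:C *: q) w.
have Fut : in_fock ut by exact: in_fock_expker.
have Fvt : in_fock vt by exact: in_fock_expker.
exists (fun A => (t^-1)%:C * (mel ut vt A + (-1) * mel u0 v0 A)).
  by apply: apprZ; apply: apprD; [exact: aPQ | apply: apprZ; exact: aPQ].
move=> A M bA; have M0 : 0 <= M by case: bA.
pose ru w := ut w - u0 w - t%:C * u1 w; pose rv w := vt w - v0 w - t%:C * v1 w.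
have Ftu := in_fockZ t%:C Fu1; have Ftv := in_fockZ t%:C Fv1.
have Fru : in_fock ru by do 2!apply: in_fockB => //.
have Frv : in_fock rv by do 2!apply: in_fockB => //.
have ct : cabs (t%:C : C) = t by rewrite cabs_real ger0_norm // ltW.
have nru : fock_norm ru <= B * t ^+ 2.
  by have := HB t%:C; rewrite ct conj_real; exact.
have nrv : fock_norm rv <= D * t ^+ 2.
  by have := HD t%:C; rewrite ct conj_real; exact.
have nvt : fock_norm vt <= D + (fock_norm v0 + fock_norm v1).
  have -> : vt = fun w => rv w + (v0 w + t%:C * v1 w).
    by apply/funext => w; rewrite /rv; ring.
  have Ls := L2D (fockL2 Fv0) (fockL2 Ftv).
  apply: le_trans (fock_normD (fockL2 Frv) Ls) _; apply: lerD.
    by apply: le_trans nrv _; rewrite ler_piMr // exprn_ile1 // ltW.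
  apply: le_trans (fock_normD (fockL2 Fv0) (fockL2 Ftv)) _; rewrite lerD2l.
  by rewrite fock_normZ ?ct; [rewrite ler_piMl | exact: fockL2].
pose su w := u0 w + t%:C * u1 w.
have Fsu : in_fock su by exact: in_fockD.
have nsu : fock_norm su <= fock_norm u0 + fock_norm u1.
  apply: le_trans (fock_normD (fockL2 Fu0) (fockL2 Ftu)) _; rewrite lerD2l.
  by rewrite fock_normZ ?ct; [rewrite ler_piMl | exact: fockL2].
have L f : in_fock f -> L2 (A f) by move=> /(opbd_fock bA)/fockL2.
(* Insert ut = su + ru and vt = v0 + t v1 + rv with su = u0 + t u1. The terms of order 0 and 1 in t
   cancel; the three that remain are of order t^2, and [K] adds up their bounds. *)
have E : mel u1 v0 A + mel u0 v1 A - (t^-1)%:C * (mel ut vt A + (-1) * mel u0 v0 A) =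
  - ((t^-1)%:C * (fock_inner (A ru) vt + fock_inner (A su) rv + (t * t)%:C * fock_inner (A u1) v1)).
  have -> : A ru = fun w => A ut w - A u0 w - t%:C * A u1 w.
    rewrite (@opbdB A M (fun w => ut w - u0 w) (fun w => t%:C * u1 w)) //; last exact: in_fockB.
    by rewrite (opbdB bA) // (opbdZ _ bA).
  have -> : A su = fun w => A u0 w + t%:C * A u1 w.
    by rewrite (opbdD bA) // (opbdZ _ bA).
  have Lvt := fockL2 Fvt; have Lv0 := fockL2 Fv0; have Lv1 := fockL2 Fv1.
  have LtA := L2Z t%:C (L _ Fu1); have Ltv := fockL2 Ftv.
  have LB := L2B (L _ Fut) (L _ Fu0); have LD := L2D (L _ Fu0) LtA.
  rewrite (fock_innerBl LB LtA Lvt) (fock_innerBl (L _ Fut) (L _ Fu0) Lvt).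
  rewrite (fock_innerZl _ (L _ Fu1) Lvt).
  rewrite (fock_innerDl (L _ Fu0) LtA (fockL2 Frv)) (fock_innerZl _ (L _ Fu1) (fockL2 Frv)).
  have inr h : L2 h -> fock_inner h rv = fock_inner h vt - fock_inner h v0 - t%:C * fock_inner h v1.
    move=> Lh; rewrite (fock_innerBr (L2B Lvt Lv0) Ltv Lh) (fock_innerBr Lvt Lv0 Lh).
    by rewrite (fock_innerZr _ Lv1 Lh) conj_real.
  rewrite !inr ?/mel //; try exact: L.
  have tC : (t^-1)%:C * t%:C = 1 :> C by rewrite -realCM mulVf.
  rewrite realCM.
  move: (fock_inner _ _) (fock_inner _ _) (fock_inner _ _) (fock_inner _ _) (fock_inner _ _)
     (fock_inner _ _) (fock_inner _ _) (t%:C) ((t^-1)%:C) tC => x1 x2 x3 x4 x5 x6 x7 s r rs.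
  have -> : r = s^-1.
    have s0 : s != 0 by apply: contra_eq_neq rs => ->; rewrite mulr0 eq_sym oner_eq0.
    by rewrite -[r](mulfK s0) rs mul1r.
  have s0 : s != 0 by apply: contra_eq_neq rs => ->; rewrite mulr0 eq_sym oner_eq0.
  by field.
rewrite E cabsN cabsM cabs_real ger0_norm ?invr_ge0 ?(ltW t0) // mulrC ler_pdivrMr //.
apply: le_trans (cabsD _ _) _; apply: le_trans (lerD (cabsD _ _) (lexx _)) _.
have b1 := opbd_inner bA Fru Fvt; have b2 := opbd_inner bA Fsu Frv; have b3 := opbd_inner bA Fu1 Fv1.
rewrite cabsM cabs_real ger0_norm ?mulr_ge0 ?(ltW t0) //.
have c1 : fock_norm ru * fock_norm vt <= B * t ^+ 2 * (D + (fock_norm v0 + fock_norm v1)) by apply: ler_pM.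
have c2 : fock_norm su * fock_norm rv <= (fock_norm u0 + fock_norm u1) * (D * t ^+ 2) by apply: ler_pM.
have c3 : t * t * cabs (fock_inner (A u1) v1) <= t * t * (2 * (fock_norm u1 * fock_norm v1) * M).
  by rewrite ler_wpM2l // mulr_ge0 // ltW.
apply: (@le_trans _ _ (t * K * M * t)); last first.
  by rewrite ler_wpM2r ?(ltW t0) // ler_wpM2r.
have -> : t * K * M * t = 2 * (B * t ^+ 2 * (D + (fock_norm v0 + fock_norm v1))) * M +
  2 * ((fock_norm u0 + fock_norm u1) * (D * t ^+ 2)) * M + t * t * (2 * (fock_norm u1 * fock_norm v1) * M).
  by rewrite /K; ring.
apply: lerD; last exact: c3.
apply: lerD.
  by apply: le_trans b1 _; rewrite ler_wpM2r // ler_wpM2l.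
by apply: le_trans b2 _; rewrite ler_wpM2r // ler_wpM2l.
Qed.

(** Write X and Y for the coefficients with x_a in the first and in the second slot. The derivative
    along a gives X + Y. Along ia the form picks up -i, which the second slot conjugates to i, so
    the derivative is i(Y - X). The two results determine X and Y. *)
Lemma gen_xdot P Q a : gen P Q ->
  gen (fun w => xdot a w * P w) Q /\ gen P (fun w => xdot a w * Q w).
Proof.
move=> G; have [eP bP eQ bQ aPQ] := G.
have exP : entire (fun w => xdot a w * P w) by apply: entireM => //; exact: entire_xdot.
have bxP : expbd (fun w => xdot a w * P w) by apply: expbdM => //; exact: expbd_xdot.
have exQ : entire (fun w => xdot a w * Q w) by apply: entireM => //; exact: entire_xdot.
have bxQ : expbd (fun w => xdot a w * Q w) by apply: expbdM => //; exact: expbd_xdot.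
have xi w : xdot ('i *: a) w = - 'i * xdot a w by rewrite xdotZl conjI.
have E f g A M : opbd A M -> in_fock f -> in_fock g ->
    mel (fun w => - 'i * f w) g A = - 'i * mel f g A /\ mel f (fun w => - 'i * g w) A = 'i * mel f g A.
  move=> bA Ff Fg; have LA := fockL2 (opbd_fock bA Ff); have Lg := fockL2 Fg.
  by rewrite /mel (opbdZ _ bA) // fock_innerZl // fock_innerZr // conjN conjI opprK.
have ii : 'i * 'i = -1 :> C by apply: eqReIm; rewrite !ReImE; ring.
have S z : appr (mel (fun w => xdot a w * P w * ker z w) (fun w => Q w * ker z w)) /\
           appr (mel (fun w => P w * ker z w) (fun w => xdot a w * Q w * ker z w)).
  have h1 := gen_diff z a G; have h2 := gen_diff z ('i *: a) G.
  have FP := in_fock_expker z eP bP; have FQ := in_fock_expker z eQ bQ.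
  have FxP := in_fock_expker z exP bxP; have FxQ := in_fock_expker z exQ bxQ.
  have Ei A M : opbd A M ->
     mel (fun w => xdot ('i *: a) w * P w * ker z w) (fun w => Q w * ker z w) A +
     mel (fun w => P w * ker z w) (fun w => xdot ('i *: a) w * Q w * ker z w) A =
     'i * (mel (fun w => P w * ker z w) (fun w => xdot a w * Q w * ker z w) A -
           mel (fun w => xdot a w * P w * ker z w) (fun w => Q w * ker z w) A).
    move=> bA; have [e1 _] := E _ _ _ _ bA FxP FQ; have [_ e2] := E _ _ _ _ bA FP FxQ.
    rewrite mulrBr -e2 -mulNr -e1 addrC; congr (mel _ _ _ + mel _ _ _);
      by apply/funext => w; rewrite xi; ring.
  have h3 := eq_appr Ei h2.
  have half (x y : C) : (2^-1 : R)%:C * (x + y + 'i * ('i * (y - x))) = x.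
    by rewrite mulrA ii; apply: eqReIm; rewrite !ReImE; field.
  have half' (x y : C) : (2^-1 : R)%:C * (x + y + (- 'i) * ('i * (y - x))) = y.
    by rewrite mulNr mulrA ii; apply: eqReIm; rewrite !ReImE; field.
  split.
    by apply: eq_appr (apprZ (2^-1 : R)%:C (apprD h1 (apprZ 'i h3))) => A M bA; rewrite half.
  by apply: eq_appr (apprZ (2^-1 : R)%:C (apprD h1 (apprZ (- 'i) h3))) => A M bA; rewrite half'.
by split; split => // z; have [] := S z.
Qed.

Lemma gen_affine P Q a (r : C) : gen P Q ->
  gen (fun w => (1 + r * xdot a w) * P w) Q /\ gen P (fun w => (1 + r * xdot a w) * Q w).
Proof.
move=> G; have [eP bP eQ bQ aPQ] := G; have [G1 G2] := gen_xdot a G.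
have [exP bxP _ _ aP] := G1; have [_ _ exQ bxQ aQ] := G2.
have el : entire (fun w => 1 + r * xdot a w).
  by apply: entireD; [exact: entire_cst | apply: entireM; [exact: entire_cst | exact: entire_xdot]].
have bl : expbd (fun w => 1 + r * xdot a w).
  by apply: expbdD; [exact: expbd_cst | apply: expbdM; [exact: expbd_cst | exact: expbd_xdot]].
have E (S : V -> C) z : (fun w => (1 + r * xdot a w) * S w * ker z w) =
    fun w => r * (xdot a w * S w * ker z w) + S w * ker z w.
  by apply/funext => w; ring.
split; split => //; try exact: entireM; try exact: expbdM; move=> z; rewrite E.
  by apply: appr_mel_combl => //; exact: in_fock_expker.
by apply: appr_mel_combr => //; exact: in_fock_expker.
Qed.

Lemma gen_pow a b (r s : C) j k :
  gen (fun w => (1 + r * xdot a w) ^+ j) (fun w => (1 + s * xdot b w) ^+ k).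
Proof.
elim: j => [|j IH].
  under eq_fun do rewrite expr0.
  elim: k => [|k IH]; first by under [X in gen _ X]eq_fun do rewrite expr0; exact: gen1.
  by under [X in gen _ X]eq_fun do rewrite exprS; exact: (proj2 (gen_affine b s IH)).
by under eq_fun do rewrite exprS; exact: (proj1 (gen_affine a r IH)).
Qed.

(** Factor a^N - b^N for a = e^(x/N) and b = 1 + x/N: both are bounded by e^(|x|/N), and a - b is of
    order |x|^2/N^2. Powers are preferred to Taylor polynomials because they arise by repeating one
    affine factor, as in [gen_pow]. *)
Lemma exp_power (x : C) (N : nat) : (0 < N)%N ->
  cabs (cexp x - (1 + (N%:R^-1 : R)%:C * x) ^+ N) <= 4 / N%:R * expR (2 * cabs x).
Proof.
move=> N0; have NR : 0 < (N%:R : R) by rewrite ltr0n.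
pose y := (N%:R^-1 : R)%:C * x.
have cy : cabs y = cabs x / N%:R by rewrite cabsM cabs_real ger0_norm ?invr_ge0 ?(ltW NR) // mulrC.
have xy : N%:R * y = x.
  by rewrite /y mulrA -(rmorph_nat (real_complex R)) -realCM divff ?mul1r // gt_eqF.
have -> : cexp x = cexp y ^+ N by rewrite cexpX xy.
rewrite -/y subrXX; pose m := expR (cabs y).
have mu : cabs (cexp y) <= m by rewrite cabs_cexp ler_expR Re_lec.
have mv : cabs (1 + y) <= m.
  by apply: le_trans (cabsD _ _) _; rewrite cabs1; exact: expR_ge1Dx.
have x0 := cabs_ge0 x.
have mN : m * m ^+ N.-1 = expR (cabs x).
  by rewrite -exprS prednK // /m cy -expRM_natl mulrC divfK // gt_eqF.
have S : cabs (\sum_(i < N) cexp y ^+ (N.-1 - i) * (1 + y) ^+ i) <= N%:R * m ^+ N.-1.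
  apply: le_trans (cabs_sum _ _ _) _; rewrite -[N in N%:R]card_ord -sumr_const mulr_suml.
  apply: ler_sum => i _; rewrite mul1r cabsM !cabsX.
  have -> : m ^+ N.-1 = m ^+ (N.-1 - i) * m ^+ i.
    by rewrite -exprD subnK // -ltnS prednK.
  by apply: ler_pM; rewrite ?exprn_ge0 ?cabs_ge0 // lerXn2r ?nnegrE ?cabs_ge0 ?expR_ge0.
have D : cabs (cexp y - (1 + y)) <= 2 * ((cabs x / N%:R) ^+ 2 * m).
  by rewrite opprD addrA -cy; exact: cexp_taylor1.
rewrite cabsM; apply: le_trans (ler_pM (cabs_ge0 _) (cabs_ge0 _) D S) _.
have -> : 2 * ((cabs x / N%:R) ^+ 2 * m) * (N%:R * m ^+ N.-1) = 2 * cabs x ^+ 2 / N%:R * (m * m ^+ N.-1).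
  by field; rewrite gt_eqF.
rewrite mN; have := @expR_ge1Dxn R (cabs x) 1 x0; rewrite (_ : (2`! = 2)%N) // => E.
have E0 := expR_gt0 (cabs x).
have -> : expR (2 * cabs x) = expR (cabs x) * expR (cabs x) by rewrite -expRD mulr_natl.
have -> : 4 / N%:R * (expR (cabs x) * expR (cabs x)) = 4 * expR (cabs x) / N%:R * expR (cabs x) by ring.
by rewrite ler_pM2r // ler_pM2r ?invr_gt0 //; move: E; clear; lra.
Qed.

Lemma ker_power_cvg a (e : R) : 0 < e -> exists N : nat,
  fock_norm (fun w => ker a w - (1 + (N%:R^-1 : R)%:C * xdot a w) ^+ N) <= e.
Proof.
move=> e0; pose B := fock_norm (@expl1 R n (2 * xdot_cst a)).
have B0 : 0 <= B by exact: fock_norm_ge0.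
pose N := (Num.trunc (4 * B / e)).+1.
have BN : 4 * B / e <= N%:R.
  have /andP[_ /ltW] := truncn_itv (divr_ge0 (mulr_ge0 (ler0n _ 4) B0) (ltW e0)).
  by [].
have NR : 0 < (N%:R : R) by rewrite ltr0n.
exists N.
have [|||L H] := @expbd_bound R n (fun w => ker a w - (1 + (N%:R^-1 : R)%:C * xdot a w) ^+ N) (4 / N%:R) (2 * xdot_cst a).
- have [cx _] := expbd_xdot a.
  apply: ccontD; first exact: ccont_cexp.
  under eq_fun do rewrite -mulN1r; apply: ccontM; first exact: ccont_cst.
  have : expbd (fun w => (1 + (N%:R^-1 : R)%:C * xdot a w) ^+ N); last by case.
  apply: expbdX; apply: expbdD; first exact: expbd_cst.
  by apply: expbdM; [exact: expbd_cst | exact: expbd_xdot].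
- by rewrite divr_ge0.
- move=> w; apply: le_trans (exp_power _ _) _ => //.
  by rewrite ler_wpM2l ?divr_ge0 // ler_expR -mulrA ler_wpM2l // cabs_xdot.
apply: le_trans H _; rewrite -/B mulrAC ler_pdivrMr // mulrC.
by rewrite [e * _]mulrC -ler_pdivrMr // [B * _]mulrC.
Qed.

Lemma in_fock_power a (r : C) k : in_fock (fun w => (1 + r * xdot a w) ^+ k).
Proof.
have [e b _ _ _] := gen_pow a a r r k k.
exact: expbd_fock.
Qed.

(** At z = 0 the kernel is 1, so [gen_pow] speaks of bare powers there. The two slots are passed to
    the limit one after the other, the left power being fixed while the right one varies. *)
Lemma appr_ker a b : appr (mel (ker a) (ker b)).
Proof.
have base j k r s : appr (mel (fun w => (1 + r * xdot a w) ^+ j) (fun w => (1 + s * xdot b w) ^+ k)).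
  have [_ _ _ _ /(_ 0)] := gen_pow a b r s j k; congr (appr (mel _ _));
  by apply/funext => w; rewrite ker0 mulr1.
have Fa := in_fock_ker a; have Fb := in_fock_ker b.
apply: appr_mel_liml => // e e0; have [N HN] := ker_power_cvg a e0.
exists (fun w => (1 + (N%:R^-1 : R)%:C * xdot a w) ^+ N); split => //; first exact: in_fock_power.
apply: appr_mel_limr => //; first exact: in_fock_power.
move=> d d0; have [K HK] := ker_power_cvg b d0.
by exists (fun w => (1 + (K%:R^-1 : R)%:C * xdot b w) ^+ K); split => //; exact: in_fock_power.
Qed.

(** [fock_dense] is applied, one slot at a time, to the space of all functions whose coefficient is
    approximable; the linear span of the kernels never has to be formed. *)
Lemma appr_mel f g : in_fock f -> in_fock g -> appr (mel f g).
Proof.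
have kk a b : appr (mel (kz a) (kz b)).
  rewrite !kzE; apply: eq_appr (apprZ ((expR (- (pi / 2 * sqn a)))%:C * (expR (- (pi / 2 * sqn b)))%:C) (appr_ker a b)) => A M bA.
  have Fa := in_fock_ker a; have Fb := in_fock_ker b.
  have LA := fockL2 (opbd_fock bA Fa); have Lb := fockL2 Fb.
  rewrite /mel (opbdZ _ bA) // fock_innerZl //; last exact: L2Z.
  by rewrite fock_innerZr // conj_real mulrA.
have fk b f' : in_fock f' -> appr (mel f' (kz b)).
  move=> Ff; apply: appr_mel_liml => //; first exact: in_fock_kz.
  move=> e e0; pose D h := in_fock h /\ appr (mel h (kz b)).
  have [|||g' [Fg ag] hg] := @fock_dense R n D _ _ _ f' Ff e e0.
  - by move=> h [].
  - move=> c h h' [Fh ah] [Fh' ah']; split; last by apply: appr_mel_combl => //; exact: in_fock_kz.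
    by apply: in_fockD => //; exact: in_fockZ.
  - by move=> z; split; [exact: in_fock_kz | exact: kk].
  by exists g'.
move=> Ff Fg; apply: appr_mel_limr => // e e0; pose D h := in_fock h /\ appr (mel f h).
have [|||g' [Fg' ag] hg] := @fock_dense R n D _ _ _ g Fg e e0.
- by move=> h [].
- move=> c h h' [Fh ah] [Fh' ah']; split; last exact: appr_mel_combr.
  by apply: in_fockD => //; exact: in_fockZ.
- by move=> z; split; [exact: in_fock_kz | exact: fk].
by exists g'.
Qed.
End BerezinSpan.

(** * The barrier estimate *)

Section Barrier.
Variables (R : realType) (D : nat).
Local Notation V := 'rV[R]_D.
Implicit Types (u : V -> R) (x y : V).

Definition econt u := forall x (e : R), 0 < e -> exists2 d : R, 0 < d &
  forall y, (forall j, `|y 0 j - x 0 j| < d) -> `|u y - u x| < e.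
(** The symmetric second difference: nonnegative at an interior minimum for small [t], with no
    recourse to first derivatives, and exact on quadratic polynomials such as the barrier. *)
Definition symdiff u (j : 'I_D) x (t : R) :=
  (u (x + t *: delta_mx 0 j) + u (x - t *: delta_mx 0 j) - 2 * u x) / t ^+ 2.
Definition symder u (j : 'I_D) x (l : R) := forall e : R, 0 < e -> exists2 d : R, 0 < d &
  forall t, 0 < t < d -> `|symdiff u j x t - l| < e.

Lemma econt_continuous u : econt u -> continuous u.
Proof.
move=> cu x; apply: (proj2 (@cvgrPdist_lt _ _ _ (nbhs x) (nbhs_filter x) u (u x))) => e e0.
have [d d0 H] := cu x e e0; apply/nbhs_ballP; exists d => // y xy /=; rewrite distrC; apply: H => j.
by case: xy => _ /(_ 0 j); rewrite /ball /= distrC.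
Qed.

Lemma econtD u v : econt u -> econt v -> econt (fun x => u x + v x).
Proof.
move=> cu cv x e e0; have e2 : 0 < e / 2 by rewrite divr_gt0.
have [d1 d10 H1] := cu x _ e2; have [d2 d20 H2] := cv x _ e2.
exists (Num.min d1 d2); first by rewrite lt_min d10.
move=> y xy; have h1 : `|u y - u x| < e / 2 by apply: H1 => j; have := xy j; rewrite lt_min => /andP[].
have h2 : `|v y - v x| < e / 2 by apply: H2 => j; have := xy j; rewrite lt_min => /andP[].
move: h1 h2; rewrite !ltr_norml; lra.
Qed.
Lemma econtN u : econt u -> econt (fun x => - u x).
Proof.
move=> cu x e e0; have [d d0 H] := cu x _ e0; exists d => // y /H.
by rewrite -opprD normrN.
Qed.
Lemma econt_coord_sum (p : 'I_D -> R -> R) : (forall j, continuous (p j)) ->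
  econt (fun x : V => \sum_j p j (x 0 j)).
Proof.
move=> cp; rewrite (_ : (fun x : V => _) = fun x : V => \sum_(j <- index_enum 'I_D) p j (x 0 j)) //.
elim: (index_enum _) => [|j s IH].
  by move=> x e e0; exists 1 => // y _; rewrite !big_nil subrr normr0.
rewrite (_ : (fun x : V => _) = fun x : V => p j (x 0 j) + \sum_(j <- s) p j (x 0 j)); last first.
  by apply/funext => x; rewrite big_cons.
apply: econtD => // x e e0; have /cvgrPdist_lt /(_ e e0) /nbhs_ballP[d d0 H] := cp j (x 0 j).
by exists d => // y /(_ j) xy; rewrite distrC; apply: H; rewrite /ball /= distrC.
Qed.

Lemma addZ_delta x (t : R) j k : (x + t *: delta_mx 0 j) 0 k = x 0 k + (if k == j then t else 0).
Proof. by rewrite !mxE eqxx /=; case: eqP; rewrite ?mulr1 ?mulr0. Qed.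
Lemma subZ_delta x (t : R) j k : (x - t *: delta_mx 0 j) 0 k = x 0 k - (if k == j then t else 0).
Proof. by rewrite -scaleNr addZ_delta; case: eqP; rewrite ?oppr0. Qed.

Lemma symdiff_coord_sum (p : 'I_D -> R -> R) j x t :
  symdiff (fun x : V => \sum_k p k (x 0 k)) j x t =
  (p j (x 0 j + t) + p j (x 0 j - t) - 2 * p j (x 0 j)) / t ^+ 2.
Proof.
rewrite /symdiff; congr (_ / _); rewrite mulr_sumr -big_split -sumrB /= (bigD1 j) //= big1 ?addr0.
  by rewrite addZ_delta subZ_delta eqxx.
by move=> k kj; rewrite addZ_delta subZ_delta (negbTE kj) addr0 subr0; ring.
Qed.

Definition refl (j0 : 'I_D) x : V := \row_j (if j == j0 then - x 0 j else x 0 j).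
Lemma refl_addZ j0 x (t : R) j : refl j0 (x + t *: delta_mx 0 j) =
  refl j0 x + (if j == j0 then - t else t) *: delta_mx 0 j.
Proof.
apply/rowP => k; rewrite addZ_delta !mxE eqxx /=; case: (eqVneq k j) => [->|kj].
  by rewrite mulr1n mulr1; case: eqP => _; ring.
by rewrite mulr0n mulr0 !addr0.
Qed.
Lemma symdiff_refl u j0 j x t : symdiff (u \o refl j0) j x t = symdiff u j (refl j0 x) t.
Proof.
rewrite /symdiff /= -scaleNr !refl_addZ; congr (_ / _).
by case: eqP => _; rewrite ?scaleNr ?opprK // [X in X - _]addrC.
Qed.

Lemma symdiff_half_diff u v j x t : symdiff (fun x => (u x - v x) / 2) j x t = (symdiff u j x t - symdiff v j x t) / 2.
Proof. by rewrite /symdiff; ring. Qed.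

(* Gilbarg-Trudinger, Theorem 3.9: compare (u(x) - u(refl x)) / 2 on a half cube with the barrier
   M (\sum_{j <> j0} x_j^2 + x_j0 (D - (D-1) x_j0)) + N/2 x_j0 (1 - x_j0), whose second derivatives add up to -N. *)
Lemma barrier u (M N : R) (L : 'I_D -> V -> R) (j0 : 'I_D) :
  econt u -> (forall x, `|u x| <= M) -> (forall j x, symder u j x (L j x)) ->
  (forall x, `|\sum_j L j x| < N) -> forall t, 0 <= t <= 1 ->
  u (t *: delta_mx 0 j0) - u (- (t *: delta_mx 0 j0)) <= t * (2 * D%:R * M + N).
Proof.
move=> cu uM uL LN t /andP[t0 t1].
have M0 : 0 <= M by exact: le_trans (normr_ge0 _) (uM 0).
have N0 : 0 < N by exact: le_lt_trans (normr_ge0 _) (LN 0).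
have D0 : (1 : R) <= D%:R by rewrite ler1n; case: D j0 => [[]|].
pose phi x := (u x - u (refl j0 x)) / 2.
pose p (j : 'I_D) (y : R) := if j == j0 then M * y * (D%:R - (D%:R - 1) * y) + N / 2 * y * (1 - y) else M * y ^+ 2.
pose psi x := \sum_j p j (x 0 j).
have cp j : continuous (p j).
  rewrite /p; case: (j == j0) => y.
    apply: cvgD; apply: cvgM.
    - by apply: cvgM; [exact: cvg_cst | exact: cvg_id].
    - by apply: cvgB; [exact: cvg_cst | apply: cvgM; [exact: cvg_cst | exact: cvg_id]].
    - by apply: cvgM; [exact: cvg_cst | exact: cvg_id].
    - by apply: cvgB; [exact: cvg_cst | exact: cvg_id].
  by apply: cvgM; [exact: cvg_cst | exact: exprn_continuous].
have cphi : econt phi.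
  move=> x e e0; have [d1 d10 H1] := cu x e e0; have [d2 d20 H2] := cu (refl j0 x) e e0.
  exists (Num.min d1 d2); first by rewrite lt_min d10.
  move=> y xy; rewrite /phi.
  have h1 : `|u y - u x| < e by apply: H1 => j; have := xy j; rewrite lt_min => /andP[].
  have h2 : `|u (refl j0 y) - u (refl j0 x)| < e.
    apply: H2 => j; rewrite !mxE; have := xy j; rewrite lt_min => /andP[_].
    by case: eqP => // _; rewrite -opprD normrN.
  move: h1 h2; rewrite !ltr_norml; lra.
have phiM x : phi x <= M.
  have := uM x; have := uM (refl j0 x); rewrite !ler_norml /phi; lra.
have phi0 x : x 0 j0 = 0 -> phi x = 0.
  move=> x0; rewrite /phi (_ : refl j0 x = x) ?subrr ?mul0r //.
  by apply/rowP => j; rewrite mxE; case: eqP => // ->; rewrite x0 oppr0.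
pose Kj (j : 'I_D) : set R := [set` `[(if j == j0 then 0 else - 1), 1 : R]].
pose K := [set x : V | forall j, Kj j (x ord0 j)].
have cK : compact K by apply: rV_compact => j; exact: segment_compact.
have K0 : K !=set0.
  exists 0 => j; rewrite /Kj /= in_itv /= mxE ler01 andbT; case: ifP => // _; lra.
have cw : {within K, continuous (fun x : V => psi x - phi x)}.
  apply: continuous_subspaceT; apply: econt_continuous; apply: econtD; first exact: econt_coord_sum.
  exact: econtN.
have [x xK xmin] := @EVT_min_rV R D (fun x : V => psi x - phi x) K K0 cK cw.
rewrite inE in xK.
have inK j : (if j == j0 then 0 else - 1) <= x 0 j <= 1 by have := xK j; rewrite /Kj /= in_itv.
have pj_ge0 j (y : R) : (if j == j0 then 0 else - 1) <= y <= 1 -> 0 <= p j y.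
  rewrite /p; case: (j == j0) => /andP[y0 y1]; last by rewrite mulr_ge0 // sqr_ge0.
  rewrite addr_ge0 ?mulr_ge0 ?(ltW N0) ?invr_ge0 //; [|lra]; nra.
have psi_ge j : p j (x 0 j) <= psi x.
  by rewrite /psi (bigD1 j) //= lerDl; apply: sumr_ge0 => k _; exact: pj_ge0.
have wmin : 0 <= psi x - phi x.
  (* Boundary of the half cube: on the face x_j0 = 0 the function [phi] vanishes by oddness, and on
     every other face one of the nonnegative summands of [psi] equals [M], which bounds [phi]. *)
  have [x00|x0n] := eqVneq (x 0 j0) 0.
    by rewrite (phi0 _ x00) subr0; apply: le_trans (psi_ge j0); exact: pj_ge0.
  have [x01|x1n] := eqVneq (x 0 j0) 1.
    have := psi_ge j0; rewrite /p eqxx x01; have := phiM x; lra.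
  have [/existsP[j /andP[jj0 xj]]|] := boolP [exists j : 'I_D, (j != j0) && (`|x 0 j| == 1)].
    have := psi_ge j; rewrite /p (negbTE jj0) -real_normK ?num_real // (eqP xj); have := phiM x; lra.
  rewrite negb_exists => /forallP intr.
  (* interior minimum: all symmetric second differences are nonnegative, but their sum tends to a negative limit *)
  exfalso.
  pose s := D%:R * M + N.
  pose Lp j := if j == j0 then - 2 * M * (D%:R - 1) - N else 2 * M.
  have sdp j (r : R) : r != 0 -> symdiff psi j x r = Lp j.
    move=> r0; rewrite /psi symdiff_coord_sum /p /Lp; case: (j == j0); by field.
  pose Lphi j := (L j x - L j (refl j0 x)) / 2.
  have sdphi j : symder phi j x (Lphi j).
    move=> e e0; have [d1 d10 H1] := uL j x e e0; have [d2 d20 H2] := uL j (refl j0 x) e e0.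
    exists (Num.min d1 d2); first by rewrite lt_min d10.
    move=> r /andP[r0]; rewrite lt_min => /andP[r1 r2].
    rewrite symdiff_half_diff -[symdiff (fun x => u (refl j0 x)) _ _ _]/(symdiff (u \o refl j0) j x r) symdiff_refl.
    have := H1 r; rewrite r0 r1 => /(_ isT); have := H2 r; rewrite r0 r2 => /(_ isT).
    rewrite /Lphi !ltr_norml; lra.
  have interior j : exists2 d : R, 0 < d & forall r, 0 < r < d -> K (x + r *: delta_mx 0 j) /\ K (x - r *: delta_mx 0 j).
    pose lo : R := if j == j0 then 0 else - 1.
    have lx : lo < x 0 j.
      have /andP[a _] := inK j; rewrite lt_neqAle a andbT /lo.
      case: (eqVneq j j0) => [jj|jj0]; first by rewrite jj eq_sym.
      have := intr j; rewrite jj0 /=; apply: contra => /eqP <-; by rewrite normrN1.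
    have xu : x 0 j < 1.
      have /andP[_ b] := inK j; rewrite lt_neqAle b andbT.
      case: (eqVneq j j0) => [->//|jj0].
      have := intr j; rewrite jj0 /=; apply: contra => /eqP ->; by rewrite normr1.
    exists (Num.min (x 0 j - lo) (1 - x 0 j)); first by rewrite lt_min !subr_gt0 lx.
    move=> r /andP[r0]; rewrite lt_min => /andP[r1 r2].
    split=> k; rewrite /Kj /= in_itv /=.
      rewrite addZ_delta; case: (eqVneq k j) => [->|_]; last by rewrite addr0; exact: inK.
      by rewrite (le_trans (ltW lx)) ?lerDl ?(ltW r0) //= -lerBrDl ltW.
    rewrite subZ_delta; case: (eqVneq k j) => [->|_]; last by rewrite subr0; exact: inK.
    by rewrite lerBrDr addrC -lerBrDr (ltW r1) /= (le_trans _ (ltW xu)) // gerBl ltW.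
  have Lge j : Lphi j <= Lp j.
    apply/ler_addgt0Pr => e e0.
    have [d1 d10 H1] := sdphi j e e0; have [d2 d20 H2] := interior j.
    pose r : R := Num.min d1 d2 / 2.
    have m0 : 0 < Num.min d1 d2 by rewrite lt_min d10.
    have r0 : 0 < r by rewrite divr_gt0.
    have rm : r < Num.min d1 d2 by rewrite /r ltr_pdivrMr // ltr_pMr // ltr1n.
    move: rm; rewrite lt_min => /andP[r1 r2].
    have r02 : 0 < r < d2 by rewrite r0 r2.
    have [k1 k2] := H2 r r02.
    have := H1 r; rewrite r0 r1 => /(_ isT).
    have rn : r != 0 by rewrite gt_eqF.
    have : symdiff phi j x r <= symdiff psi j x r.
      rewrite /symdiff ler_pM2r ?invr_gt0 ?exprn_gt0 //.
      have := xmin (x + r *: delta_mx 0 j); have := xmin (x - r *: delta_mx 0 j).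
      rewrite !inE => /(_ k2) h2 /(_ k1) h1; lra.
    rewrite sdp // ltr_norml; lra.
  have : \sum_j Lphi j <= \sum_j Lp j by apply: ler_sum => j _.
  have -> : \sum_j Lp j = - N.
    rewrite (bigD1 j0) //= {1}/Lp eqxx (eq_bigr (fun=> 2 * M)); last first.
      by move=> j /negbTE jj0; rewrite /Lp jj0.
    rewrite sumr_const cardC1 card_ord -(mulr_natl _ D.-1).
    have -> : (D.-1%:R : R) = D%:R - 1.
      by rewrite -subn1 natrB // (leq_ltn_trans _ (ltn_ord j0)).
    ring.
  rewrite /Lphi -mulr_suml sumrB; have := LN x; have := LN (refl j0 x); rewrite !ltr_norml; lra.
have tK : K (t *: delta_mx 0 j0).
  move=> j; rewrite /Kj /= in_itv /= !mxE eqxx /=.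
  case: (eqVneq j j0) => _; rewrite ?mulr1 ?mulr0 ?t0 //.
  by rewrite ler01 andbT; lra.
have := xmin (t *: delta_mx 0 j0); rewrite inE => /(_ tK) wt.
have : phi (t *: delta_mx 0 j0) <= psi (t *: delta_mx 0 j0) by lra.
have -> : psi (t *: delta_mx 0 j0) = M * t * (D%:R - (D%:R - 1) * t) + N / 2 * t * (1 - t).
  rewrite /psi (bigD1 j0) //= big1 ?addr0 => [|j jj0].
    by rewrite /p eqxx !mxE !eqxx mulr1.
  by rewrite /p (negbTE jj0) !mxE (negbTE jj0) eqxx /= mulr0 expr0n mulr0.
rewrite /phi (_ : refl j0 (t *: delta_mx 0 j0) = - (t *: delta_mx 0 j0)); last first.
  apply/rowP => j; rewrite !mxE; case: (eqVneq j j0) => // _; by rewrite andbF mulr0 oppr0.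
(* The terms of [psi] quadratic in [t] are nonpositive; dropping them leaves a bound linear in
   [t]. *)
have h1 : 0 <= M * (t * t) * (D%:R - 1) by rewrite !mulr_ge0 // subr_ge0.
have h2 : 0 <= N * (t * t) by rewrite !mulr_ge0 // ltW.
lra.
Qed.
End Barrier.

(** * Symmetric second differences in one variable *)

Section SecondDerivative.
Variable R : realType.
Implicit Types (f g : R -> R).

Definition rder g (s l : R) := forall e : R, 0 < e -> exists2 d : R, 0 < d &
  forall h : R, 0 < `|h| < d -> `|(g (s + h) - g s) / h - l| < e.

Lemma rder_is_derive g s l : rder g s l -> is_derive s 1 g l.
Proof.
move=> H.
have cv : (fun h => h^-1 *: ((g \o shift s) (h *: 1) - g s)) @ 0^' --> l.
  apply/cvgrPdist_lt => e e0; have [d d0 Hd] := H e e0.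
  rewrite near_withinE; apply/nbhs_ballP; exists d => //= h hd h0.
  rewrite distrC /= [h *: 1]mulr1 addrC [h + s]addrC [_ *: _]mulrC.
  have := Hd h; rewrite addrC; apply; rewrite normr_gt0 h0 /=.
  by move: hd; rewrite /ball /= sub0r normrN.
apply: DeriveDef; first by apply/cvg_ex; exists l.
exact: cvg_lim cv.
Qed.
Lemma rder_opp g s l : rder g (- s) l -> rder (fun x => g (- x)) s (- l).
Proof.
move=> H e /H[d d0 Hd]; exists d => // h hd.
have := Hd (- h); rewrite normrN => /(_ hd).
by rewrite invrN mulrN -[X in `|X|]opprB normrN !opprK addrC opprD.
Qed.
Lemma rder_sq (c s : R) : rder (fun x => c * x ^+ 2) s (c * (2 * s)).
Proof.
move=> e e0; have c0 : 0 < `|c| + 1 by rewrite ltr_wpDl.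
exists (e / (`|c| + 1)); first by rewrite divr_gt0.
move=> h /andP[h0 hd]; have hn : h != 0 by rewrite -normr_gt0.
have -> : (c * (s + h) ^+ 2 - c * s ^+ 2) / h - c * (2 * s) = c * h by field.
rewrite ltr_pdivlMr // mulrDr mulr1 in hd; rewrite normrM mulrC; lra.
Qed.

(** Let c be the second difference at t. The function g(x) + g(-x) - c x^2 has equal values at 0 and
    t, so its derivative vanishes at some x in between; there c is the mean of the difference
    quotients of [g1] at 0 with increments x and -x, both close to [l]. *)
Lemma symder2 g (g1 : R -> R) (l : R) : (forall s, rder g s (g1 s)) -> rder g1 0 l ->
  forall e : R, 0 < e -> exists2 d : R, 0 < d &
  forall t : R, 0 < t < d -> `|(g t + g (- t) - 2 * g 0) / t ^+ 2 - l| < e.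
Proof.
move=> dg dl e e0; have [d d0 H] := dl e e0; exists d => // t /andP[t0 td].
pose c := (g t + g (- t) - 2 * g 0) / t ^+ 2.
have tn : t != 0 by rewrite gt_eqF.
pose k := (fun x => g x) + (fun x => g (- x)) - (fun x => c * x ^+ 2).
have dk (x : R) : is_derive x 1 k (g1 x + - g1 (- x) - c * (2 * x)).
  have D1 := rder_is_derive (dg x); have D2 := rder_is_derive (rder_opp (dg (- x))).
  have D3 := rder_is_derive (rder_sq c x).
  exact: is_deriveB.
have ck : {within `[0, t], continuous k}.
  by apply: derivable_within_continuous => x _; have [] := dk x.
have [x /[!in_itv] /andP [x0 xt]] := @MVT _ k _ 0 t t0 (fun x _ => dk x) ck.
have -> : k t - k 0 = 0.
  rewrite /k !fctE oppr0 expr0n mulr0 subr0.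
  have -> : c * t ^+ 2 = g t + g (- t) - 2 * g 0 by rewrite /c divfK // expf_neq0.
  ring.
move: x0 xt; rewrite /= => x0 xt.
rewrite subr0 => /esym/eqP; rewrite mulf_eq0 (negbTE tn) orbF => /eqP E.
have xn : x != 0 by rewrite gt_eqF.
have c2 : c = ((g1 (0 + x) - g1 0) / x + (g1 (0 + - x) - g1 0) / (- x)) / 2.
  rewrite !add0r; have -> : c = (g1 x - g1 (- x)) / (2 * x).
    apply: (mulIf (mulf_neq0 (_ : 2 != 0 :> R) xn)) => //; rewrite divfK; last by rewrite mulf_neq0.
    by move: E; clear; lra.
  by field.
have xd : 0 < `|x| < d by rewrite gtr0_norm // x0 (lt_trans xt td).
have := H x xd; have := H (- x); rewrite normrN => /(_ xd).
rewrite -/c c2 !ltr_norml; lra.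
Qed.
End SecondDerivative.

(** * From the Laplacian on C^n to the barrier estimate on R^(2n) *)

Section Oscillation.
Variables (R : realType) (n : nat).
Local Notation C := R[i].
Local Notation V := (Cn R n).
Implicit Types (F H : V -> C) (z v : V).

Lemma rderiv_symder F (G : V -> C) z v (l : C) : (forall w, has_rderiv F w v (G w)) -> has_rderiv G z v l ->
  forall e : R, 0 < e -> exists2 d : R, 0 < d & forall t : R, 0 < t < d ->
   `|(Re (F (z + t%:C *: v)) + Re (F (z - t%:C *: v)) - 2 * Re (F z)) / t ^+ 2 - Re l| < e.
Proof.
move=> dF dG.
have conv (K : V -> C) s m : has_rderiv K (z + s%:C *: v) v m -> rder (fun s => Re (K (z + s%:C *: v))) s (Re m).
  move=> H e /H[d d0 Hd]; exists d => // h hd; have := Hd h hd; apply: le_lt_trans.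
  rewrite realCD scalerDl addrA.
  have -> : Re (K (z + s%:C *: v + h%:C *: v)) - Re (K (z + s%:C *: v)) =
     Re (K (z + s%:C *: v + h%:C *: v) - K (z + s%:C *: v)) by rewrite ReD ReN.
  have -> : forall c : C, Re c / h - Re m = Re (c / h%:C - m).
    by move=> c; rewrite -realCV !ReImE mulr0 subr0.
  exact: Re_le_cabs.
move=> e e0.
have [d d0 Hd] := @symder2 R (fun s => Re (F (z + s%:C *: v))) (fun s => Re (G (z + s%:C *: v))) (Re l)
  (fun s => conv F s _ (dF _)) (conv G 0 l (eq_ind_r (fun w => has_rderiv G w v l) dG (etrans (congr1 (fun w => z + w) (scale0r v)) (addr0 z)))) e e0.
exists d => // t /Hd; by rewrite realCN scaleNr scale0r addr0.
Qed.

Definition rdir (b : bool) (i : 'I_n) : V := (if b then 'i else 1) *: ec R i.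

Lemma rdirE b i j : rdir b i 0 j = if j == i then (if b then 'i else 1) else 0.
Proof. by rewrite /rdir mxE ecE eq_sym; case: (j == i); rewrite ?mulr1n ?mulr0n ?mulr1 ?mulr0. Qed.

(** [emb] identifies R^(2n) with C^n around [z], real parts in the first n coordinates and imaginary
    parts in the last n. The sum of the real second derivatives is 4 Re H, whence 4N; the added 1
    supplies the strict inequality that [barrier] asks for. *)
Lemma laplacian_osc F H (M N : R) : laplacian_is F H -> ccont F ->
  (forall z, cabs (F z) <= M) -> (forall z, cabs (H z) <= N) ->
  forall b i z (t : R), 0 <= t <= 1 ->
  Re (F (z + t%:C *: rdir b i)) - Re (F (z - t%:C *: rdir b i)) <= t * (2 * (n + n)%:R * M + (4 * N + 1)).
Proof.
move=> [Dx [Dy [Dxx [Dyy [h1 [h2 [h3 [h4 h5]]]]]]]] cF FM HN b i z t t01.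
pose emb (x : 'rV[R]_(n + n)) : V := \row_k (z 0 k + Complex (x 0 (lshift n k)) (x 0 (rshift n k))).
pose idx (b : bool) (i : 'I_n) : 'I_(n + n) := if b then rshift n i else lshift n i.
have embE x s b' k : emb (x + s *: delta_mx 0 (idx b' k)) = emb x + s%:C *: rdir b' k.
  apply/rowP => j; rewrite [LHS]mxE !addZ_delta [RHS]mxE [emb x 0 j]mxE -addrA; congr (_ + _).
  have e1 : (lshift n j == lshift n k) = (j == k) by rewrite (inj_eq (@lshift_inj _ _)).
  have e2 : (rshift n j == rshift n k) = (j == k) by rewrite (inj_eq (@rshift_inj _ _)).
  have e3 (p q r t' : R) : Complex (p + q) (r + t') = Complex p r + Complex q t' by [].
  rewrite e3; congr (_ + _); rewrite [RHS]mxE rdirE.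
  have si : Complex 0 s = s%:C * 'i.
    by apply: eqReIm; rewrite !ReImE ?mulr0 ?mul0r ?mulr1 ?subr0 ?addr0.
  rewrite /idx; case: b'; rewrite ?e1 ?e2 ?eq_lrshift ?eq_rlshift; case: (j == k);
    by rewrite ?mulr0 ?mulr1 ?si.
pose L (j : 'I_(n + n)) x : R := match fintype.split j with inl k => Re (Dxx k (emb x)) | inr k => Re (Dyy k (emb x)) end.
pose u x := Re (F (emb x)).
have cu : econt u.
  move=> x e e0; have [d d0 Hd] := cF (emb x) e e0.
  pose K : R := 2 * n%:R + 1; have K0 : 0 < K by rewrite /K ltr_wpDl // mulr_ge0.
  exists (Num.min 1 (d / K)); first by rewrite lt_min ltr01 divr_gt0.
  move=> y xy; rewrite /u -ReN -ReD; apply: le_lt_trans (Re_le_cabs _) _; apply: Hd.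
  set m := Num.min _ _ in xy; have m0 : 0 < m by rewrite lt_min ltr01 divr_gt0.
  have m1 : m <= 1 by rewrite ge_min lexx.
  apply: (@le_lt_trans _ _ (n%:R * (2 * m))).
    rewrite /sqn -[n in n%:R]card_ord -sumr_const mulr_suml; apply: ler_sum => k _.
    have E (w : 'rV[R]_(n + n)) : emb w 0 k = z 0 k + Complex (w 0 (lshift n k)) (w 0 (rshift n k)) by rewrite mxE.
    have -> : (emb y - emb x) 0 k = emb y 0 k - emb x 0 k by rewrite mxE [X in _ + X]mxE.
    rewrite !E opprD addrACA subrr add0r cabs_sq !ReImE mul1r.
    have sq (a : R) : `|a| < m -> a ^+ 2 <= m.
      move=> am; rewrite -real_normK ?num_real // expr2; apply: le_trans (_ : `|a| * 1 <= _).
        by rewrite ler_wpM2l // (le_trans (ltW am)).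
      by rewrite mulr1 ltW.
    have := sq _ (xy (lshift n k)); have := sq _ (xy (rshift n k)).
    by move=> h6 h7; rewrite mulr_natl mulr2n; exact: lerD h7 h6.
  have : m * K <= d by rewrite -ler_pdivlMr // ge_min lexx orbT.
  rewrite /K; nra.
have uM x : `|u x| <= M by apply: le_trans (Re_le_cabs _) (FM _).
have uL j x : symder u j x (L j x).
  have S b' k (G : V -> C) l : (forall w, has_rderiv F w (rdir b' k) (G w)) -> has_rderiv G (emb x) (rdir b' k) l ->
      symder u (idx b' k) x (Re l).
    move=> dF dG e e0; have [d d0 Hd] := rderiv_symder dF dG e0.
    exists d => // s /Hd; rewrite /symdiff /u embE.
    by rewrite -(scaleNr s) embE realCN scaleNr.
  rewrite /L -{1}(splitK j); case: (fintype.split j) => k /=.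
    have := S false k (Dx k) (Dxx k (emb x)); rewrite /rdir scale1r; apply => //.
  exact: (S true k (Dy k) (Dyy k (emb x)) (h2 k) (h4 k _)).
have LN x : `|\sum_j L j x| < 4 * N + 1.
  have -> : \sum_j L j x = 4 * Re (H (emb x)).
    rewrite h5 ReM Re_real Im_real mul0r subr0 Re_sum big_split_ord /= mulrA divff ?mul1r //.
    under [RHS]eq_bigr do rewrite ReD.
    rewrite big_split /=; congr (_ + _); apply: eq_bigr => k _; rewrite /L.
      by rewrite (unsplitK (inl k)).
    by rewrite (unsplitK (inr k)).
  rewrite normrM ger0_norm //; have := le_trans (Re_le_cabs _) (HN (emb x)); lra.
have := barrier (idx b i) cu uM uL LN t01.
have e0 : emb 0 = z.
  by apply/rowP => k; rewrite !mxE [Complex 0 0](_ : _ = 0) ?addr0.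
have ep : emb (t *: delta_mx 0 (idx b i)) = z + t%:C *: rdir b i by rewrite -[_ *: _]add0r embE e0.
have em : emb (- (t *: delta_mx 0 (idx b i))) = z - t%:C *: rdir b i.
  by rewrite -[- _]add0r -scaleNr embE e0 realCN scaleNr.
by rewrite /u ep em.
Qed.
End Oscillation.

(** * Translations of operators *)

Section Covariance.
Variables (R : realType) (n : nat).
Local Notation C := R[i].
Local Notation V := (Cn R n).
Local Notation op := (op R n).
Implicit Types (f g : V -> C) (z w a b h : V) (A B S T : op).

Definition alpha z A : op := fun f => weyl z (A (weyl_adj z f)).

Lemma bounded_opbd A : bounded_op A -> exists M, opbd A M.
Proof.
move=> [AF [Al [M AM]]]; exists (Num.max M 0); split => //; first by rewrite le_max lexx orbT.
move=> f Ff; apply: le_trans (AM f Ff) _; rewrite ler_wpM2r ?fock_norm_ge0 //.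
by rewrite le_max lexx.
Qed.
Lemma opbd_bounded A M : opbd A M -> bounded_op A.
Proof. by case=> AF Al _ AM; split => //; split => //; exists M. Qed.
Lemma bounded_fock A f : bounded_op A -> in_fock f -> in_fock (A f).
Proof. by case=> H _; exact: H. Qed.
Lemma bounded_L2 A f : bounded_op A -> in_fock f -> L2 (A f).
Proof. by move=> bA Ff; apply: fockL2; exact: bounded_fock. Qed.

Lemma opbd_alpha z A M : opbd A M -> opbd (alpha z A) M.
Proof.
move=> bA; have M0 : 0 <= M by case: bA.
split => //.
- by move=> f Ff; apply: fock_weyl; apply: opbd_fock bA _; exact: fock_weyl.
- move=> c f g Ff Fg; rewrite /alpha /weyl_adj weylD weylZ (opbd_comb _ bA); try exact: fock_weyl.
  by rewrite weylD weylZ.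
- move=> f Ff; have Fw := fock_weyl (- z) Ff.
  have [c1 _] := fockL2 (opbd_fock bA Fw); have [c2 _] := fockL2 Ff.
  rewrite fock_norm_weyl // -(fock_norm_weyl (- z) c2); exact: opbd_le.
Qed.
Lemma bounded_alpha z A : bounded_op A -> bounded_op (alpha z A).
Proof. by move=> /bounded_opbd[M /(opbd_alpha z)/opbd_bounded]. Qed.

Lemma fock_inner_weyl_adj z f g : L2 f -> L2 g ->
  fock_inner (weyl z f) g = fock_inner f (weyl (- z) g).
Proof.
move=> Lf Lg; have [cf _] := Lf; have [cg _] := Lg.
rewrite !fock_innerE //; try exact: L2_weyl.
rewrite rip_weyl_adj // -weylZ rip_weyl_adj //.
by case: (L2Z 'i Lg).
Qed.

(** The Weyl operator of -z sends k_w to a unimodular multiple of k_(w-z); the phase occurs once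
    plainly and once conjugated. *)
Lemma berezin_alpha z w A : bounded_op A -> berezin (alpha z A) w = berezin A (w - z).
Proof.
move=> /bounded_opbd[M bA]; have Fk := in_fock_kz w; have Fwk := fock_weyl (- z) Fk.
have Fd := in_fock_kz (w - z).
rewrite /berezin /alpha fock_inner_weyl_adj; last exact: fockL2; last first.
  by apply: fockL2; apply: opbd_fock bA _.
have -> : weyl (- z) (kz w) = fun x => wphase (- z) w * kz (w - z) x.
  by rewrite kz_weyl weyl_weyl addrC -kz_weyl.
rewrite /weyl_adj (_ : weyl (- z) (kz w) = fun x => wphase (- z) w * kz (w - z) x); last first.
  by rewrite kz_weyl weyl_weyl addrC -kz_weyl.
have LA := fockL2 (opbd_fock bA Fd); have Ld := fockL2 Fd.
rewrite (opbdZ _ bA) // fock_innerZl //; last exact: L2Z.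
by rewrite fock_innerZr // mulrA mul_conj cabs_wphase expr1n mul1r.
Qed.

(** The phases produced on the left and on the right of [A] are inverse to each other, so [alpha] is
    a true action of the additive group, in particular commutative. The phase is pulled through [A]
    by linearity, which holds on Fock functions. *)
Lemma alpha_alpha z w A f : bounded_op A -> in_fock f -> alpha z (alpha w A) f = alpha (z + w) A f.
Proof.
move=> /bounded_opbd[M bA] Ff; rewrite /alpha /weyl_adj !weyl_weyl -opprD [w + z]addrC.
rewrite (opbdZ _ bA); last exact: fock_weyl.
rewrite weylZ; apply/funext => x; rewrite mulrA -[RHS]mul1r; congr (_ * _).
rewrite /wphase -cexpD dotcNl dotcNr opprK (dotcC w z) Im_conj.
rewrite -[RHS](cexp0 R); congr cexp; apply: eqReIm; rewrite ?ReD ?ImD /=; ring.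
Qed.
Lemma alpha0 A : alpha 0 A = A.
Proof. by apply/funext => f; rewrite /alpha /weyl_adj oppr0 !weyl0. Qed.

Lemma dle_tri A B T (K L : R) : bounded_op A -> bounded_op B -> bounded_op T ->
  op_dist_le A B K -> op_dist_le B T L -> op_dist_le A T (K + L).
Proof.
move=> bA bB bT h1 h2 f Ff; rewrite mulrDl.
apply: le_trans (fock_norm_tri (bounded_L2 bA Ff) (bounded_L2 bB Ff) (bounded_L2 bT Ff)) _.
by apply: lerD; [exact: h1 | exact: h2].
Qed.
Lemma dle_sym A B (K : R) : bounded_op A -> bounded_op B -> op_dist_le A B K -> op_dist_le B A K.
Proof.
move=> bA bB h f Ff; rewrite fock_norm_distC; [exact: h | exact: bounded_L2 | exact: bounded_L2].
Qed.
Lemma dle_le A B (K L : R) : K <= L -> op_dist_le A B K -> op_dist_le A B L.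
Proof. by move=> KL h f Ff; apply: le_trans (h f Ff) _; rewrite ler_wpM2r ?fock_norm_ge0. Qed.
Lemma dle_alpha z A B (K : R) : bounded_op A -> bounded_op B ->
  op_dist_le A B K -> op_dist_le (alpha z A) (alpha z B) K.
Proof.
move=> bA bB h f Ff; have Fw := fock_weyl (- z) Ff; rewrite /alpha -weylB.
have [cf _] := fockL2 Ff; have [c1 _] := L2B (bounded_L2 bA Fw) (bounded_L2 bB Fw).
by rewrite fock_norm_weyl // -(fock_norm_weyl (- z) cf); exact: h.
Qed.
(** Identities such as [alpha_alpha] hold on Fock functions and are not equalities of maps; this is
    how they are used where a rewrite would be expected. *)
Lemma dle_eq A A' B B' (K : R) : (forall f, in_fock f -> A f = A' f) -> (forall f, in_fock f -> B f = B' f) ->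
  op_dist_le A B K -> op_dist_le A' B' K.
Proof. by move=> eA eB h f Ff; rewrite -eA // -eB //; exact: h. Qed.
Lemma dle_refl A (K : R) : 0 <= K -> op_dist_le A A K.
Proof.
move=> K0 f Ff; under [X in fock_norm X <= _]eq_fun do rewrite subrr.
by rewrite fock_norm0 mulr_ge0 // fock_norm_ge0.
Qed.

Lemma dle_alpha_add a b S (K L : R) : bounded_op S ->
  op_dist_le (alpha a S) S K -> op_dist_le (alpha b S) S L -> op_dist_le (alpha (a + b) S) S (K + L).
Proof.
move=> bS h1 h2; rewrite (addrC K); have ba := bounded_alpha a bS; have bb := bounded_alpha b bS.
apply: (@dle_tri _ (alpha a S)) => //; first exact: bounded_alpha.
apply: dle_eq (dle_alpha a bb bS h2) => // f Ff; exact: alpha_alpha.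
Qed.
Lemma dle_alpha_sum (I : Type) (s : seq I) (h : I -> V) (K : I -> R) S : bounded_op S ->
  (forall i, op_dist_le (alpha (h i) S) S (K i)) ->
  op_dist_le (alpha (\sum_(i <- s) h i) S) S (\sum_(i <- s) K i).
Proof.
move=> bS H; elim: s => [|i s IH]; last by rewrite !big_cons; exact: dle_alpha_add.
by rewrite !big_nil alpha0; exact: dle_refl.
Qed.

(** For a group acting by isometries, continuity of an orbit map at 0 implies continuity everywhere,
    with the same modulus. *)
Lemma CbuP S : Cbu S <-> bounded_op S /\ forall e : R, 0 < e -> exists2 d : R, 0 < d &
  forall h, sqn h < d -> op_dist_le (alpha h S) S e.
Proof.
split=> -[bS H]; split => //.
  move=> e /(H 0)[d d0 Hd]; exists d => // h hd; have := Hd h; rewrite subr0 => /(_ hd).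
  by rewrite -[X in op_dist_le _ X _ -> _]/(alpha 0 S) alpha0.
move=> z e /H[d d0 Hd]; exists d => // z' hz.
rewrite -[X in op_dist_le X _ _]/(alpha z' S) -[X in op_dist_le _ X _]/(alpha z S).
have := dle_alpha z (bounded_alpha (z' - z) bS) bS (Hd _ hz).
by apply: dle_eq => // f Ff; rewrite alpha_alpha // addrC subrK.
Qed.

Lemma Cbu_closed S : bounded_op S ->
  (forall e : R, 0 < e -> exists2 T, Cbu T & op_dist_le S T e) -> Cbu S.
Proof.
move=> bS H; apply/CbuP; split => // e e0; have e3 : 0 < e / 3 by rewrite divr_gt0.
have [T /CbuP[bT /(_ _ e3)[d d0 Hd]] ST] := H _ e3; exists d => // h /Hd hT.
have -> : e = e / 3 + (e / 3 + e / 3) by field.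
have bh := bounded_alpha h bS; have bhT := bounded_alpha h bT.
apply: (dle_tri bh bhT bS); first exact: dle_alpha.
by apply: (dle_tri bhT bT bS) => //; exact: dle_sym.
Qed.

Lemma ccont_conj f : ccont f -> ccont (fun w => (f w)^*).
Proof.
move=> cf z e e0; have [d d0 H] := cf z e e0; exists d => // w /H.
by rewrite -conjN -conjD cabs_conj.
Qed.
Lemma ccont_sqn : ccont (fun w : V => (sqn w)%:C : C).
Proof.
have -> : (fun w : V => (sqn w)%:C : C) = fun w => \sum_(i < n) w 0 i * (w 0 i)^*.
  apply/funext => w; rewrite /sqn (big_morph (real_complex R) (@realCD R) (realC0 R)).
  by apply: eq_bigr => i _; rewrite mul_conj.
apply: (@ccont_sum R n _ _ _ (fun i w => w 0 i * (w 0 i)^*)) => i.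
by apply: ccontM; [|apply: ccont_conj]; exact: ccont_coord.
Qed.

(** The squared distance of k_w and k_z is 2 - 2 Re <k_z, k_w>, and by the reproducing property the
    inner product has the real part of the explicit continuous function [G]. *)
Lemma kz_cont z (e : R) : 0 < e -> exists2 d : R, 0 < d &
  forall w, sqn (w - z) < d -> fock_norm (fun x => kz w x - kz z x) <= e.
Proof.
move=> e0; pose G w : C := cexp ((- (pi / 2))%:C * (sqn w)%:C) * kz z w.
have cG : ccont G.
  apply: ccontM; last by have /entireP[] := @entire_kz R n z.
  by apply: ccont_cexp; apply: ccontM; [exact: ccont_cst | exact: ccont_sqn].
have GE w : Re (G w) = rip (kz z) (kz w).
  have [-> _] := rip_kz w (in_fock_kz z); rewrite /G -realCM ReM /= sin0 mulr0 mul0r subr0 cos0 mulr1.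
  by rewrite mulNr.
have Lk w := fockL2 (in_fock_kz w : in_fock (kz w : V -> C)).
have kk w : rip (kz w) (kz w) = 1.
  by have [c _] := Lk w; rewrite -fock_norm_sq // fock_norm_kz expr1n.
have [d d0 Hd] := cG z (e ^+ 2 / 2) (divr_gt0 (exprn_gt0 2 e0) (ltr0n _ 2)).
exists d => // w /Hd; have [cB _] := L2B (Lk w) (Lk z).
move=> hw; have : `|Re (G w) - Re (G z)| < e ^+ 2 / 2.
  by apply: le_lt_trans hw; rewrite -ReN -ReD Re_le_cabs.
rewrite !GE kk ltr_norml => /andP[h1 _].
rewrite -(@ler_pXn2r _ 2) ?nnegrE ?fock_norm_ge0 ?(ltW e0) // fock_norm_sq //.
rewrite (ripBl (Lk w) (Lk z) (L2B (Lk w) (Lk z))) (ripBr (Lk w) (Lk z) (Lk w)) (ripBr (Lk w) (Lk z) (Lk z)).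
rewrite !kk (ripC (kz w)); lra.
Qed.

Lemma ccont_berezin A : bounded_op A -> ccont (berezin A).
Proof.
move=> /bounded_opbd[M bA] z e e0; have M0 : 0 <= M by case: bA.
have K0 : 0 < 4 * M + 1 by rewrite ltr_wpDl // mulr_ge0.
have [d d0 Hd] := kz_cont z (divr_gt0 e0 K0).
exists d => // w /Hd h; have Fw := in_fock_kz w; have Fz := in_fock_kz z.
have Lw := fockL2 Fw; have Lz := fockL2 Fz.
have LAw := fockL2 (opbd_fock bA Fw); have LAz := fockL2 (opbd_fock bA Fz).
have -> : berezin A w - berezin A z = fock_inner (A (fun x => kz w x - kz z x)) (kz w) +
   fock_inner (A (kz z)) (fun x => kz w x - kz z x).
  by rewrite (opbdB bA) // fock_innerBl // fock_innerBr // addrA subrK.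
have FB := in_fockB Fw Fz.
have b1 := opbd_inner bA FB Fw; have b2 := opbd_inner bA Fz FB.
rewrite fock_norm_kz mulr1 in b1; rewrite fock_norm_kz mul1r in b2.
apply: le_lt_trans (cabsD _ _) _; apply: le_lt_trans (lerD b1 b2) _.
have [->|Mn] := eqVneq M 0; first by rewrite !mulr0 addr0.
have Mp : 0 < M by rewrite lt_def Mn.
apply: (@le_lt_trans _ _ (4 * M * (e / (4 * M + 1)))).
  have : 2 * fock_norm (fun x => kz w x - kz z x) * M <= 2 * (e / (4 * M + 1)) * M.
    by rewrite ler_wpM2r // ler_wpM2l.
  by lra.
by rewrite mulrA ltr_pdivrMr // mulrC ltr_pM2l // ltrDl.
Qed.
End Covariance.

(** * Lipschitz continuity of translations on W^{2,oo} *)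

Section Regularity.
Variables (R : realType) (n : nat).
Local Notation C := R[i].
Local Notation V := (Cn R n).
Local Notation op := (op R n).
Implicit Types (F G : V -> C) (f g : V -> C) (z w a v : V) (A B S T : op).

Lemma has_rderivD F G z v (l m : C) : has_rderiv F z v l -> has_rderiv G z v m ->
  has_rderiv (fun w => F w + G w) z v (l + m).
Proof.
move=> dF dG e e0; have e2 : 0 < e / 2 by rewrite divr_gt0.
have [d1 d10 H1] := dF _ e2; have [d2 d20 H2] := dG _ e2.
exists (Num.min d1 d2); first by rewrite lt_min d10.
move=> t /andP[t0]; rewrite lt_min => /andP[t1 t2].
have := H1 t; rewrite t0 t1 => /(_ isT) h1; have := H2 t; rewrite t0 t2 => /(_ isT) h2.
have -> : forall p q r s u : C, (p + q - (r + s)) / u - (l + m) = ((p - r) / u - l) + ((q - s) / u - m).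
  by move=> p q r s u; ring.
apply: le_lt_trans (cabsD _ _) _; lra.
Qed.
Lemma has_rderivZ (c : C) F z v (l : C) : has_rderiv F z v l -> has_rderiv (fun w => c * F w) z v (c * l).
Proof.
move=> dF e e0; have c0 : 0 < cabs c + 1 by rewrite ltr_wpDl // cabs_ge0.
have [d d0 H] := dF _ (divr_gt0 e0 c0); exists d => // t /H.
have -> : (c * F (z + t%:C *: v) - c * F z) / t%:C - c * l = c * ((F (z + t%:C *: v) - F z) / t%:C - l) by ring.
rewrite cabsM ltr_pdivlMr // mulrDr mulr1 mulrC; have := cabs_ge0 ((F (z + t%:C *: v) - F z) / t%:C - l); lra.
Qed.
Lemma has_rderiv_reflect F a z v (l : C) : has_rderiv F (a - z) v l ->
  has_rderiv (fun w => F (a - w)) z v (- l).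
Proof.
move=> dF e /dF[d d0 H]; exists d => // t td; have := H (- t); rewrite normrN => /(_ td).
rewrite realCN scaleNr -addrA -opprD invrN mulrN -[X in cabs X]opprB opprK addrC cabsN.
by rewrite opprK [l + _]addrC [- _ + a]addrC.
Qed.

Lemma laplacian_isD F F' G G' : laplacian_is F F' -> laplacian_is G G' ->
  laplacian_is (fun w => F w + G w) (fun w => F' w + G' w).
Proof.
move=> [Dx [Dy [Dxx [Dyy [h1 [h2 [h3 [h4 h5]]]]]]]] [Ex [Ey [Exx [Eyy [k1 [k2 [k3 [k4 k5]]]]]]]].
exists (fun i w => Dx i w + Ex i w), (fun i w => Dy i w + Ey i w),
  (fun i w => Dxx i w + Exx i w), (fun i w => Dyy i w + Eyy i w).
split=> [i z|]; first exact: has_rderivD.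
split=> [i z|]; first exact: has_rderivD.
split=> [i z|]; first exact: has_rderivD.
split=> [i z|z]; first exact: has_rderivD.
rewrite h5 k5 -mulrDr -big_split /=; congr (_ * _); apply: eq_bigr => i _; ring.
Qed.
Lemma laplacian_isZ (c : C) F F' : laplacian_is F F' -> laplacian_is (fun w => c * F w) (fun w => c * F' w).
Proof.
move=> [Dx [Dy [Dxx [Dyy [h1 [h2 [h3 [h4 h5]]]]]]]].
exists (fun i w => c * Dx i w), (fun i w => c * Dy i w),
  (fun i w => c * Dxx i w), (fun i w => c * Dyy i w).
split=> [i z|]; first exact: has_rderivZ.
split=> [i z|]; first exact: has_rderivZ.
split=> [i z|]; first exact: has_rderivZ.
split=> [i z|z]; first exact: has_rderivZ.
rewrite h5 mulrCA; congr (_ * _); rewrite mulr_sumr; apply: eq_bigr => i _; ring.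
Qed.
(** By [berezin_alpha] the Berezin value of a translate at p, as a function of the translation w, is
    B(S)(p - w). First derivatives change sign under this reflection, second derivatives do not. *)
Lemma laplacian_is_reflect a F F' : laplacian_is F F' -> laplacian_is (fun w => F (a - w)) (fun w => F' (a - w)).
Proof.
move=> [Dx [Dy [Dxx [Dyy [h1 [h2 [h3 [h4 h5]]]]]]]].
exists (fun i w => - Dx i (a - w)), (fun i w => - Dy i (a - w)),
  (fun i w => Dxx i (a - w)), (fun i w => Dyy i (a - w)).
have NN G z v (l : C) : has_rderiv G (a - z) v l -> has_rderiv (fun w => - G (a - w)) z v l.
  move=> /has_rderiv_reflect/(has_rderivZ (-1)); rewrite mulN1r opprK.
  by under eq_fun do rewrite mulN1r.
split=> [i z|]; first exact: has_rderiv_reflect.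
split=> [i z|]; first exact: has_rderiv_reflect.
split=> [i z|]; first exact: NN.
by split=> [i z|z]; first exact: NN.
Qed.
Lemma laplacian_is0 : laplacian_is (fun _ : V => 0 : C) (fun=> 0).
Proof.
have d0 z v : has_rderiv (fun _ : V => 0 : C) z v 0.
  by move=> e e0; exists 1 => // t _; rewrite subrr mul0r subr0 cabs0.
exists (fun _ _ => 0), (fun _ _ => 0), (fun _ _ => 0), (fun _ _ => 0).
do 4 split => //; by rewrite big1 ?mulr0 // => i _; rewrite addr0.
Qed.
Lemma laplacian_is_sum (I : Type) (s : seq I) (F F' : I -> V -> C) : (forall i, laplacian_is (F i) (F' i)) ->
  laplacian_is (fun w => \sum_(i <- s) F i w) (fun w => \sum_(i <- s) F' i w).
Proof.
move=> H; elim: s => [|i s IH].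
  by under eq_fun do rewrite big_nil; under [X in laplacian_is _ X]eq_fun do rewrite big_nil; exact: laplacian_is0.
under eq_fun do rewrite big_cons; under [X in laplacian_is _ X]eq_fun do rewrite big_cons.
exact: laplacian_isD.
Qed.

Lemma opbdB_op A B (K L : R) : opbd A K -> opbd B L -> opbd (fun f w => A f w - B f w) (K + L).
Proof.
move=> bA bB; split; last 2 first.
- by rewrite addr_ge0 //; [case: bA | case: bB].
- move=> f Ff; rewrite mulrDl.
  apply: le_trans (fock_normB (fockL2 (opbd_fock bA Ff)) (fockL2 (opbd_fock bB Ff))) _.
  by apply: lerD; apply: opbd_le.
- by move=> f Ff; apply: in_fockB; [exact: opbd_fock bA Ff | exact: opbd_fock bB Ff].
- move=> c f g Ff Fg; rewrite (opbd_comb c bA) // (opbd_comb c bB) //.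
  by apply/funext => w; ring.
Qed.

(** Duality: test with f normalized and with (A - B) f normalized, for which the real form returns
    the norm. *)
Lemma dle_rip A B (K : R) : bounded_op A -> bounded_op B -> 0 <= K ->
  (forall f g, in_fock f -> in_fock g -> fock_norm f <= 1 -> fock_norm g <= 1 ->
     rip (A f) g - rip (B f) g <= K) -> op_dist_le A B K.
Proof.
move=> /bounded_opbd[M bA] /bounded_opbd[N bB] K0 H f Ff.
have bD := opbdB_op bA bB; pose D : op := fun f w => A f w - B f w.
rewrite -[X in fock_norm X]/(D f); have FD := opbd_fock bD Ff : in_fock (D f).
have f0 := fock_norm_ge0 f; have [Df|Dn] := eqVneq (fock_norm (D f)) 0.
  by rewrite Df mulr_ge0.
have D0 : 0 < fock_norm (D f) by rewrite lt_def Dn fock_norm_ge0.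
have fp : 0 < fock_norm f.
  rewrite lt_def f0 andbT; apply: contra_neq Dn => fn.
  apply/eqP; rewrite eq_le fock_norm_ge0 andbT; have := opbd_le bD Ff; by rewrite fn mulr0.
pose a := (fock_norm f)^-1; pose b := (fock_norm (D f))^-1.
have na : fock_norm (fun w => a%:C * f w) = 1.
  by rewrite (fock_normZ _ (fockL2 Ff)) cabs_real ger0_norm ?invr_ge0 // mulVf // gt_eqF.
have nb : fock_norm (fun w => b%:C * D f w) = 1.
  by rewrite (fock_normZ _ (fockL2 FD)) cabs_real ger0_norm ?invr_ge0 ?fock_norm_ge0 // mulVf // gt_eqF.
have Fa := in_fockZ a%:C Ff; have Fb := in_fockZ b%:C FD.
have := H _ _ Fa Fb; rewrite na nb lexx => /(_ isT isT).
rewrite -ripBl; [|exact: fockL2 (opbd_fock bA Fa)|exact: fockL2 (opbd_fock bB Fa)|exact: fockL2].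
have E : (fun w => A (fun w => a%:C * f w) w - B (fun w => a%:C * f w) w) = fun w => a%:C * D f w.
  exact: opbdZ bD Ff.
have LD := fockL2 FD; have [cD _] := LD; rewrite E.
rewrite (ripZl _ LD (L2Z _ LD)) (ripZr _ LD LD) -fock_norm_sq //.
rewrite expr2 (mulrA b) /b mulVf ?mul1r; last by rewrite gt_eqF.
by rewrite /a mulrC ler_pdivrMr.
Qed.

Lemma Re_fock_inner f g : in_fock f -> in_fock g -> Re (fock_inner f g) = rip f g.
Proof. by move=> Ff Fg; rewrite fock_innerE //; exact: fockL2. Qed.

Lemma close_osc (p q x y m c e : R) :
  - m <= q - y -> p - x <= m -> m + m <= e -> x - y <= c -> p - q <= c + e.
Proof. lra. Qed.

(** For fixed f and g of norm at most 1, one finite combination [Fs] of Berezin values serves all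
    translates of both [S] and [T]. It is scalar, its Laplacian for [S] is its value for [T], and
    [laplacian_osc] applies. Since [K] depends neither on the combination nor on f and g, the error
    can be sent to 0. *)
Lemma W2inf_osc S : W2inf S -> exists2 K : R, 0 <= K & forall b i (t : R), 0 <= t <= 1 ->
  op_dist_le (alpha (t%:C *: rdir R b i) S) (alpha (- (t%:C *: rdir R b i)) S) (t * K).
Proof.
move=> [bS [T [bT lST]]].
have [M oS] := bounded_opbd bS; have [N oT] := bounded_opbd bT.
have M0 : 0 <= M by case: oS. have N0 : 0 <= N by case: oT.
(* The 3 is 2 + 1: a matrix coefficient at vectors of norm at most 1 is bounded by 2M, and its
   approximation differs from it by at most M because d <= 1; likewise for N. *)
pose K := 2 * (n + n)%:R * (3 * M) + (4 * (3 * N) + 1).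
have K0 : 0 <= K by rewrite /K !(addr_ge0, mulr_ge0).
exists K => // b i t t01; have t0 : 0 <= t by case/andP: t01.
apply: dle_rip; rewrite ?mulr_ge0 //; try exact: bounded_alpha.
move=> f g Ff Fg nf ng.
have fg1 : fock_norm f * fock_norm g <= 1 by rewrite -[leRHS]mulr1; apply: ler_pM; rewrite ?fock_norm_ge0.
apply/ler_addgt0Pr => e e0.
(* The approximation error d M is paid twice, at the two opposite translations; this choice keeps
   the total below [e]. *)
pose d := Num.min 1 (e / (2 * M + 1)).
have M1 : 0 < 2 * M + 1 by rewrite ltr_wpDl // mulr_ge0.
have d0 : 0 < d by rewrite lt_min ltr01 divr_gt0.
have d1 : d <= 1 by rewrite ge_min lexx.
have dM : d * M + d * M <= e.
  have : d * (2 * M + 1) <= e by rewrite -ler_pdivlMr // ge_min lexx orbT.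
  by rewrite mulrDr mulr1; lra.
have [s Hs] := appr_mel Ff Fg d0.
pose Fs A w : C := \sum_(p <- s) p.1 * berezin A (p.2 - w).
have FsE A w L : opbd A L -> cabs (mel f g (alpha w A) - Fs A w) <= d * L.
  move=> oA; have := Hs _ _ (opbd_alpha w oA).
  by under eq_bigr do rewrite (berezin_alpha _ _ (opbd_bounded oA)).
have Fsb A w L : opbd A L -> cabs (Fs A w) <= 3 * L.
  move=> oA; have L0 : 0 <= L by case: oA.
  have h1 := FsE A w L oA; have h2 := opbd_inner (opbd_alpha w oA) Ff Fg.
  have h3 : 2 * (fock_norm f * fock_norm g) * L <= 2 * L by rewrite ler_wpM2r // -[leRHS]mulr1 ler_wpM2l.
  have h4 : d * L <= L by rewrite ler_piMl.
  have := cabsBD (mel f g (alpha w A)) (mel f g (alpha w A) - Fs A w).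
  rewrite opprB addrC subrK; rewrite /mel in h1 h2 *; lra.
have lF : laplacian_is (Fs S) (Fs T).
  apply: (@laplacian_is_sum _ s (fun p w => p.1 * berezin S (p.2 - w)) (fun p w => p.1 * berezin T (p.2 - w))) => p.
  by apply: laplacian_isZ; exact: laplacian_is_reflect.
have cF : ccont (Fs S).
  apply: (@ccont_sum R n _ s xpredT (fun p w => p.1 * berezin S (p.2 - w))) => p.
  apply: ccontM; first exact: ccont_cst.
  apply: (@ccont_comp R n _ (fun w => p.2 - w) 1 ltr01); last exact: ccont_berezin.
  by move=> z w; rewrite mul1r opprB addrC addrA subrK -sqnN opprB.
have := laplacian_osc lF cF (fun z => Fsb _ z _ oS) (fun z => Fsb _ z _ oT) b i 0 t01.
rewrite add0r sub0r -/K.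
have oa w := opbd_fock (opbd_alpha w oS) Ff.
rewrite -!Re_fock_inner // -/(mel f g (alpha _ S)) -/(mel f g (alpha _ S)).
set z := t%:C *: _; have := FsE S z M oS; have := FsE S (- z) M oS.
move=> /(le_trans (Re_le_cabs _)); rewrite ReD ReN ler_norml => /andP[h1 h2].
move=> /(le_trans (Re_le_cabs _)); rewrite ReD ReN ler_norml => /andP[h3 h4].
by move=> h5; exact: close_osc h1 h4 dM h5.
Qed.

(** Translating the symmetric estimate between u and -u by u compares 2u with 0, and translating it
    by -u compares -2u with 0; hence the half step s/2. *)
Lemma W2inf_lip S : W2inf S -> exists2 K : R, 0 <= K & forall b i (t : R), `|t| <= 1 ->
  op_dist_le (alpha (t%:C *: rdir R b i) S) S (`|t| * K).
Proof.
move=> wS; have [bS _] := wS; have [K K0 H] := W2inf_osc wS; exists K => // b i t t1.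
have pos s : 0 <= s <= 1 -> op_dist_le (alpha (s%:C *: rdir R b i) S) S (s * K) /\
    op_dist_le (alpha (- (s%:C *: rdir R b i)) S) S (s * K).
  move=> /andP[s0 s1]; pose u := (s / 2)%:C *: rdir R b i.
  have uu : u + u = s%:C *: rdir R b i by rewrite /u -scalerDl -realCD -splitr.
  have s2 : 0 <= s / 2 <= 1 by rewrite divr_ge0 //= ler_pdivrMr //; lra.
  have h := H b i _ s2; rewrite -/u in h.
  have ba := bounded_alpha u bS; have bb := bounded_alpha (- u) bS.
  have sK : s / 2 * K <= s * K by rewrite ler_wpM2r //; lra.
  split.
    have := dle_alpha u ba bb h; rewrite -uu => h1; apply: dle_le sK _; apply: dle_eq h1 => f Ff.
      exact: alpha_alpha.
    by rewrite alpha_alpha // subrr alpha0.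
  have := dle_alpha (- u) bb ba (dle_sym ba bb h); rewrite -uu => h1; apply: dle_le sK _; apply: dle_eq h1 => f Ff.
    by rewrite alpha_alpha // opprD.
  by rewrite alpha_alpha // addNr alpha0.
have [t0|t0] := leP 0 t.
  by have := pos t; rewrite ger0_norm // in t1 *; rewrite t0 t1 => /(_ isT)[].
have := pos (- t); rewrite ltr0_norm // in t1 *; rewrite oppr_ge0 (ltW t0) t1 => /(_ isT)[_].
by rewrite realCN scaleNr opprK.
Qed.

Lemma rdir_sum (h : V) : h = \sum_(p : bool * 'I_n) (if p.1 then Im (h 0 p.2) else Re (h 0 p.2))%:C *: rdir R p.1 p.2.
Proof.
apply/(@rowP C n) => j; rewrite summxE.
rewrite -(pair_bigA _ (fun b i => ((if b then Im (h 0 i) else Re (h 0 i))%:C *: rdir R b i) 0 j)) /=.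
rewrite (eq_bigr (fun b : bool => (if b then Im (h 0 j) else Re (h 0 j))%:C * (if b then 'i else 1))); last first.
  move=> b _; rewrite (bigD1 j) //= big1 ?addr0; first by rewrite mxE rdirE eqxx.
  by move=> i ij; rewrite mxE rdirE eq_sym (negbTE ij) mulr0.
rewrite big_bool /=; apply: eqReIm; rewrite !ReImE; ring.
Qed.

(** A displacement is the sum of its 2n components along the real axes, each no longer than the
    displacement, and by the group law the Lipschitz bounds add up. *)
Lemma W2inf_Cbu S : W2inf S -> Cbu S.
Proof.
move=> wS; have [bS _] := wS; have [K K0 H] := W2inf_lip wS; apply/CbuP; split => // e e0.
pose L := (n + n)%:R * K + 1; have L0 : 0 < L by rewrite ltr_wpDl // mulr_ge0.
pose d := Num.min 1 (e / L); have d0 : 0 < d by rewrite lt_min ltr01 divr_gt0.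
have d1 : d <= 1 by rewrite ge_min lexx.
exists (d ^+ 2); first by rewrite exprn_gt0.
move=> h hd; pose c (p : bool * 'I_n) : R := if p.1 then Im (h 0 p.2) else Re (h 0 p.2).
have cd p : `|c p| <= d.
  apply: (@le_trans _ _ (cabs (h 0 p.2))).
    by rewrite /c; case: p.1; [exact: Im_le_cabs | exact: Re_le_cabs].
  rewrite -(@ler_pXn2r _ 2) ?nnegrE ?cabs_ge0 ?(ltW d0) //.
  exact: le_trans (coord_le_sqn _ _) (ltW hd).
rewrite (rdir_sum h).
have := @dle_alpha_sum R n _ (index_enum _) (fun p : bool * 'I_n => (c p)%:C *: rdir R p.1 p.2) (fun p => d * K) S bS.
move=> Hsum; apply: dle_le (Hsum _) => [|p]; last first.
  apply: dle_le (H p.1 p.2 (c p) _); last exact: le_trans (cd p) d1.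
  by rewrite ler_wpM2r.
rewrite sumr_const card_prod card_bool card_ord mul2n -addnn.
have dL : d * L <= e by rewrite -ler_pdivlMr // ge_min lexx orbT.
apply: le_trans dL; rewrite -mulr_natl /L mulrDr mulr1 mulrCA lerDl; exact: ltW.
Qed.
End Regularity.

(** * Smoothing by averages *)

Section Averages.
Variables (R : realType) (n : nat).
Local Notation C := R[i].
Local Notation V := (Cn R n).
Local Notation op := (op R n).
Implicit Types (f g : V -> C) (z w a d e : V) (A B S T : op).

Definition oplin A (c : C) B : op := fun f w => A f w + c * B f w.
Definition opsum (m : nat) (c : R) (A : nat -> op) : op := fun f w => \sum_(k < m) c%:C * A k f w.

Lemma opsumS m c (A : nat -> op) : opsum m.+1 c A = oplin (opsum m c A) c%:C (A m).
Proof. by apply/funext => f; apply/funext => w; rewrite /opsum big_ord_recr. Qed.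
Lemma opsum0 c (A : nat -> op) : opsum 0 c A = fun _ _ => 0.
Proof. by apply/funext => f; apply/funext => w; rewrite /opsum big_ord0. Qed.

Lemma bounded_op0 : bounded_op (fun _ _ => 0 : C) (n := n).
Proof.
apply: (@opbd_bounded R n _ 0); split => //.
- by move=> f _; exact: in_fock0.
- by move=> c f g _ _; apply/funext => w; rewrite mulr0 addr0.
- by move=> f _; rewrite fock_norm0 mul0r.
Qed.
Lemma bounded_oplin A c B : bounded_op A -> bounded_op B -> bounded_op (oplin A c B).
Proof.
move=> /bounded_opbd[K bA] /bounded_opbd[L bB]; apply: (@opbd_bounded R n _ (K + cabs c * L)); split.
- by move=> f Ff; apply: in_fockD; [exact: opbd_fock bA Ff | apply: in_fockZ; exact: opbd_fock bB Ff].
- move=> x f g Ff Fg; rewrite /oplin (opbd_comb _ bA) // (opbd_comb _ bB) //.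
  by apply/funext => w; ring.
- by rewrite addr_ge0 ?mulr_ge0 ?cabs_ge0 //; [case: bA | case: bB].
- move=> f Ff; have LB := fockL2 (opbd_fock bB Ff).
  apply: le_trans (fock_normD (fockL2 (opbd_fock bA Ff)) (L2Z c LB)) _.
  rewrite fock_normZ // mulrDl -(mulrA (cabs c)); apply: lerD; first exact: opbd_le.
  by rewrite ler_wpM2l ?cabs_ge0 //; exact: opbd_le.
Qed.
Lemma bounded_opsum m c (A : nat -> op) : (forall k, bounded_op (A k)) -> bounded_op (opsum m c A).
Proof.
move=> bA; elim: m => [|m IH]; first by rewrite opsum0; exact: bounded_op0.
by rewrite opsumS; exact: bounded_oplin.
Qed.
Lemma dle_oplin A A' c B B' (K L : R) : bounded_op A -> bounded_op A' -> bounded_op B -> bounded_op B' ->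
  op_dist_le A A' K -> op_dist_le B B' L -> op_dist_le (oplin A c B) (oplin A' c B') (K + cabs c * L).
Proof.
move=> bA bA' bB bB' h1 h2 f Ff.
have LA := L2B (bounded_L2 bA Ff) (bounded_L2 bA' Ff); have LB := L2B (bounded_L2 bB Ff) (bounded_L2 bB' Ff).
have -> : (fun w => oplin A c B f w - oplin A' c B' f w) = fun w => (A f w - A' f w) + c * (B f w - B' f w).
  by apply/funext => w; rewrite /oplin; ring.
apply: le_trans (fock_normD LA (L2Z c LB)) _; rewrite fock_normZ // mulrDl -(mulrA (cabs c)).
by apply: lerD; [exact: h1 | rewrite ler_wpM2l ?cabs_ge0 //; exact: h2].
Qed.
Lemma dle_opsum m (c K : R) (A B : nat -> op) : 0 <= c -> (forall k, bounded_op (A k)) -> (forall k, bounded_op (B k)) ->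
  (forall k, (k < m)%N -> op_dist_le (A k) (B k) K) -> op_dist_le (opsum m c A) (opsum m c B) (m%:R * (c * K)).
Proof.
move=> c0 bA bB; elim: m => [|m IH] H; first by rewrite !opsum0 mul0r; exact: dle_refl.
rewrite !opsumS -[X in op_dist_le _ _ (X * _)]natr1 mulrDl mul1r.
have -> : c * K = cabs (c%:C : C) * K by rewrite cabs_real ger0_norm.
apply: dle_oplin; try exact: bounded_opsum; try exact: bA; try exact: bB; last exact: H.
by rewrite cabs_real ger0_norm //; apply: IH => k km; apply: H; exact: ltnW.
Qed.

Lemma op_complete (A : nat -> op) : (forall k, bounded_op (A k)) ->
  (forall e : R, 0 < e -> exists N, forall m k, (N <= m)%N -> (N <= k)%N -> op_dist_le (A m) (A k) e) ->
  exists2 B, bounded_op B & forall e : R, 0 < e -> exists N, forall k, (N <= k)%N -> op_dist_le (A k) B e.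
Proof.
move=> bA HC.
have lim f : in_fock f -> exists g, in_fock g /\ fock_cvg (fun k => A k f) g.
  move=> Ff; have [||g Fg cv] := @fock_complete R n (fun k => A k f); last by exists g.
    by move=> k; exact: bounded_fock.
  move=> e e0; have f1 : 0 < fock_norm f + 1 by rewrite ltr_wpDl // fock_norm_ge0.
  have [N HN] := HC (e / (fock_norm f + 1)) (divr_gt0 e0 f1); exists N => m k Nm Nk.
  apply: le_trans (HN m k Nm Nk f Ff) _; rewrite mulrAC ler_pdivrMr // ler_pM2l // lerDl //.
(* Outside the Fock space the value is a dummy, [f] itself. *)
pose B : op := fun f => if pselect (in_fock f) is left Ff then sval (cid (lim f Ff)) else f.
have BP f : in_fock f -> in_fock (B f) /\ fock_cvg (fun k => A k f) (B f).
  by move=> Ff; rewrite /B; case: pselect => // Ff'; case: (cid _).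
have LB f : in_fock f -> L2 (B f) by move=> /BP[/fockL2].
have conv (e : R) : 0 < e -> exists N, forall k, (N <= k)%N -> op_dist_le (A k) B e.
  move=> e0; have [N HN] := HC e e0; exists N => k Nk f Ff.
  apply/ler_addgt0Pr => r r0; have [_ /(_ _ r0)[N2 H2]] := BP f Ff.
  have := HN k (maxn N N2) Nk (leq_maxl _ _) f Ff; have := H2 _ (leq_maxr N N2).
  have := fock_norm_tri (bounded_L2 (bA k) Ff) (bounded_L2 (bA (maxn N N2)) Ff) (LB f Ff); lra.
have pt f w : in_fock f -> forall e : R, 0 < e -> exists N, forall k, (N <= k)%N -> cabs (A k f w - B f w) <= e.
  move=> Ff e e0; pose E : R := 2 * expR (pi / 2 * sqn w).
  have E0 : 0 < E by rewrite mulr_gt0 // expR_gt0.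
  have [FB /(_ _ (divr_gt0 e0 E0))[N HN]] := BP f Ff; exists N => k /HN h.
  have := fock_point_le w (in_fockB (bounded_fock (bA k) Ff) FB) => h2; apply: le_trans h2 _.
  by rewrite -/E mulrC -ler_pdivlMr.
exists B => //; split; first by move=> f /BP[].
split; last first.
  have [N HN] := conv 1 ltr01; have [M bM] := bounded_opbd (bA N); exists (M + 1) => f Ff.
  have := HN N (leqnn _) f Ff; have := opbd_le bM Ff.
  have LA := bounded_L2 (bA N) Ff; have := fock_normB LA (L2B LA (LB f Ff)).
  have -> : (fun w => A N f w - (A N f w - B f w)) = B f by apply/funext => w; rewrite opprB addrC subrK.
  rewrite mulrDl; lra.
move=> c f g Ff Fg; apply/funext => w; have Fc := in_fockD (in_fockZ c Ff) Fg.
apply: (limit_unique (pt _ w Fc)) => e e0; have c0 : 0 < cabs c + 1 by rewrite ltr_wpDl // cabs_ge0.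
have e2 : 0 < e / 2 by rewrite divr_gt0.
have [N1 H1] := pt f w Ff _ (divr_gt0 e2 c0); have [N2 H2] := pt g w Fg _ e2.
exists (maxn N1 N2) => k; rewrite geq_max => /andP[/H1 h1 /H2 h2].
have [K oA] := bounded_opbd (bA k); rewrite (opbd_comb c oA) //.
have -> : c * A k f w + A k g w - (c * B f w + B g w) = c * (A k f w - B f w) + (A k g w - B g w) by ring.
apply: le_trans (cabsD _ _) _; rewrite cabsM; rewrite ler_pdivlMr // mulrDr mulr1 in h1.
have := cabs_ge0 (A k f w - B f w); lra.
Qed.

Lemma alpha_linear z A c B : alpha z (oplin A c B) = oplin (alpha z A) c (alpha z B).
Proof. by apply/funext => f; rewrite /alpha /oplin weylD weylZ. Qed.
Lemma alpha_opsum z m c (A : nat -> op) : alpha z (opsum m c A) = opsum m c (fun k => alpha z (A k)).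
Proof.
elim: m => [|m IH]; last by rewrite !opsumS alpha_linear IH.
by rewrite !opsum0; apply/funext => f; apply/funext => w; rewrite /alpha /weyl mulr0.
Qed.

(** The sample at the left end k/m of the k-th subinterval; [rsum] is the corresponding Riemann sum
    on [0, 1]. *)
Definition shift_op e S (m k : nat) : op := alpha ((k%:R / m%:R : R)%:C *: e) S.
Definition rsum e S (m : nat) : op := opsum m m%:R^-1 (shift_op e S m).

Lemma bounded_rsum e S m : bounded_op S -> bounded_op (rsum e S m).
Proof. by move=> bS; apply: bounded_opsum => k; exact: bounded_alpha. Qed.

Lemma alpha_diff a b S (K : R) : bounded_op S -> op_dist_le (alpha (b - a) S) S K ->
  op_dist_le (alpha b S) (alpha a S) K.
Proof.
move=> bS h; apply: dle_eq (dle_alpha a (bounded_alpha (b - a) bS) bS h) => // f Ff.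
by rewrite alpha_alpha // addrC subrK.
Qed.

Lemma Cbu_ray S e (r : R) : Cbu S -> 0 < r -> exists2 t : R, 0 < t & forall s : R, `|s| <= t ->
  op_dist_le (alpha (s%:C *: e) S) S r.
Proof.
move=> /CbuP[bS H] r0; have [d d0 Hd] := H r r0; have e1 : 0 < sqn e + 1 by rewrite ltr_wpDl // sqn_ge0.
exists (Num.min 1 (d / (sqn e + 1) / 2)); first by rewrite lt_min ltr01 !divr_gt0.
move=> s; rewrite le_min => /andP[s1 sd]; apply: Hd.
rewrite sqnZ cabs_real; apply: (@le_lt_trans _ _ (`|s| * (sqn e + 1))).
  by apply: ler_pM; rewrite ?exprn_ge0 ?sqn_ge0 ?lerDl // expr2 ler_piMr.
rewrite -ltr_pdivlMr //; apply: le_lt_trans sd _; have := divr_gt0 d0 e1; lra.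
Qed.

Lemma sum_divn (G : nat -> C) N j : (0 < j)%N -> \sum_(l < N * j) G (l %/ j)%N = j%:R * \sum_(k < N) G k.
Proof.
move=> j0; elim: N => [|N IH]; first by rewrite !big_ord0 mulr0.
rewrite big_ord_recr /= mulrDr -IH mulSn addnC big_split_ord /=; congr (_ + _).
rewrite (eq_bigr (fun=> G N)); first by rewrite sumr_const card_ord mulr_natl.
by move=> i _; rewrite divnMDl // divn_small // addn0.
Qed.

(** Repeating each sample [j] times gives the coarse sum the index set of the fine one, so that
    [rsum_close] can compare them term by term. *)
Lemma rsum_refine e S N j : (0 < N)%N -> (0 < j)%N ->
  rsum e S N = opsum (N * j) (N * j)%:R^-1 (fun l => shift_op e S N (l %/ j)).
Proof.
move=> N0 j0; apply/funext => f; apply/funext => w; rewrite /rsum /opsum.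
rewrite (sum_divn (fun k => ((N * j)%:R^-1 : R)%:C * shift_op e S N k f w)) //.
rewrite mulr_sumr; apply: eq_bigr => k _; rewrite mulrA; congr (_ * _).
rewrite -(rmorph_nat (real_complex R)) -realCM; congr (_%:C).
by rewrite natrM invfM mulrCA divff ?mulr1 // pnatr_eq0 -lt0n.
Qed.

Lemma rsum_close e S N j (K t : R) : bounded_op S -> (0 < N)%N -> (0 < j)%N -> N%:R^-1 <= t ->
  (forall s : R, `|s| <= t -> op_dist_le (alpha (s%:C *: e) S) S K) ->
  op_dist_le (rsum e S N) (rsum e S (N * j)) K.
Proof.
move=> bS N0 j0 Nt H; rewrite (rsum_refine e S N0 j0).
have NR : 0 < (N%:R : R) by rewrite ltr0n.
have jR : 0 < (j%:R : R) by rewrite ltr0n.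
have -> : K = (N * j)%:R * ((N * j)%:R^-1 * K).
  by rewrite mulrA divff ?mul1r // pnatr_eq0 -lt0n muln_gt0 N0.
apply: dle_opsum => [|k|k|k km]; try exact: bounded_alpha; first by rewrite invr_ge0.
apply: alpha_diff => //; rewrite -scalerBl -realCB; apply: H.
rewrite distrC.
(* A fine sample point lies less than 1/N to the right of its coarse one. *)
have E : k%:R / (N * j)%:R - (k %/ j)%:R / N%:R = (k %% j)%:R / j%:R / N%:R :> R.
  rewrite {1}(divn_eq k j) natrD !natrM; field.
  by rewrite !gt_eqF.
rewrite E ger0_norm ?divr_ge0 //; apply: le_trans Nt.
rewrite ler_pdivrMr // mulVf ?gt_eqF // ler_pdivrMr // mul1r ler_nat; exact: ltnW (ltn_pmod _ j0).
Qed.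

(* A = \int_0^1 alpha_{s e}(S) ds, as a norm limit of Riemann sums. *)
Definition isavg e S A := bounded_op A /\ forall r : R, 0 < r -> exists N, forall k, (N <= k)%N ->
  (0 < k)%N -> op_dist_le (rsum e S k) A r.

Lemma inv_nat_small (t : R) : 0 < t -> exists N : nat, forall k, (N <= k)%N -> (0 < k)%N -> (k%:R : R)^-1 <= t.
Proof.
move=> t0; exists (Num.trunc t^-1).+1 => k Nk k0.
rewrite -[leRHS]invrK lef_pV2 ?posrE ?invr_gt0 ?ltr0n //.
have /andP[_ /ltW h] := truncn_itv (ltW (eq_ind_r (fun b => is_true b) t0 (invr_gt0 t))).
by apply: le_trans h _; rewrite ler_nat.
Qed.

(** Two Riemann sums are both close to the sum over their common refinement, so the sequence is
    Cauchy; the index is shifted by one to avoid the empty sum. *)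
Lemma isavg_exists e S : Cbu S -> exists A, isavg e S A.
Proof.
move=> cS; have bS : bounded_op S by case: cS.
have [k||A bA HA] := @op_complete (fun k => rsum e S k.+1); first exact: bounded_rsum.
  move=> r r0; have r2 : 0 < r / 2 by rewrite divr_gt0.
  have [t t0 Ht] := Cbu_ray e cS r2; have [N HN] := inv_nat_small t0.
  exists N => m k Nm Nk; have -> : r = r / 2 + r / 2 by rewrite -splitr.
  apply: (@dle_tri _ _ _ (rsum e S (m.+1 * k.+1))); try exact: bounded_rsum.
    by apply: rsum_close Ht => //; apply: HN => //; exact: leqW.
  apply: dle_sym; try exact: bounded_rsum.
  by rewrite mulnC; apply: rsum_close Ht => //; apply: HN => //; exact: leqW.
exists A; split => // r /HA[N HN]; exists N.+1 => -[//|k] Nk _; exact: HN.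
Qed.

Lemma dle_lim A B (K : R) : (forall r : R, 0 < r -> op_dist_le A B (K + r)) -> op_dist_le A B K.
Proof.
move=> H f Ff; apply/ler_addgt0Pr => r r0; have f1 : 0 < fock_norm f + 1 by rewrite ltr_wpDl // fock_norm_ge0.
apply: le_trans (H _ (divr_gt0 r0 f1) f Ff) _; rewrite mulrDl lerD2l.
by rewrite mulrAC ler_pdivrMr // ler_pM2l // lerDl.
Qed.
Lemma isavg_dle e e' S A T B (K : R) : bounded_op S -> bounded_op T -> isavg e S A -> isavg e' T B ->
  (forall k, (0 < k)%N -> op_dist_le (rsum e S k) (rsum e' T k) K) -> op_dist_le A B K.
Proof.
move=> bS bT [bA HA] [bB HB] H; apply: dle_lim => r r0; have r2 : 0 < r / 2 by rewrite divr_gt0.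
have [N1 H1] := HA _ r2; have [N2 H2] := HB _ r2; pose k := (maxn N1 N2).+1.
have h1 := H1 k (leqW (leq_maxl _ _)) isT; have h2 := H2 k (leqW (leq_maxr _ _)) isT.
have -> : K + r = r / 2 + (K + r / 2) by rewrite addrCA -splitr.
have bR := bounded_rsum e k bS; have bR' := bounded_rsum e' k bT.
apply: (dle_tri bA bR bB); first exact: dle_sym.
by apply: (dle_tri bR bR' bB) => //; exact: H.
Qed.
Lemma dle_opavg k (K : R) (A B : nat -> op) : (0 < k)%N -> (forall i, bounded_op (A i)) -> (forall i, bounded_op (B i)) ->
  (forall i, (i < k)%N -> op_dist_le (A i) (B i) K) -> op_dist_le (opsum k k%:R^-1 A) (opsum k k%:R^-1 B) K.
Proof.
move=> k0 bA bB H; have -> : K = k%:R * (k%:R^-1 * K).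
  by rewrite mulrA divff ?mul1r // pnatr_eq0 -lt0n.
by apply: dle_opsum => //; rewrite invr_ge0.
Qed.
Lemma isavg_mono e S T A B (K : R) : bounded_op S -> bounded_op T -> isavg e S A -> isavg e T B ->
  op_dist_le S T K -> op_dist_le A B K.
Proof.
move=> bS bT aA aB H; apply: (isavg_dle bS bT aA aB) => k k0.
by apply: dle_opavg => // i; [exact: bounded_alpha | exact: bounded_alpha | move=> _; exact: dle_alpha].
Qed.
Lemma opsum_cst k (c : R) S : opsum k c (fun=> S) = fun f w => (k%:R * c)%:C * S f w.
Proof.
apply/funext => f; apply/funext => w; rewrite /opsum sumr_const card_ord.
rewrite -[_ *+ k]mulr_natl mulrA.
by rewrite -(rmorph_nat (real_complex R)) -realCM.
Qed.
Lemma opsum_avg_cst k S : (0 < k)%N -> opsum k k%:R^-1 (fun=> S) = S.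
Proof.
move=> k0; rewrite opsum_cst divff ?pnatr_eq0 -?lt0n //.
by apply/funext => f; apply/funext => w; rewrite mul1r.
Qed.
(** [S] is its own average in direction 0, so the claim reduces to comparing two averages sample by
    sample. *)
Lemma isavg_close e S A (K : R) : bounded_op S -> isavg e S A ->
  (forall s : R, 0 <= s <= 1 -> op_dist_le (alpha (s%:C *: e) S) S K) -> op_dist_le A S K.
Proof.
move=> bS aA H.
have a0 : isavg 0 S S.
  split=> // r r0; exists 0%N => k _ k0; rewrite /rsum.
  have -> : shift_op 0 S k = fun=> S by apply/funext => i; rewrite /shift_op scaler0 alpha0.
  rewrite opsum_avg_cst //; apply: dle_refl; exact: ltW.
apply: (isavg_dle bS bS aA a0) => k k0.
apply: dle_opavg => // i; try exact: bounded_alpha.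
move=> ik; rewrite /shift_op scaler0 alpha0; apply: H.
have kR : 0 < (k%:R : R) by rewrite ltr0n.
by rewrite divr_ge0 // ler_pdivrMr // mul1r ler_nat ltnW.
Qed.
Lemma isavg_linear e S T A B c : isavg e S A -> isavg e T B -> bounded_op S -> bounded_op T ->
  isavg e (oplin S c T) (oplin A c B).
Proof.
move=> [bA HA] [bB HB] bS bT; split; first exact: bounded_oplin.
move=> r r0; have c0 : 0 < cabs c + 1 by rewrite ltr_wpDl // cabs_ge0.
have r2 : 0 < r / (cabs c + 1) by rewrite divr_gt0.
have [N1 H1] := HA _ r2; have [N2 H2] := HB _ r2; exists (maxn N1 N2) => k.
rewrite geq_max => /andP[/H1 h1 /H2 h2] k0.
have -> : rsum e (oplin S c T) k = oplin (rsum e S k) c (rsum e T k).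
  apply/funext => f; apply/funext => w; rewrite /rsum /oplin /opsum mulr_sumr -big_split /=.
  by apply: eq_bigr => i _; rewrite /shift_op alpha_linear /oplin; ring.
have := dle_oplin c (bounded_rsum e k bS) bA (bounded_rsum e k bT) bB (h1 k0) (h2 k0).
apply: dle_le; rewrite mulrA -[X in X + _]mul1r -mulrA -mulrDl addrC.
by rewrite mulrC divfK // gt_eqF.
Qed.
Lemma rsum_alpha e z S k f : bounded_op S -> in_fock f -> rsum e (alpha z S) k f = alpha z (rsum e S k) f.
Proof.
move=> bS Ff; rewrite /rsum alpha_opsum; apply/funext => w; apply: eq_bigr => i _; congr (_ * _).
by rewrite /shift_op !alpha_alpha // addrC.
Qed.
Lemma isavg_alpha e z S A : bounded_op S -> isavg e S A -> isavg e (alpha z S) (alpha z A).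
Proof.
move=> bS [bA HA]; split; first exact: bounded_alpha.
move=> r /HA[N HN]; exists N => k Nk k0.
apply: dle_eq (dle_alpha z (bounded_rsum e k bS) bA (HN k Nk k0)) => // f Ff.
by rewrite rsum_alpha.
Qed.
(** Averaging commutes with translations and is contractive, so an average inherits the modulus of
    continuity of the operator. *)
Lemma avg_alpha_close e h S A (K : R) : bounded_op S -> isavg e S A ->
  op_dist_le (alpha h S) S K -> op_dist_le (alpha h A) A K.
Proof.
move=> bS aA; exact: (isavg_mono (bounded_alpha h bS) bS (isavg_alpha h bS aA) aA).
Qed.
Lemma Cbu_avg e S A : Cbu S -> isavg e S A -> Cbu A.
Proof.
move=> /CbuP[bS H] aA; apply/CbuP; split; first by case: aA.
move=> r /H[d d0 Hd]; exists d => // h /Hd; exact: (avg_alpha_close bS aA).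
Qed.
Lemma Cbu_linear S T c : Cbu S -> Cbu T -> Cbu (oplin S c T).
Proof.
move=> /CbuP[bS HS] /CbuP[bT HT]; apply/CbuP; split; first exact: bounded_oplin.
move=> r r0; have c0 : 0 < cabs c + 1 by rewrite ltr_wpDl // cabs_ge0.
have r2 : 0 < r / (cabs c + 1) by rewrite divr_gt0.
have [d1 d10 H1] := HS _ r2; have [d2 d20 H2] := HT _ r2.
exists (Num.min d1 d2); first by rewrite lt_min d10.
move=> h; rewrite lt_min alpha_linear => /andP[/H1 h1 /H2 h2].
have := dle_oplin c (bounded_alpha h bS) bS (bounded_alpha h bT) bT h1 h2.
apply: dle_le; rewrite mulrA -[X in X + _]mul1r -mulrA -mulrDl addrC.
by rewrite mulrC divfK // gt_eqF.
Qed.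
Lemma Cbu_alpha z S : Cbu S -> Cbu (alpha z S).
Proof.
move=> /CbuP[bS HS]; apply/CbuP; split; first exact: bounded_alpha.
move=> r /HS[d d0 H]; exists d => // h /H hh.
apply: dle_eq (dle_alpha z (bounded_alpha h bS) bS hh) => // f Ff.
by rewrite !alpha_alpha // addrC.
Qed.
Lemma Cbu0 : Cbu (fun _ _ => 0 : C) (n := n).
Proof.
apply/CbuP; split; first exact: bounded_op0.
move=> r r0; exists 1 => // h _ f Ff.
rewrite (_ : (fun w => _) = fun _ : V => 0 : C); last first.
  by apply/funext => w; rewrite /alpha /weyl mulr0 subrr.
by rewrite fock_norm0 mulr_ge0 ?fock_norm_ge0 // ltW.
Qed.

(* A' is the norm derivative of t |-> alpha_{t d}(A) at t = 0; since B(alpha_z A)(w) = B(A)(w - z),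
   the derivative of B(A) along d is then - B(A'). *)
Definition opderiv d A A' := [/\ bounded_op A, bounded_op A' & forall r : R, 0 < r ->
  exists2 t0 : R, 0 < t0 & forall t : R, `|t| <= t0 ->
    op_dist_le (alpha (t%:C *: d) A) (oplin A t%:C A') (r * `|t|)].

(** The differentiability estimate for [S] is averaged as it stands, by linearity and contractivity.
    This is what permits the axes to be treated one after the other. *)
Lemma opderiv_avg d e S S' A A' : opderiv d S S' -> isavg e S A -> isavg e S' A' -> opderiv d A A'.
Proof.
move=> [bS bS' H] aA aA'; split; [by case: aA | by case: aA' |].
move=> r /H[t0 t00 Ht]; exists t0 => // t /Ht.
apply: isavg_mono; [exact: bounded_alpha | exact: bounded_oplin | exact: (isavg_alpha _ bS aA)|].
exact: isavg_linear.
Qed.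
Lemma opderiv_linear d A A' B B' c : opderiv d A A' -> opderiv d B B' ->
  opderiv d (oplin A c B) (oplin A' c B').
Proof.
move=> [bA bA' HA] [bB bB' HB]; split; try exact: bounded_oplin.
move=> r r0; have c0 : 0 < cabs c + 1 by rewrite ltr_wpDl // cabs_ge0.
have r2 : 0 < r / (cabs c + 1) by rewrite divr_gt0.
have [d1 d10 H1] := HA _ r2; have [d2 d20 H2] := HB _ r2.
exists (Num.min d1 d2); first by rewrite lt_min d10.
move=> t; rewrite le_min alpha_linear => /andP[/H1 h1 /H2 h2].
have bx := bounded_oplin t%:C bA bA'; have bz := bounded_oplin t%:C bB bB'.
have := dle_oplin c (bounded_alpha (t%:C *: d) bA) bx (bounded_alpha (t%:C *: d) bB) bz h1 h2.
have -> : oplin (oplin A t%:C A') c (oplin B t%:C B') = oplin (oplin A c B) t%:C (oplin A' c B').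
  by apply/funext => f; apply/funext => w; rewrite /oplin; ring.
apply: dle_le; rewrite mulrA -mulrDl -[X in X + _]mul1r -mulrDl addrC.
by rewrite (mulrC (_ + _)) divfK // gt_eqF.
Qed.
Lemma opderiv_alpha d z A A' : opderiv d A A' -> opderiv d (alpha z A) (alpha z A').
Proof.
move=> [bA bA' HA]; split; try exact: bounded_alpha.
move=> r /HA[t0 t00 H]; exists t0 => // t /H h.
have := dle_alpha z (bounded_alpha (t%:C *: d) bA) (bounded_oplin t%:C bA bA') h.
rewrite alpha_linear; apply: dle_eq => // f Ff; by rewrite !alpha_alpha // addrC.
Qed.

Definition opscale (c : R) A : op := oplin (fun _ _ => 0) c%:C A.
Lemma bounded_opscale c A : bounded_op A -> bounded_op (opscale c A).
Proof. by move=> bA; apply: bounded_oplin => //; exact: bounded_op0. Qed.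
Lemma opderiv_scale d (c : R) A A' : 0 < c -> opderiv (c%:C *: d) A A' -> opderiv d A (opscale c^-1 A').
Proof.
move=> c0 [bA bA' H]; split => //; first exact: bounded_opscale.
move=> r r0; have [t0 t00 Ht] := H (r * c) (mulr_gt0 r0 c0).
have cn : c != 0 by rewrite gt_eqF.
exists (t0 * c); first by rewrite mulr_gt0.
move=> t tt0; have := Ht (t / c).
rewrite normrM normfV (gtr0_norm c0) ler_pdivrMr // => /(_ tt0).
rewrite scalerA -realCM divfK // (_ : r * c * (`|t| / c) = r * `|t|); last by field.
have -> // : oplin A (t / c)%:C A' = oplin A t%:C (opscale c^-1 A').
by apply/funext => f; apply/funext => w; rewrite /opscale /oplin add0r mulrA -realCM.
Qed.
Lemma opderiv_scaler d (c : R) A A' : opderiv d A A' -> opderiv d (opscale c A) (opscale c A').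
Proof.
move=> H; apply: opderiv_linear => //; split; try exact: bounded_op0.
move=> r r0; exists 1 => // t _ f Ff.
rewrite (_ : (fun w => _) = fun _ : V => 0 : C); last first.
  by apply/funext => w; rewrite /alpha /weyl /oplin !mulr0 addr0 subrr.
by rewrite fock_norm0 mulr_ge0 ?fock_norm_ge0 // mulr_ge0 // ltW.
Qed.

(** Discrete form of the identity that the integral over [q, 1+q] minus that over [0, 1] is the
    integral of F(1+s) - F(s) over [0, q]; the common part of the two windows cancels. *)
Lemma opsum_shift N p (c : R) (a : nat -> op) : opsum N c (fun k => a (k + p)%N) =
  oplin (opsum N c a) 1 (opsum p c (fun k => oplin (a (k + N)%N) (-1) (a k))).
Proof.
elim: p => [|p IH].
  apply/funext => f; apply/funext => w; rewrite /oplin opsum0 mulr0 addr0.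
  by apply: eq_bigr => k _; rewrite addn0.
rewrite opsumS; apply/funext => f; apply/funext => w.
have := congr1 (fun A : op => A f w) IH; rewrite {1 2}/oplin /opsum => E.
rewrite {1 2}/oplin /opsum mulrDr addrA -E.
pose G k := c%:C * a (k + p)%N f w.
have E1 : \sum_(i < N.+1) G i = \sum_(i < N) G i + G N by rewrite big_ord_recr.
have E2 : \sum_(i < N.+1) G i = G 0%N + \sum_(i < N) c%:C * a (i + p.+1)%N f w.
  by rewrite big_ord_recl; congr (_ + _); apply: eq_bigr => i _; rewrite /G lift0 addSn addnS.
have -> : \sum_(i < N) c%:C * a (i + p.+1)%N f w = \sum_(i < N) G i + G N - G 0%N.
  by rewrite -E1 E2 addrC addKr.
rewrite -[\sum_(k < N) c%:C * a (k + p)%N f w]/(\sum_(k < N) G k) /oplin /G add0n [(p + N)%N]addnC; ring.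
Qed.

(** The increment of [A] under translation by te is the integral over [0, t] of the translates of D
    = alpha_e(S) - S, and each of these is within 2K of D. The argument is run on Riemann sums,
    where it is [opsum_shift]. *)
Lemma avg_difference e S A (t K : R) : Cbu S -> isavg e S A -> 0 <= K -> 0 <= t <= 1 ->
  (forall s : R, 0 <= s <= t -> op_dist_le (alpha (s%:C *: e) S) S K) ->
  op_dist_le (alpha (t%:C *: e) A) (oplin A t%:C (oplin (alpha e S) (-1) S)) (t * (2 * K)).
Proof.
move=> cS aA K0 /andP[t0 t1] H; have bS : bounded_op S by case: cS.
have [bA HA] := aA; pose D := oplin (alpha e S) (-1) S.
have bD : bounded_op D by apply: bounded_oplin => //; exact: bounded_alpha.
have [M oD] := bounded_opbd bD; have M0 : 0 <= M by case: oD.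
have M1 : 0 < M + 1 by rewrite ltr_wpDl.
apply: dle_lim => r r0; have r4 : 0 < r / 4 by rewrite divr_gt0.
have [s0 s00 Hs] := Cbu_ray e cS r4.
have [N1 H1] := HA _ r4; have [N2 H2] := inv_nat_small s00; have [N3 H3] := inv_nat_small (divr_gt0 r4 M1).
(* Large enough for three purposes: the Riemann sum is near [A], translation by e/N hardly moves
   [S], and D/N is small. The four errors r/4 are those of steps 1, 2, 4 and 5. *)
pose N := (maxn N1 (maxn N2 N3)).+1.
have h1 : op_dist_le (rsum e S N) A (r / 4) by apply: H1 => //; rewrite leqW // leq_maxl.
have h2 : N%:R^-1 <= s0 by apply: H2 => //; rewrite leqW // leq_max leq_maxl orbT.
have h3 : N%:R^-1 <= r / 4 / (M + 1) by apply: H3 => //; rewrite leqW // leq_max leq_maxr orbT.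
have NR : 0 < (N%:R : R) by rewrite ltr0n.
(* Rounding [t] down to the grid point q = p/N turns translation by qe into a shift of the summation
   index by [p]. *)
pose p := Num.trunc (t * N%:R).
have /andP[p1 p2] := truncn_itv (mulr_ge0 t0 (ltW NR)).
rewrite -/p in p1 p2.
pose q : R := p%:R / N%:R.
have qt : q <= t by rewrite ler_pdivrMr.
have tq : t - q <= N%:R^-1.
  have : t < p.+1%:R / N%:R by rewrite ltr_pdivlMr.
  by rewrite -nat1r mulrDl mul1r lerBlDr => /ltW.
have q0 : 0 <= q by rewrite divr_ge0.
have bR := bounded_rsum e N bS.
have bq := bounded_oplin q%:C bR bD.
have step3 : op_dist_le (alpha (q%:C *: e) (rsum e S N)) (oplin (rsum e S N) q%:C D) (q * (2 * K)).
  pose a k := shift_op e S N k.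
  have ba k : bounded_op (a k) by exact: bounded_alpha.
  have E1 f : in_fock f -> alpha (q%:C *: e) (rsum e S N) f = opsum N N%:R^-1 (fun k => a (k + p)%N) f.
    move=> Ff; rewrite /rsum alpha_opsum; apply/funext => w; apply: eq_bigr => k _; congr (_ * _).
    by rewrite /a /shift_op alpha_alpha // -scalerDl -realCD /q -mulrDl -natrD addnC.
  have E2 : oplin (rsum e S N) q%:C D = oplin (rsum e S N) 1 (opsum p N%:R^-1 (fun=> D)).
    by apply/funext => f; apply/funext => w; rewrite opsum_cst /oplin mul1r.
  rewrite E2; apply: (@dle_eq R n (oplin (rsum e S N) 1 (opsum p N%:R^-1 (fun k => oplin (a (k + N)%N) (-1) (a k)))) _
    (oplin (rsum e S N) 1 (opsum p N%:R^-1 (fun=> D)))) => // [f Ff|].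
    by rewrite E1 // opsum_shift.
  have -> : q * (2 * K) = 0 + cabs (1 : C) * (p%:R * (N%:R^-1 * (2 * K))).
    by rewrite add0r cabs1 mul1r /q; ring.
  have bo k : bounded_op (oplin (a (k + N)%N) (-1) (a k)) by exact: bounded_oplin.
  apply: dle_oplin; rewrite ?bounded_opsum //; try exact: bounded_opsum; first exact: dle_refl.
  apply: dle_opsum => // k kp.
  have -> : 2 * K = K + cabs (-1 : C) * K by rewrite cabsN cabs1 mul1r mulr_natl mulr2n.
  have kt : 0 <= (k%:R / N%:R : R) <= t.
    rewrite divr_ge0 //= (le_trans _ qt) // /q ler_pM2r ?invr_gt0 // ler_nat; exact: ltnW.
  apply: dle_oplin => //; try exact: bounded_alpha; last exact: H.
  apply: alpha_diff => //; have -> : ((k + N)%:R / N%:R : R)%:C *: e - e = (k%:R / N%:R : R)%:C *: e.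
    by rewrite natrD mulrDl divff ?gt_eqF // realCD realC1 scalerDl scale1r addrK.
  exact: H.
have qn : `|t - q| <= N%:R^-1 by rewrite ger0_norm // subr_ge0.
have step1 : op_dist_le (alpha (t%:C *: e) A) (alpha (q%:C *: e) A) (r / 4).
  apply: alpha_diff => //; apply: (avg_alpha_close bS aA); rewrite -scalerBl -realCB.
  by apply: Hs; exact: le_trans qn h2.
have step2 : op_dist_le (alpha (q%:C *: e) A) (alpha (q%:C *: e) (rsum e S N)) (r / 4).
  by apply: dle_alpha => //; exact: dle_sym.
have step4 : op_dist_le (oplin (rsum e S N) q%:C D) (oplin A q%:C D) (r / 4).
  have := dle_oplin q%:C bR bA bD bD h1 (dle_refl D (lexx 0)); by rewrite mulr0 addr0.
have step5 : op_dist_le (oplin A q%:C D) (oplin A t%:C D) (r / 4).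
  move=> f Ff; have LD := fockL2 (opbd_fock oD Ff).
  have -> : (fun w => oplin A q%:C D f w - oplin A t%:C D f w) = fun w => (q - t)%:C * D f w.
    by apply/funext => w; rewrite /oplin realCB; ring.
  rewrite fock_normZ // cabs_real distrC.
  apply: (@le_trans _ _ (r / 4 / (M + 1) * (M * fock_norm f))).
    by apply: ler_pM; rewrite ?fock_norm_ge0 //; [exact: le_trans qn h3 | exact: opbd_le].
  rewrite mulrA ler_wpM2r ?fock_norm_ge0 // mulrAC ler_pdivrMr // ler_wpM2l ?(ltW r4) //.
  by rewrite lerDl.
have bqA := bounded_oplin q%:C bA bD; have btA := bounded_oplin t%:C bA bD.
have b1 := bounded_alpha (t%:C *: e) bA; have b2 := bounded_alpha (q%:C *: e) bA.
have b3 := bounded_alpha (q%:C *: e) bR.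
have := dle_tri b1 b2 btA step1 (dle_tri b2 b3 btA step2 (dle_tri b3 bq btA step3 (dle_tri bq bqA btA step4 step5))).
apply: dle_le; have : q * (2 * K) <= t * (2 * K) by rewrite ler_wpM2r // mulr_ge0.
lra.
Qed.

(** A negative [t] is reduced to s = -t by translating the estimate at s back by se; the derivative
    is then taken at the translated point, which is repaired by the continuity of its translates. *)
Lemma opderiv_isavg e S A : Cbu S -> isavg e S A -> opderiv e A (oplin (alpha e S) (-1) S).
Proof.
move=> cS aA; have bS : bounded_op S by case: cS.
have bA : bounded_op A by case: aA.
pose D := oplin (alpha e S) (-1) S; have bD : bounded_op D by apply: bounded_oplin => //; exact: bounded_alpha.
(* [avg_difference] doubles r/4 to r/2; for negative [t] the variation of [D] costs another r/2. *)
split => // r r0; have r4 : 0 < r / 4 by rewrite divr_gt0.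
have [s0 s00 Hs] := Cbu_ray e cS r4.
exists (Num.min 1 s0); first by rewrite lt_min ltr01.
move=> t; rewrite le_min => /andP[t1 ts].
have pos s : 0 <= s <= 1 -> s <= s0 -> op_dist_le (alpha (s%:C *: e) A) (oplin A s%:C D) (s * (2 * (r / 4))).
  move=> s01 ss; apply: avg_difference => //; first exact: ltW.
  move=> u /andP[u0 us]; apply: Hs; rewrite ger0_norm //; exact: le_trans us ss.
have [t0|t0] := leP 0 t.
  rewrite ger0_norm // in t1 ts *; have := pos t; rewrite t0 t1 => /(_ isT ts).
  apply: dle_le; rewrite mulrC ler_wpM2r //; lra.
rewrite ltr0_norm // in t1 ts *; pose s := - t; have s_gt0 : 0 < s by rewrite oppr_gt0.
have := pos s; rewrite (ltW s_gt0) t1 => /(_ isT ts) h.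
have ss : op_dist_le (alpha ((- s)%:C *: e) S) S (r / 4) by apply: Hs; rewrite normrN gtr0_norm.
have bm := bounded_alpha ((- s)%:C *: e) bD.
have hD : op_dist_le (alpha ((- s)%:C *: e) D) D (2 * (r / 4)).
  rewrite alpha_linear; have -> : 2 * (r / 4) = r / 4 + cabs (-1 : C) * (r / 4).
    by rewrite cabsN cabs1 mul1r mulr_natl mulr2n.
  apply: dle_oplin => //; try exact: bounded_alpha; try by do 2!apply: bounded_alpha.
  apply: dle_eq (dle_alpha e (bounded_alpha ((- s)%:C *: e) bS) bS ss) => // f Ff.
  by rewrite !alpha_alpha // addrC.
have bs := bounded_alpha (s%:C *: e) bA; have bl := bounded_oplin s%:C bA bD.
have := dle_alpha ((- s)%:C *: e) bs bl h; rewrite alpha_linear => h1.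
have bA' := bounded_alpha ((- s)%:C *: e) bA.
have h2 := dle_oplin s%:C bA' bA' bm bD (dle_refl _ (lexx 0)) hD.
have h3 : op_dist_le (oplin (alpha ((- s)%:C *: e) A) s%:C D) A (s * r).
  have bx := bounded_oplin s%:C bA' bm; have bz := bounded_oplin s%:C bA' bD.
  apply: (dle_le _ (dle_tri bz bx bA (dle_sym bx bz h2) (dle_sym bA bx _))); last first.
    apply: dle_eq h1 => // f Ff; rewrite alpha_alpha // -scalerDl -realCD addNr scale0r alpha0 //.
  rewrite cabs_real gtr0_norm //; lra.
move=> f Ff; have := h3 f Ff; rewrite /oplin /s opprK realCN.
have -> // : (fun w => alpha (t%:C *: e) A f w + - t%:C * D f w - A f w) =
   (fun w => alpha (t%:C *: e) A f w - (A f w + t%:C * oplin (alpha e S) (-1) S f w)).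
  by apply/funext => w; rewrite /D; ring.
by rewrite [r * _]mulrC.
Qed.

(** The derivatives are kept in C_{b,u} because [isavg_exists] must be able to average them along
    the next directions. *)
Definition op2 d A := exists A' A'', [/\ Cbu A, Cbu A', Cbu A'', opderiv d A A' & opderiv d A' A''].

Lemma op2_avg d e S A : op2 d S -> isavg e S A -> op2 d A.
Proof.
move=> [S' [S'' [cS cS' cS'' d1 d2]]] aA.
have [A' aA'] := isavg_exists e cS'; have [A'' aA''] := isavg_exists e cS''.
exists A', A''; split; try by [apply: Cbu_avg aA | apply: Cbu_avg aA' | apply: Cbu_avg aA''].
  exact: opderiv_avg aA aA'.
exact: opderiv_avg aA' aA''.
Qed.

Lemma Cbu_opscale c S : Cbu S -> Cbu (opscale c S).
Proof. by move=> cS; apply: Cbu_linear => //; exact: Cbu0. Qed.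

(** Average twice along a short vector e = td, at a cost of r/2 each time. The derivative of the
    second average [A2] along e is (alpha_e - 1) A1, and that of [A1] is [D1] = (alpha_e - 1) S, so
    the second derivative is (alpha_e - 1) D1. Factors 1/t pass from e to d. The last clause
    protects the directions treated before. *)
Lemma smooth_direction S d (r : R) : Cbu S -> 0 < r -> exists S',
  [/\ Cbu S', op_dist_le S' S r, op2 d S' & forall d', op2 d' S -> op2 d' S'].
Proof.
move=> cS r0; have r2 : 0 < r / 2 by rewrite divr_gt0.
have bS : bounded_op S by case: cS.
have [t t0 Ht] := Cbu_ray d cS r2; pose e := t%:C *: d.
have He s : 0 <= s <= 1 -> op_dist_le (alpha (s%:C *: e) S) S (r / 2).
  move=> /andP[s0 s1]; rewrite /e scalerA -realCM; apply: Ht.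
  by rewrite ger0_norm ?mulr_ge0 ?(ltW t0) // ler_piMl // ltW.
have [A1 a1] := isavg_exists e cS; have c1 := Cbu_avg cS a1; have b1 : bounded_op A1 by case: a1.
have [A2 a2] := isavg_exists e c1; have c2 := Cbu_avg c1 a2; have b2 : bounded_op A2 by case: a2.
have h1 : op_dist_le A1 S (r / 2) by apply: isavg_close a1 He.
have h2 : op_dist_le A2 A1 (r / 2).
  by apply: isavg_close a2 _ => // s /He; exact: (avg_alpha_close bS a1).
exists A2; split => //; first by rewrite (splitr r); exact: dle_tri h2 h1.
  have d1 := opderiv_isavg cS a1; have d2 := opderiv_isavg c1 a2.
  pose D1 := oplin (alpha e S) (-1) S.
  have d3 := opderiv_linear (-1) (opderiv_alpha e d1) d1.
  exists (opscale t^-1 (oplin (alpha e A1) (-1) A1)), (opscale t^-1 (opscale t^-1 (oplin (alpha e D1) (-1) D1))).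
  have cD1 : Cbu D1 by apply: Cbu_linear => //; exact: Cbu_alpha.
  split => //.
  - by apply: Cbu_opscale; apply: Cbu_linear => //; exact: Cbu_alpha.
  - by do 2!apply: Cbu_opscale; apply: Cbu_linear => //; exact: Cbu_alpha.
  - exact: opderiv_scale.
  - by apply: opderiv_scaler; exact: opderiv_scale.
by move=> d' o2; apply: op2_avg a2; exact: op2_avg a1.
Qed.

Lemma smooth_directions S (s : seq V) (r : R) : Cbu S -> 0 < r -> exists S',
  [/\ Cbu S', op_dist_le S' S r & forall d, d \in s -> op2 d S'].
Proof.
move=> cS; elim: s r => [|d s IH] r r0; first by exists S; split => //; apply: dle_refl; exact: ltW.
have r2 : 0 < r / 2 by rewrite divr_gt0.
have [S1 [c1 h1 o1]] := IH _ r2; have [S2 [c2 h2 o2 o3]] := smooth_direction d c1 r2.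
exists S2; split => //.
  by rewrite (splitr r); apply: (dle_tri _ _ _ h2 h1); [case: c2 | case: c1 | case: cS].
by move=> d'; rewrite inE => /orP[/eqP -> //|/o1/o3].
Qed.

Lemma berezin_oplin A c B z : bounded_op A -> bounded_op B ->
  berezin (oplin A c B) z = berezin A z + c * berezin B z.
Proof.
move=> bA bB; have Fk := in_fock_kz z; have LA := bounded_L2 bA Fk; have LB := bounded_L2 bB Fk.
by rewrite /berezin /oplin fock_innerDl ?fock_innerZl //; try exact: fockL2; exact: L2Z.
Qed.
Lemma berezin_dle A B (K : R) z : bounded_op A -> bounded_op B -> op_dist_le A B K ->
  cabs (berezin A z - berezin B z) <= 2 * K.
Proof.
move=> bA bB h; have Fk := in_fock_kz z; have Lk := fockL2 Fk.
have LA := bounded_L2 bA Fk; have LB := bounded_L2 bB Fk.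
rewrite /berezin -fock_innerBl //; apply: le_trans (fock_inner_le (L2B LA LB) Lk) _.
by have := h _ Fk; rewrite fock_norm_kz !mulr1 => hh; rewrite ler_wpM2l.
Qed.

Lemma opderiv_berezin d A A' z : opderiv d A A' -> has_rderiv (berezin A) z d (- berezin A' z).
Proof.
move=> [bA bA' H] r r0; have r4 : 0 < r / 4 by rewrite divr_gt0.
have [t0 t00 Ht] := H _ r4; exists t0 => // t /andP[tn tt0].
(* Taken at -t, since the translate by -td has the Berezin transform B(A)(z + td) at z; hence the
   sign of the derivative. *)
have h := Ht (- t); rewrite normrN (ltW tt0) in h; have {}h := h isT.
have bx := bounded_alpha ((- t)%:C *: d) bA; have bl := bounded_oplin (- t)%:C bA bA'.
have := berezin_dle z bx bl h.
rewrite berezin_alpha // berezin_oplin // realCN scaleNr opprK => hh.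
have tC : (t%:C : C) != 0 by apply/eqP => E; move: tn; rewrite -(cabs_real t) E cabs0 ltxx.
have -> : (berezin A (z + t%:C *: d) - berezin A z) / t%:C - - berezin A' z =
   (berezin A (z + t%:C *: d) - (berezin A z + - t%:C * berezin A' z)) / t%:C by field.
rewrite cabsM cabsV cabs_real ltr_pdivrMr //; apply: le_lt_trans hh _.
rewrite mulrA ltr_pM2r //; lra.
Qed.

Lemma berezin_sum (I : Type) (s : seq I) (X : I -> op) : (forall i, bounded_op (X i)) ->
  exists2 T, bounded_op T & forall z, berezin T z = \sum_(i <- s) berezin (X i) z.
Proof.
move=> bX; elim: s => [|i s [T bT E]].
  exists (fun _ _ => 0); first exact: bounded_op0.
  move=> z; rewrite big_nil /berezin; have Lk := fockL2 (in_fock_kz z).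
  have -> : (fun _ : V => 0 : C) = fun w => 0 * kz z w by apply/funext => w; rewrite mul0r.
  by rewrite fock_innerZl // mul0r.
exists (oplin (X i) 1 T); first exact: bounded_oplin.
by move=> z; rewrite big_cons berezin_oplin // mul1r E.
Qed.

(** Each derivative brings a sign, and two of them cancel: the second derivatives of B(S) are the
    Berezin transforms of the second operator derivatives. The witness [T] is a quarter of their sum
    over the 2n real axes. *)
Lemma op2_W2inf S : bounded_op S -> (forall b i, op2 (rdir R b i) S) -> W2inf S.
Proof.
move=> bS H; split => //.
have [X HX] := choice (fun i => H false i); have [XX HXX] := choice HX.
have [Y HY] := choice (fun i => H true i); have [YY HYY] := choice HY.
have bXX i : bounded_op (XX i) by have [_ _ []] := HXX i.
have bYY i : bounded_op (YY i) by have [_ _ []] := HYY i.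
have [T bT ET] := berezin_sum (index_enum 'I_n) (fun i => bounded_oplin 1 (bXX i) (bYY i)).
exists (oplin (fun _ _ => 0) (4%:R^-1 : R)%:C T); split.
  by apply: bounded_oplin => //; exact: bounded_op0.
have NN d A B z : opderiv d A B -> has_rderiv (fun w => - berezin A w) z d (berezin B z).
  move=> /(@opderiv_berezin _ _ _ z)/(has_rderivZ (-1)); rewrite mulN1r opprK.
  by under eq_fun do rewrite mulN1r.
exists (fun i z => - berezin (X i) z), (fun i z => - berezin (Y i) z),
   (fun i z => berezin (XX i) z), (fun i z => berezin (YY i) z).
split=> [i z|]; first by have [_ _ _ d1 _] := HXX i; rewrite -[ec R i]scale1r; exact: opderiv_berezin.
split=> [i z|]; first by have [_ _ _ d1 _] := HYY i; exact: opderiv_berezin.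
split=> [i z|]; first by have [_ _ _ _ d2] := HXX i; rewrite -[ec R i]scale1r; exact: NN.
split=> [i z|z]; first by have [_ _ _ _ d2] := HYY i; exact: NN.
rewrite berezin_oplin //; last exact: bounded_op0.
have -> : berezin (fun _ _ => 0) z = 0 :> C.
  have [T0 _ /(_ z)] := @berezin_sum nat [::] (fun _ => S) (fun _ => bS).
  rewrite big_nil /berezin => _; have Lk := fockL2 (in_fock_kz z).
  have -> : (fun _ : V => 0 : C) = fun w => 0 * kz z w by apply/funext => w; rewrite mul0r.
  by rewrite fock_innerZl // mul0r.
rewrite add0r ET; congr (_ * _); apply: eq_bigr => i _.
by rewrite berezin_oplin // mul1r.
Qed.

Lemma Cbu_closure S : Cbu S -> W2inf_closure S.
Proof.
move=> cS; have bS : bounded_op S by case: cS.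
split => // r r0.
have [T [cT hT oT]] := smooth_directions [seq rdir R p.1 p.2 | p : bool * 'I_n] cS r0.
have bT : bounded_op T by case: cT.
exists T; last exact: dle_sym.
apply: op2_W2inf => // b i; apply: oT.
exact: (codom_f (fun p : bool * 'I_n => rdir R p.1 p.2) (b, i)).
Qed.
End Averages.

Theorem theorem4p4 (R : realType) (n : nat) (hn : (1 <= n)%N) (S : op R n) :
  Cbu S <-> W2inf_closure S.
Proof.
split; first exact: Cbu_closure.
move=> [bS H]; apply: Cbu_closed => // e /H[T wT ST].
by exists T => //; exact: W2inf_Cbu.
Qed.
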